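(* The Euclidean plane satisfies the log-honeycomb property; that is, there is a hexagonal tiling $\mathcal{T}_{hex}$ of the Euclidean plane $\mathbb{R}^2$ with unit area cells such that for every convex, normal tiling $\mathcal{T}$ of $\mathbb{R}^2$ with unit area cells, \[ \underline{P}_{\log}(\mathcal{T})\ge P_{\log}(\mathcal{T}_{hex}). \]
   Context: A tiling is a countable family of compact sets (cells) with nonempty interiors, whose union is $\mathbb{R}^2$ and such that the interiors of any two distinct cells are disjoint. It is convex if every cell is convex. A convex tiling is normal if there are constants $0<\hat r<\hat R$ such that every cell contains a Euclidean disk of radius $\hat r$ and is contained in a Euclidean disk of radius $\hat R$. A hexagonal tiling is a tiling whose cells are translates of a given centrally symmetric convex hexagon; angles of cells are permitted to be straight angles, so the hexagon may be degenerate. Let $\mathbf{B}^2$ be the Euclidean closed unit disk centered at the origin, $\mathrm{perim}(C)$ the Euclidean perimeter of a convex cell $C$, and, for a convex, normal tiling $\mathcal{T}$ and $R>0$, let $\mathcal{T}(R)$ be the family of cells of $\mathcal{T}$ contained in $R\mathbf{B}^2$. Then \[ \underline{P}_{\log}(\mathcal{T})=\liminf_{R\to\infty}\frac{\sum_{C\in\mathcal{T}(R)}\log(\mathrm{perim}(C))}{\mathrm{card}(\mathcal{T}(R))}, \] $\overline{P}_{\log}(\mathcal{T})$ is the same with $\limsup$, and if the two are equal the common value is denoted by $P_{\log}(\mathcal{T})$. *)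

(* Defs.v *)
From HB Require Import structures.
From mathcomp Require Import all_boot all_order all_algebra finmap.
From mathcomp Require Import all_classical all_reals all_analysis.

Set Implicit Arguments.
Unset Strict Implicit.
Unset Printing Implicit Defensive.

Import Order.TTheory GRing.Theory Num.Theory.
Import numFieldNormedType.Exports.

Local Open Scope classical_set_scope.
Local Open Scope ring_scope.

Section LogHoneycomb.
Context {R : realType}.

Local Notation plane := (R * R)%type.

Implicit Types (p q s : plane) (C H : set plane) (T : set (set plane)).

(* The library norm on R * R is the max norm. Only its topology, linear
   structure and product Borel structure are used here; everything metric is
   expressed with the Euclidean distance below. *)
Definition edist p q : R :=
  Num.sqrt ((p.1 - q.1) ^+ 2 + (p.2 - q.2) ^+ 2).

Definition disk p (r : R) : set plane := [set q | edist p q <= r].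

Definition area C : \bar R :=
  (@lebesgue_measure R \x @lebesgue_measure R)%E C.

(* Twice the signed area of the triangle p q s: positive when p, q, s is a
   counterclockwise triple, zero when the points are collinear. *)
Definition orient p q s : R :=
  (q.1 - p.1) * (s.2 - p.2) - (q.2 - p.2) * (s.1 - p.1).

Definition boundary C : set plane := closure C `\` C°.

(* The polygon with vertices v_0, ..., v_(n-1) is convex, has no straight angle
   and is listed counterclockwise, starting anywhere on its boundary. For
   n <= 2 (points and doubled segments) there is no condition. *)
Definition strictly_ccw n (v : 'I_n -> plane) : Prop :=
  forall i j k : 'I_n, (i < j < k)%N -> 0 < orient (v i) (v j) (v k).

(* Same, but straight angles are permitted. *)
Definition weakly_ccw n (v : 'I_n -> plane) : Prop :=
  injective v /\
  forall i j k : 'I_n, (i < j < k)%N -> 0 <= orient (v i) (v j) (v k).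

(* Length of the closed polygonal line v_0 v_1 ... v_(n-1) v_0; [ordS] is the
   cyclic successor. *)
Definition closed_length n (v : 'I_n -> plane) : R :=
  \sum_(i < n) edist (v i) (v (ordS i)).

(* Arc length of the boundary curve of a convex body: the supremum of the
   lengths of the closed polygonal lines whose vertices lie on the boundary and
   follow it in cyclic order. For points on the boundary of a convex body the
   cyclic order is the counterclockwise order; asking for strict convexity only
   discards vertices lying on the segment joining their neighbours, which do
   not contribute to the length. *)
Definition perim C : R :=
  sup [set l | exists n (v : 'I_n -> plane),
    [/\ forall i, boundary C (v i), strictly_ccw v & l = closed_length v]].

(* A family is given by its set of cells: since cells have nonempty interiors
   and the interiors of distinct cells are disjoint, no cell is repeated. *)
Definition tiling T : Prop :=
  [/\ countable T,
      forall C, T C -> compact C /\ C° !=set0,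
      \bigcup_(C in T) C = setT &
      forall C D, T C -> T D -> C <> D -> C° `&` D° = set0].

Definition convex_tiling T : Prop :=
  tiling T /\
  forall C, T C -> convex_set (C : set (convex_lmodType plane)).

Definition normal_tiling T : Prop :=
  exists r0 R0 : R,
    0 < r0 < R0 /\
    forall C, T C ->
      (exists c, disk c r0 `<=` C) /\ (exists c, C `<=` disk c R0).

Definition unit_area_cells T : Prop := forall C, T C -> area C = 1%E.

Definition convex_hull n (v : 'I_n -> plane) : set plane :=
  [set p | exists w : 'I_n -> R,
    [/\ forall i, 0 <= w i, \sum_(i < n) w i = 1 &
        p = \sum_(i < n) w i *: v i]].

Definition convex_hexagon H : Prop :=
  H° !=set0 /\ exists v : 'I_6 -> plane, weakly_ccw v /\ H = convex_hull v.

Definition centrally_symmetric H : Prop :=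
  exists o, forall p, H p -> H (o *+ 2 - p).

Definition hexagonal_tiling T : Prop :=
  tiling T /\
  exists H, [/\ convex_hexagon H, centrally_symmetric H &
    forall C, T C -> exists t, C = [set t + p | p in H]].

Definition cells_in T (r : R) : set (set plane) :=
  [set C | T C /\ C `<=` disk 0 r].

(* For a normal tiling [cells_in T r] is finite, so both the finitely supported
   sum and [fset_set] have their intended meaning. The value for small r, when
   there may be no cell at all, is irrelevant for the limits at infinity. *)
Definition mean_log_perim T (r : R) : R :=
  (\sum_(C \in cells_in T r) ln (perim C)) /
  (#|` fset_set (cells_in T r)|)%:R.

Definition Plog_inf T : \bar R :=
  limf_einf (fun r : R => (mean_log_perim T r)%:E) (pinfty_nbhs R).

Definition Plog_sup T : \bar R :=
  limf_esup (fun r : R => (mean_log_perim T r)%:E) (pinfty_nbhs R).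

Definition has_Plog T (P : R) : Prop :=
  Plog_inf T = P%:E /\ Plog_sup T = P%:E.

End LogHoneycomb.

(* Main.v *)
Require Import Defs.
From HB Require Import structures.
From mathcomp Require Import all_boot all_order all_algebra finmap.
From mathcomp Require Import all_classical all_reals all_analysis.
From mathcomp Require Import zify ring lra.

Set Implicit Arguments.
Unset Strict Implicit.
Unset Printing Implicit Defensive.

Import Order.TTheory GRing.Theory Num.Theory.
Import numFieldNormedType.Exports.
(* The analysis library has another [edist]. *)
Import Defs.

Local Open Scope classical_set_scope.
Local Open Scope ring_scope.

(** An n-gon of area A and perimeter L satisfies L^2 >= 4 n tan(pi/n) A, and
    4 n tan(pi/n) >= 8 sqrt 3 q^(6-n) with q = 22/21, equality holding at n = 6.
    So the log-perimeter of a unit-area cell with n corners is at least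
    ln(8 sqrt 3)/2 - (ln q/2)(n - 6), and it suffices that cells have at most 6
    corners on average. A corner v of a cell is not interior to any cell; among
    the cells having v as a corner, at most two do not have v as their
    lexicographically first or last point, and some cell of the tiling does have
    it so. Hence at most three times as many cells have v as a corner as have it
    as a lexicographic extremity; since a cell has only two extremities, the
    corners number at most 6 per cell. Only the cells near the boundary of the
    disk of radius R disturb this count, and as cells have unit area and bounded
    diameter their proportion is O(1/R).

    The perimeter of the regular hexagon of unit area is at most its hexagonal
    perimeter, namely the sum over the three normals of the total variation of
    the inner product along the boundary, which gives the matching upper bound. *)

(** * Isoperimetric inequality for polygons *)

(** Wirtinger bounds the area by the sum of the squared sides, and Cauchy-Schwarz compares this sum
    with [L ^ 2 / n] in the wrong direction unless all sides are equal; hence the detour through a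
    maximizing polygon, whose sides are forced to be equal. The logarithmic bound is affine in the
    number of corners, so averaging it over cells involves only the mean number of corners. Any [q]
    between about 1.028 (from [n = 7]) and 1.0487 (from [n = 5]) satisfies the inequality; 22/21
    leaves room from 7 on, where [pi] and the tangent are estimated crudely. Corners are the extreme
    points of a single cell, so a vertex of the tiling inside a side of a cell is not counted for
    that cell. Lexicographic extremities play the part of Euler's formula. If [v] were an extremity
    of no cell, at most two cells would contain it, and two convex cells with disjoint interiors
    cannot surround a corner of one of them. The same fact shows that a cell has finitely many
    corners: each is an extremity of one of the finitely many nearby cells. *)

Section Wirtinger.
Context {R : realType}.

Lemma ordS_bij n : bijective (@ordS n).
Proof. exact: injF_bij (@ordS_inj n). Qed.

Lemma sum_ordS (V : nmodType) n (f : 'I_n -> V) :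
  \sum_(i < n) f (ordS i) = \sum_(i < n) f i.
Proof. by rewrite [RHS](reindex _ (onW_bij _ (ordS_bij n))). Qed.

Lemma cosD2pin (a : R) k : cos (a + pi *+ 2 *+ k) = cos a.
Proof. exact: periodicn (@cosD2pi R) k a. Qed.

Lemma sinD2pin (a : R) k : sin (a + pi *+ 2 *+ k) = sin a.
Proof. exact: periodicn (@sinD2pi R) k a. Qed.

(** * Discrete Wirtinger inequality by finite Fourier analysis *)

Section dft.
Variables (n : nat).
Hypothesis n1 : (1 < n)%N.
Let t : R := pi *+ 2 / n%:R.

Let nR0 : n%:R != 0 :> R.
Proof. by rewrite pnatr_eq0 -lt0n (ltn_trans _ n1). Qed.

Let tn : t *+ n = pi *+ 2.
Proof. by rewrite /t -[LHS]mulr_natr divfK. Qed.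

(** At the last index [ordS j] is 0 instead of [n]; the two angles then differ by [k] full turns. *)
Let cosS (k : nat) (j : 'I_n) :
  cos (t *+ (k * ordS j)) = cos (t *+ (k * j) + t *+ k).
Proof.
rewrite -mulrnDr addnC -mulnS /=; have := ltn_ord j.
rewrite leq_eqVlt => /predU1P[->|jn]; last by rewrite modn_small.
by rewrite modnn muln0 mulr0n mulnC mulrnA tn -[X in _ = cos X]add0r cosD2pin.
Qed.

Let sinS (k : nat) (j : 'I_n) :
  sin (t *+ (k * ordS j)) = sin (t *+ (k * j) + t *+ k).
Proof.
rewrite -mulrnDr addnC -mulnS /=; have := ltn_ord j.
rewrite leq_eqVlt => /predU1P[->|jn]; last by rewrite modn_small.
by rewrite modnn muln0 mulr0n mulnC mulrnA tn -[X in _ = sin X]add0r sinD2pin.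
Qed.

(** The frequencies [k] and [n - k] have the same cosine, so the angle may be assumed at most [pi],
    where cosine decreases. *)
Let cos_lt_cost (k : nat) : (0 < k < n)%N -> cos (t *+ k) <= cos t.
Proof.
have t0 : 0 < t by rewrite divr_gt0 ?ltr0n ?(ltn_trans _ n1)// mulrn_wgt0// pi_gt0.
wlog kn : k / (k <= n - k)%N => [H /andP[k0 kn]|/andP[k0 k_n]].
  have [/H->//|kk] := leqP k (n - k); first by rewrite k0.
  have -> : cos (t *+ k) = cos (t *+ (n - k)).
    rewrite mulrnBr 1?ltnW// tn -[RHS]cosN opprB.
    by rewrite -[RHS](cosD2pin _ 1) mulr1n subrK.
  by apply: H; [rewrite subKn; lia|lia].
have tk : t *+ k <= pi.
  rewrite -(@ler_pMn2r _ 2)// -tn -mulrnA ler_pMn2l//; lia.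
rewrite leNgt; apply/negP => ct.
move: (ct); rewrite (ltr_cos) ?in_itv/= ?mulrn_wge0 ?(ltW t0) ?tk//.
  by rewrite -[ltRHS]mulr1n ltr_pMn2l //; lia.
by rewrite (le_trans _ tk)// -[leLHS]mulr1n ler_pMn2l.
Qed.

(** Shifting the index rotates the vector of the two sums by the angle [t *+ m], which is not a full
    turn, so this vector is 0. The linear system has determinant [(1 - c) ^+ 2 + s ^+ 2]. *)
Let sum_cos (m : nat) : (0 < m < n)%N ->
  \sum_(k < n) cos (t *+ (m * k)) = 0 /\ \sum_(k < n) sin (t *+ (m * k)) = 0.
Proof.
move=> m0n.
set S := \sum_(k < n) cos _; set S' := \sum_(k < n) sin _.
have ES : S = cos (t *+ m) * S - sin (t *+ m) * S'.
  rewrite {1}/S -sum_ordS 2!mulr_sumr -sumrB; apply: eq_bigr => j _.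
  by rewrite cosS cosD; ring.
have ES' : S' = cos (t *+ m) * S' + sin (t *+ m) * S.
  rewrite {1}/S' -sum_ordS 2!mulr_sumr -big_split; apply: eq_bigr => j _.
  by rewrite sinS sinD /=; ring.
have c1 : cos (t *+ m) < 1.
  apply: le_lt_trans (cos_lt_cost m0n) _; rewrite -cos0 ltr_cos ?in_itv/= ?lexx ?pi_ge0//.
    by rewrite divr_gt0 ?ltr0n ?(ltn_trans _ n1)// mulrn_wgt0// pi_gt0.
  rewrite /t; apply/andP; split.
    by apply: divr_ge0 => //; apply: mulrn_wge0; exact: pi_ge0.
  rewrite ler_pdivrMr ?ltr0n ?(ltn_trans _ n1)// -[leLHS]mulr_natr.
  by rewrite ler_wpM2l ?pi_ge0// ler_nat.
have := cos2Dsin2 (t *+ m); move: ES ES' c1.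
set c := cos _; set s := sin _ => ES ES' c1 cs.
have d0 : (1 - c) ^+ 2 + s ^+ 2 != 0 by rewrite gt_eqF// ltr_wpDr ?sqr_ge0// exprn_gt0// subr_gt0.
split; apply: (mulfI d0); rewrite mulr0.
  have -> : ((1 - c) ^+ 2 + s ^+ 2) * S = (1 - c) * (S - (c * S - s * S')) - s * (S' - (c * S' + s * S)) by ring.
  by rewrite -ES -ES' !subrr !mulr0 subrr.
have -> : ((1 - c) ^+ 2 + s ^+ 2) * S' = (1 - c) * (S' - (c * S' + s * S)) + s * (S - (c * S - s * S')) by ring.
by rewrite -ES -ES' !subrr !mulr0 addr0.
Qed.

(** Cosine and sine parts of the [k]-th Fourier coefficient of [x]. *)
Let C (x : 'I_n -> R) (k : nat) := \sum_(j < n) x j * cos (t *+ (k * j)).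
Let S (x : 'I_n -> R) (k : nat) := \sum_(j < n) x j * sin (t *+ (k * j)).

Let sum_cosB (j l : 'I_n) :
  \sum_(k < n) (cos (t *+ (k * j)) * cos (t *+ (k * l)) +
                sin (t *+ (k * j)) * sin (t *+ (k * l))) = (j == l)%:R * n%:R.
Proof.
under eq_bigr do rewrite -cosB.
wlog jl : j l / (l <= j)%N => [H|].
  have [/H//|/ltnW/H] := leqP l j; rewrite eq_sym => <-; apply: eq_bigr => k _.
  by rewrite -cosN opprB.
under eq_bigr do rewrite -mulrnBr ?leq_mul2l ?jl ?orbT// -mulnBr mulnC.
have [->|/eqP nlj] := eqVneq j l.
  under eq_bigr do rewrite subnn mul0n mulr0n cos0.
  by rewrite sumr_const card_ord mul1r.
rewrite mul0r; apply (sum_cos (m := j - l)); have := ltn_ord j.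
by have : nat_of_ord j <> l by [move=> /val_inj]; lia.
Qed.

Let parseval (x : 'I_n -> R) :
  \sum_(k < n) (C x k ^+ 2 + S x k ^+ 2) = n%:R * \sum_(j < n) x j ^+ 2.
Proof.
transitivity (\sum_(k < n) \sum_(j < n) \sum_(l < n) (x j * x l *
   (cos (t *+ (k * j)) * cos (t *+ (k * l)) +
                sin (t *+ (k * j)) * sin (t *+ (k * l))))).
  apply: eq_bigr => k _; rewrite !expr2 !big_distrlr/= -big_split; apply: eq_bigr => j _.
  by rewrite -big_split; apply: eq_bigr => l _ /=; ring.
rewrite exchange_big mulr_sumr; apply: eq_bigr => j _.
rewrite exchange_big/= (bigD1 j)//= [X in _ + X]big1 ?addr0 => [|l /negPf lj].
  by rewrite -mulr_sumr sum_cosB eqxx mul1r mulrC expr2.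
by rewrite -mulr_sumr sum_cosB eq_sym lj mul0r mulr0.
Qed.

(** Taking differences multiplies the squared modulus of the [k]-th Fourier coefficient by
    [|exp (i t k) - 1| ^ 2 = 2 - 2 cos (t k)]. The zero sum kills coefficient 0, and over the other
    frequencies the multiplier is least at [k = 1]. *)
Lemma scalar_wirtinger (x : 'I_n -> R) : \sum_j x j = 0 ->
  (2 - 2 * cos t) * \sum_j x j ^+ 2 <= \sum_j (x (ordS j) - x j) ^+ 2.
Proof.
move=> x0.
have nR : 0 < n%:R :> R by rewrite ltr0n (ltn_trans _ n1).
rewrite -(ler_pM2l nR) mulrCA -!parseval mulr_sumr; apply: ler_sum => k _.
pose d j := x (ordS j) - x j.
rewrite -/d.
have Cd : C d k = cos (t *+ k) * C x k + sin (t *+ k) * S x k - C x k.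
  transitivity (\sum_(j < n) x (ordS j) * cos (t *+ (k * ordS j) - t *+ k) - C x k).
    rewrite -sumrB; apply: eq_bigr => j _.
    rewrite [in RHS]cosB cosS sinS -cosB addrK; rewrite /d; ring.
  congr (_ - _); rewrite (sum_ordS (fun j => x j * cos (t *+ (k * j) - t *+ k))).
  by rewrite !mulr_sumr -big_split; apply: eq_bigr => j _; rewrite cosB/=; ring.
have Sd : S d k = cos (t *+ k) * S x k - sin (t *+ k) * C x k - S x k.
  transitivity (\sum_(j < n) x (ordS j) * sin (t *+ (k * ordS j) - t *+ k) - S x k).
    rewrite -sumrB; apply: eq_bigr => j _.
    rewrite [in RHS]sinB cosS sinS -sinB addrK; rewrite /d; ring.
  congr (_ - _); rewrite (sum_ordS (fun j => x j * sin (t *+ (k * j) - t *+ k))).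
  by rewrite !mulr_sumr -sumrB; apply: eq_bigr => j _; rewrite sinB/=; ring.
have E : C d k ^+ 2 + S d k ^+ 2 = (2 - 2 * cos (t *+ k)) * (C x k ^+ 2 + S x k ^+ 2).
  rewrite Cd Sd.
  have -> : 2 - 2 * cos (t *+ k) = cos (t *+ k) ^+ 2 + sin (t *+ k) ^+ 2 + 1 - 2 * cos (t *+ k).
    by rewrite cos2Dsin2; ring.
  ring.
rewrite E; have [k0|k0] := posnP k.
  have -> : C x k = 0.
    by rewrite /C k0; under eq_bigr do rewrite mul0n mulr0n cos0 mulr1.
  have -> : S x k = 0.
    by rewrite /S k0; under eq_bigr do rewrite mul0n mulr0n sin0 mulr0; rewrite big1.
  by rewrite expr0n/= addr0 !mulr0.
apply: ler_wpM2r; first by rewrite addr_ge0 ?sqr_ge0.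
by rewrite lerB// ler_wpM2l// cos_lt_cost// k0 ltn_ord.
Qed.
End dft.
End Wirtinger.

(** * Signed area against energy, and the move that equalizes two sides *)

Section Isoperimetric.
Context {R : realType}.
Local Notation plane := (R * R)%type.

Definition cross (p q : plane) : R := p.1 * q.2 - p.2 * q.1.

Definition sqdist (p q : plane) : R := (p.1 - q.1) ^+ 2 + (p.2 - q.2) ^+ 2.

Lemma sqdist_ge0 (p q : plane) : 0 <= sqdist p q.
Proof. by rewrite addr_ge0 ?sqr_ge0. Qed.

Lemma edist_nneg (p q : plane) : 0 <= edist p q.
Proof. exact: sqrtr_ge0. Qed.

Lemma edist_sqr (p q : plane) : edist p q ^+ 2 = sqdist p q.
Proof. by rewrite sqr_sqrtr// sqdist_ge0. Qed.

Lemma edist_eq (p q : plane) (r : R) : 0 <= r -> sqdist p q = r ^+ 2 -> edist p q = r.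
Proof. by move=> r0 E; rewrite /edist -/(sqdist p q) E sqrtr_sqr ger0_norm. Qed.

Lemma edistC (p q : plane) : edist p q = edist q p.
Proof. by rewrite /edist -sqrrN opprB -[(p.2 - q.2) ^+ 2]sqrrN opprB. Qed.

Lemma pi_div_bounds n : (2 < n)%N -> 0 < (pi : R) / n%:R < pi / 2.
Proof.
move=> n2; rewrite divr_gt0 ?pi_gt0 ?ltr0n ?(ltn_trans _ n2)//=.
by rewrite ltr_pM2l ?pi_gt0// ltf_pV2 ?posrE ?ltr0n ?(ltn_trans _ n2)// ltr_nat.
Qed.

(* For the centred polygon [z], expand [|z' - z - i t (z' + z)| ^ 2 >= 0] with
   [t = tan (pi / n)] and bound the remaining [|z| ^ 2] by Wirtinger. *)
Lemma cross_sum_le n (v : 'I_n -> plane) : (2 < n)%N ->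
  2 * tan (pi / n%:R) * (\sum_j cross (v j) (v (ordS j))) <=
  \sum_j sqdist (v j) (v (ordS j)).
Proof.
move=> n2.
have nR : n%:R != 0 :> R by rewrite pnatr_eq0; case: n n2 {v}.
(* The polygon is centred at the mean of its vertices, because Wirtinger asks for coordinates of sum
   0. *)
pose a := (\sum_j (v j).1) / n%:R; pose b := (\sum_j (v j).2) / n%:R.
pose x j := (v j).1 - a; pose y j := (v j).2 - b.
have x0 : \sum_j x j = 0.
  by rewrite sumrB sumr_const card_ord -mulr_natr /a divfK ?subrr.
have y0 : \sum_j y j = 0.
  by rewrite sumrB sumr_const card_ord -mulr_natr /b divfK ?subrr.
have n1 : (1 < n)%N by rewrite (ltn_trans _ n2).
have Wx := scalar_wirtinger n1 x0; have Wy := scalar_wirtinger n1 y0.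
set ph := pi / n%:R.
have /andP[ph0 ph1] : 0 < ph < pi / 2 by exact: pi_div_bounds.
have c0 : 0 < cos ph.
  by rewrite cos_gt0_pihalf// ph1 (lt_trans _ ph0)// oppr_lt0 divr_gt0 ?pi_gt0.
have s0 : 0 < sin ph by rewrite sin_gt0_pihalf// ph0.
have ct : 2 - 2 * cos (pi *+ 2 / n%:R) = 4 * sin ph ^+ 2.
  have -> : pi *+ 2 / n%:R = ph *+ 2 :> R by rewrite /ph mulrnAl.
  by rewrite cos_mulr2n cos2sin2; ring.
pose D := \sum_j ((x (ordS j) - x j) ^+ 2 + (y (ordS j) - y j) ^+ 2).
pose Q := \sum_j (x j ^+ 2 + y j ^+ 2).
pose X := \sum_j (x j * y (ordS j) - y j * x (ordS j)).
have ED : \sum_j sqdist (v j) (v (ordS j)) = D.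
  by apply: eq_bigr => j _; rewrite /sqdist /x /y; ring.
(* The signed area does not feel the translation: the extra terms telescope around the polygon. *)
have EX : \sum_j cross (v j) (v (ordS j)) = X.
  have -> : X = \sum_j (cross (v j) (v (ordS j)) + a * (v j).2 - b * (v j).1
     - (a * (v (ordS j)).2 - b * (v (ordS j)).1)).
    by apply: eq_bigr => j _; rewrite /cross /x /y; ring.
  rewrite [RHS]sumrB (sum_ordS (fun j => a * (v j).2 - b * (v j).1)) -sumrB.
  by apply: eq_bigr => j _; rewrite /=; ring.
have W : 4 * sin ph ^+ 2 * Q <= D.
  by rewrite /Q /D !big_split/= mulrDr -ct lerD.
have M : 4 * tan ph * X <= D + tan ph ^+ 2 * (4 * Q - D).
  (* Parallelogram identity [|z' + z| ^ 2 = 2 |z| ^ 2 + 2 |z'| ^ 2 - |z' - z| ^ 2], summed over the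
     polygon. *)
  have E : 4 * Q - D =
      \sum_j ((x j + x (ordS j)) ^+ 2 + (y j + y (ordS j)) ^+ 2).
    have -> : 4 * Q = 2 * Q + 2 * Q by ring.
    have {2}-> : Q = \sum_j (x (ordS j) ^+ 2 + y (ordS j) ^+ 2).
      by rewrite (sum_ordS (fun j => x j ^+ 2 + y j ^+ 2)).
    rewrite !mulr_sumr -big_split -sumrB.
    by apply: eq_bigr => j _; rewrite /=; ring.
  rewrite E /D /X !mulr_sumr -big_split; apply: ler_sum => j _ /=.
  set t := tan ph; rewrite -subr_ge0.
  set lhs := _ - _.
  have -> : lhs = ((x (ordS j) - x j) + t * (y j + y (ordS j))) ^+ 2 +
    ((y (ordS j) - y j) - t * (x j + x (ordS j))) ^+ 2 by rewrite /lhs; ring.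
  by rewrite addr_ge0 ?sqr_ge0.
have {M}M : 4 * tan ph * X <= 2 * D.
  apply: le_trans M _.
  have tc : tan ph * cos ph = sin ph by rewrite /tan divfK ?gt_eqF.
  (* Wirtinger in the form [sin ^ 2 * (4 Q - D) <= cos ^ 2 * D], so that the remainder is at most
     [D]. *)
  have T : cos ph ^+ 2 * (tan ph ^+ 2 * (4 * Q - D)) <= cos ph ^+ 2 * D.
    rewrite mulrA -exprMn [cos ph * _]mulrC tc cos2sin2.
    by move: W; set s2 := sin ph ^+ 2; lra.
  have -> : 2 * D = D + D by ring.
  by rewrite lerD2l -(@ler_pM2l _ (cos ph ^+ 2)) ?exprn_gt0.
rewrite ED EX; lra.
Qed.

(** Among the triangles on the base [p q] with a given sum of the other two sides, the isosceles one
    has the largest area, and [cross p m + cross m q - cross p q] is twice the signed area. The apex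
    [m'] is on the perpendicular bisector, on the side where this area is nonnegative. *)
Lemma isosceles_move (p m q : plane) : exists m' : plane,
  [/\ edist p m' = (edist p m + edist m q) / 2,
      edist m' q = (edist p m + edist m q) / 2 &
      cross p m + cross m q <= cross p m' + cross m' q].
Proof.
set l1 := edist p m; set l2 := edist m q.
have l10 : 0 <= l1 := edist_nneg _ _; have l20 : 0 <= l2 := edist_nneg _ _.
have s0 : 0 <= (l1 + l2) / 2 by rewrite divr_ge0 ?addr_ge0.
pose e1 := q.1 - p.1; pose e2 := q.2 - p.2; pose D := e1 ^+ 2 + e2 ^+ 2.
have D0 : 0 <= D by rewrite addr_ge0 ?sqr_ge0.
(* If [p = q] both sums vanish, and any point at the mean distance from [p] will do. *)
move: D0; rewrite le_eqVlt => /predU1P[D0|D0].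
  have e10 : e1 = 0 by apply/eqP; rewrite -sqrf_eq0; apply/eqP; move: D0 (sqr_ge0 e1) (sqr_ge0 e2); rewrite /D; lra.
  have e20 : e2 = 0 by apply/eqP; rewrite -sqrf_eq0; apply/eqP; move: D0 (sqr_ge0 e1) (sqr_ge0 e2); rewrite /D; lra.
  exists (p.1 + (l1 + l2) / 2, p.2); split.
  - by apply: edist_eq => //; rewrite /sqdist/=; ring.
  - apply: edist_eq => //; rewrite /sqdist/=.
    have -> : q.1 = p.1 by move: e10; rewrite /e1; lra.
    have -> : q.2 = p.2 by move: e20; rewrite /e2; lra.
    by ring.
  - rewrite /cross/=.
    have -> : q.1 = p.1 by move: e10; rewrite /e1; lra.
    have -> : q.2 = p.2 by move: e20; rewrite /e2; lra.
    lra.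
(* Position of [m] from the midpoint of the base, in units of the base: [al] along it and [be] along
   its normal. *)
pose m1 := m.1 - (p.1 + q.1) / 2; pose m2 := m.2 - (p.2 + q.2) / 2.
pose al := (m1 * e1 + m2 * e2) / D; pose be := (m1 * e2 - m2 * e1) / D.
have Dn0 : D != 0 by rewrite gt_eqF.
have Em1 : m1 = al * e1 + be * e2.
  by rewrite /al /be; move: Dn0; rewrite /D => Dn0; field.
have Em2 : m2 = al * e2 - be * e1.
  by rewrite /al /be; move: Dn0; rewrite /D => Dn0; field.
have L1 : l1 ^+ 2 = ((al + 2^-1) ^+ 2 + be ^+ 2) * D.
  rewrite edist_sqr /sqdist; have -> : p.1 - m.1 = - (m1 + e1 / 2) by rewrite /m1 /e1; field.
  have -> : p.2 - m.2 = - (m2 + e2 / 2) by rewrite /m2 /e2; field.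
  by rewrite Em1 Em2 /D; field.
have L2 : l2 ^+ 2 = ((al - 2^-1) ^+ 2 + be ^+ 2) * D.
  rewrite edist_sqr /sqdist; have -> : m.1 - q.1 = m1 - e1 / 2 by rewrite /m1 /e1; field.
  have -> : m.2 - q.2 = m2 - e2 / 2 by rewrite /m2 /e2; field.
  by rewrite Em1 Em2 /D; field.
(* Cauchy-Schwarz for [p m] and the mirror image of [m q] in the base, which is the reflection
   argument: adding twice this to [l1 ^+ 2 + l2 ^+ 2] cancels [al] and leaves [(1 + 4 be ^ 2) D]. *)
have L12 : (4^-1 - al ^+ 2 + be ^+ 2) * D <= l1 * l2.
  apply: le_trans (ler_norm _) _.
  rewrite -(@ler_pXn2r _ 2)// ?nnegrE ?mulr_ge0// real_normK ?num_real// [in leRHS]exprMn L1 L2 -subr_ge0.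
  set d := _ - _.
  have -> : d = (2 * al * be * D) ^+ 2 by rewrite /d; field.
  exact: sqr_ge0.
(* Squared height of the isosceles apex by Pythagoras, in units of the base. *)
pose k2 := (l1 + l2) ^+ 2 / (4 * D) - 4^-1.
have K2 : be ^+ 2 <= k2.
  rewrite /k2 lerBrDr ler_pdivlMr ?mulr_gt0//.
  have : (l1 + l2) ^+ 2 = l1 ^+ 2 + l2 ^+ 2 + 2 * (l1 * l2) by ring.
  move=> ->; rewrite L1 L2.
  by move: L12; rewrite !mulrDl !sqrrD !mulrDl mulNr; lra.
have k20 : 0 <= k2 := le_trans (sqr_ge0 be) K2.
pose k := Num.sqrt k2.
have Ek : k ^+ 2 = k2 by rewrite sqr_sqrtr.
have bek : be <= k.
  apply: le_trans (ler_norm be) _.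
  by rewrite -(@ler_pXn2r _ 2)// ?nnegrE ?sqrtr_ge0// real_normK ?num_real// Ek.
have Ek' : (k ^+ 2 + 4^-1) * D = ((l1 + l2) / 2) ^+ 2.
  by rewrite Ek /k2; field.
exists ((p.1 + q.1) / 2 + k * e2, (p.2 + q.2) / 2 - k * e1); split.
- by apply: edist_eq => //; rewrite -Ek' /sqdist/= /D /e1 /e2; field.
- by apply: edist_eq => //; rewrite -Ek' /sqdist/= /D /e1 /e2; field.
- have : be * D <= k * D by rewrite ler_pM2r.
  have -> : cross p m + cross m q = be * D + cross p q.
    have -> : be * D = m1 * e2 - m2 * e1 by rewrite /be divfK.
    by rewrite /cross /m1 /m2 /e1 /e2; field.
  move=> H; rewrite -subr_ge0; set d := _ - _.
  have -> : d = k * D - be * D.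
    rewrite /d; have -> : k * D = k * (e1 ^+ 2 + e2 ^+ 2) by [].
    by rewrite /cross/= /e1 /e2; field.
  by rewrite subr_ge0.
Qed.
End Isoperimetric.

(** * Maximizing polygons and the isoperimetric inequality *)

Section IsoperimetricCompactness.
Context {R : realType}.
Local Notation plane := (R * R)%type.

Lemma edist_coord_le (p q : plane) : `|q.1 - p.1| <= edist p q /\ `|q.2 - p.2| <= edist p q.
Proof.
split; rewrite -[leLHS]sqrtr_sqr ler_sqrt ?addr_ge0 ?sqr_ge0//.
  by rewrite -sqrrN opprB lerDl sqr_ge0.
by rewrite -[leLHS]sqrrN opprB lerDr sqr_ge0.
Qed.

(** Applied to each coordinate, this bounds a polygon with first vertex 0 by its length. *)
Lemma cyclic_dist_le m (f : 'I_m.+1 -> R) i :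
  `|f i - f ord0| <= \sum_j `|f (ordS j) - f j|.
Proof.
pose G j := `|f (ordS (inord j)) - f (inord j)|.
have H k : (k < m.+1)%N -> `|f (inord k) - f ord0| <= \sum_(0 <= j < k) G j.
  elim: k => [_|k IH km].
    by rewrite big_geq// (_ : inord 0 = ord0) ?subrr ?normr0//; apply/val_inj; rewrite /= inordK.
  rewrite big_nat_recr//= addrC.
  have -> : inord k.+1 = ordS (inord k) :> 'I_m.+1.
    by apply/val_inj; rewrite /= !inordK// ?modn_small// ltnW.
  rewrite (_ : _ - _ = f (ordS (inord k)) - f (inord k) + (f (inord k) - f ord0)); last by ring.
  by apply: le_trans (ler_normD _ _) _; rewrite lerD// IH// ltnW.
have := H i (ltn_ord i); rewrite inord_val => /le_trans; apply.
have -> : \sum_j `|f (ordS j) - f j| = \sum_(0 <= j < m.+1) G j.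
  by rewrite big_mkord; apply: eq_bigr => j _; rewrite /G inord_val.
rewrite [leRHS](big_cat_nat (n := i)) ?(ltnW (ltn_ord i))//=.
by rewrite lerDl; apply: sumr_ge0 => j _; exact: normr_ge0.
Qed.

Lemma val_ordS n (k : 'I_n) : (ordS k : nat) = if k.+1 == n then 0%N else k.+1.
Proof.
have [kn|kn] := eqVneq k.+1 n; first by rewrite /= [X in (X %% _)%N]kn modnn.
by rewrite /= modn_small// ltn_neqAle kn ltn_ord.
Qed.

(** Only the two sides at the moved vertex change; [2 < n] keeps this vertex and its two neighbours
    distinct. *)
Lemma sum_move n (h : plane -> plane -> R) (v : 'I_n -> plane) (k : 'I_n) (m : plane) :
  (2 < n)%N ->
  let i := ordS k in let v' j := if j == i then m else v j in
  \sum_j h (v' j) (v' (ordS j)) = \sum_j h (v j) (v (ordS j))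
   - (h (v k) (v i) + h (v i) (v (ordS i))) + (h (v k) m + h m (v (ordS i))).
Proof.
move=> n2 i v'.
have ik : i != k.
  by apply/eqP => /(congr1 (@nat_of_ord n)); rewrite val_ordS; case: ifP; lia.
have Sik : ordS i != k.
  by apply/eqP => /(congr1 (@nat_of_ord n)); rewrite !val_ordS; do 2 case: ifP; lia.
have Si : ordS i != i by apply: contra Sik => /eqP/ordS_inj/eqP; rewrite (negPf ik).
have ki : k != i by rewrite eq_sym.
rewrite (bigD1 k)//= (bigD1 i)//= [in RHS](bigD1 k)//= [in RHS](bigD1 i)//=.
have v'i : v' i = m by rewrite /v' eqxx.
have v'k : v' k = v k by rewrite /v' (negPf ki).
have v'Si : v' (ordS i) = v (ordS i) by rewrite /v' (negPf Si).
rewrite -/i v'i v'k v'Si.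
set A := \sum_(_ < _ | _) _; set B := \sum_(_ < _ | _) _.
have -> : A = B; last by ring.
apply: eq_bigr => j /andP[jk ji]; rewrite /v' (negPf ji).
by case: eqP => // /ordS_inj /eqP; rewrite (negPf jk).
Qed.

Section maximizer.
Variable m : nat.
Local Notation n := m.+1.
Hypothesis n2 : (2 < n)%N.
(** Polygons are stored as two coordinate rows, so that the compactness of boxes of row vectors
    applies. *)
Let T := ('rV[R]_n * 'rV[R]_n)%type.
Let pt (z : T) (i : 'I_n) : plane := (z.1 ord0 i, z.2 ord0 i).

Let cont1 i : continuous (fun z : T => z.1 ord0 i).
Proof.
move=> z; apply: (@continuous_comp _ _ _ fst (fun M : 'rV[R]_n => M ord0 i)); first exact: cvg_fst.
exact: coord_continuous.
Qed.
Let cont2 i : continuous (fun z : T => z.2 ord0 i).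
Proof.
move=> z; apply: (@continuous_comp _ _ _ snd (fun M : 'rV[R]_n => M ord0 i)); first exact: cvg_snd.
exact: coord_continuous.
Qed.

Let cont_sum (f : 'I_n -> T -> R) : (forall i, continuous (f i)) ->
  continuous (fun z => \sum_i f i z).
Proof.
move=> fc z; elim: (index_enum _) => [|i s IH].
  by under eq_fun do rewrite big_nil; exact: cvg_cst.
by under eq_fun do rewrite big_cons; apply: cvgD => //; exact: fc.
Qed.

Let cont_len i j : continuous (fun z : T => sqdist (pt z i) (pt z j)).
Proof.
move=> z; rewrite /sqdist/=; apply: cvgD.
  by apply: (@cvg_comp _ _ _ (fun z : T => z.1 ord0 i - z.1 ord0 j) (fun x => x ^+ 2)); [apply: cvgB; exact: cont1|exact: exprn_continuous].
by apply: (@cvg_comp _ _ _ (fun z : T => z.2 ord0 i - z.2 ord0 j) (fun x => x ^+ 2)); [apply: cvgB; exact: cont2|exact: exprn_continuous].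
Qed.

Let cont_cross i j : continuous (fun z : T => cross (pt z i) (pt z j)).
Proof.
move=> z; rewrite /cross/=; apply: cvgB; apply: cvgM;
  by [exact: cont1|exact: cont2].
Qed.

Let cont_edist i j : continuous (fun z : T => edist (pt z i) (pt z j)).
Proof.
move=> z; apply: (@cvg_comp _ _ _ (fun z : T => sqdist (pt z i) (pt z j)) (@Num.sqrt R)).
  exact: cont_len.
exact: sqrt_continuous.
Qed.

(** One vertex is held at the origin, since polygons of bounded length form a compact set only up to
    translation. *)
Let K (L : R) := [set z : T | pt z ord0 = 0 /\ closed_length (pt z) <= L].

Let compact_K L : compact (K L).
Proof.
pose B := [set v : 'rV[R]_n | forall i, [set` `[- L, L]] (v ord0 i)].
have cB : compact B by apply: (@rV_compact _ _ (fun=> [set` `[- L, L]])) => _; exact: segment_compact.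
apply: (@subclosed_compact _ _ (B `*` B)); last 2 first.
- exact: compact_setX.
- move=> z [/eqP]; rewrite xpair_eqE => /andP[/eqP z1 /eqP z2] zL; split => i /=;
    rewrite in_itv/= -ler_norml; apply: le_trans zL.
    rewrite -[z.1 ord0 i]subr0 -z1; apply: le_trans (cyclic_dist_le (fun i => z.1 ord0 i) i) _.
    by apply: ler_sum => j _; have [] := edist_coord_le (pt z j) (pt z (ordS j)).
  rewrite -[z.2 ord0 i]subr0 -z2; apply: le_trans (cyclic_dist_le (fun i => z.2 ord0 i) i) _.
  by apply: ler_sum => j _; have [] := edist_coord_le (pt z j) (pt z (ordS j)).
have -> : K L = (fun z : T => z.1 ord0 ord0) @^-1` [set 0] `&`
   ((fun z : T => z.2 ord0 ord0) @^-1` [set 0] `&`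
   (fun z : T => closed_length (pt z)) @^-1` [set x | x <= L]).
  apply/seteqP; split=> z; first by move=> [[]].
  by move=> [/= z1 [z2 zL]]; split => //; rewrite /pt z1 z2.
apply: closedI; first by apply: preimage_closed => [z _|]; [exact: cont1|exact: closed_eq].
apply: closedI; first by apply: preimage_closed => [z _|]; [exact: cont2|exact: closed_eq].
by apply: preimage_closed => [z _|]; [apply: cont_sum => i; exact: cont_edist|exact: closed_le].
Qed.

Let tau : R := tan (pi / n%:R).

Let tau_gt0 : 0 < tau.
Proof.
have /andP[h0 h1] := @pi_div_bounds R n n2.
rewrite /tau /tan divr_gt0 ?sin_gt0_pihalf ?cos_gt0_pihalf ?h0//.
by rewrite h1 andbT (lt_trans _ h0)// oppr_lt0 divr_gt0 ?pi_gt0.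
Qed.

(* A maximizer of area minus [eps] times energy has equal sides: otherwise
   [isosceles_move] increases the objective. For equal sides the energy is
   [L ^ 2 / n], and [cross_sum_le] applies. *)
Let maximizer_bound (eps L : R) (z : T) : 0 < eps -> K L z ->
  \sum_j cross (pt z j) (pt z (ordS j)) -
     eps * \sum_j sqdist (pt z j) (pt z (ordS j)) <= L ^+ 2 / (2 * n%:R * tau).
Proof.
move=> eps0 Kz.
pose F (z : T) := \sum_j cross (pt z j) (pt z (ordS j)) -
     eps * \sum_j sqdist (pt z j) (pt z (ordS j)).
have cF : continuous F.
  move=> y; apply: cvgB; first by apply: cont_sum => i; exact: cont_cross.
  by apply: cvgMr; apply: cont_sum => i; exact: cont_len.
have [||| w] := @compact_EVT_max T R F (K L).
- by exists z.
- exact: compact_K.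
- exact/continuous_subspaceT.
rewrite inE => -[w0 wL] wmax; apply: (@le_trans _ _ (F w)); first by apply: wmax; rewrite inE.
(* The vertex that moves is [ordS k], so it must not be the one held at the origin. The other
   [n - 1] vertices suffice to make all sides equal. *)
have step k : ordS k != ord0 ->
    edist (pt w k) (pt w (ordS k)) = edist (pt w (ordS k)) (pt w (ordS (ordS k))).
  move=> k0.
  set l1 := edist _ _; set l2 := edist _ (pt w (ordS (ordS k))).
  have [m' [e1 e2 cr]] := isosceles_move (pt w k) (pt w (ordS k)) (pt w (ordS (ordS k))).
  pose v' j := if j == ordS k then m' else pt w j.
  pose w' : T := (\row_j (v' j).1, \row_j (v' j).2).
  have Ew' : pt w' = v' by apply/funext => j; rewrite /pt /w' !mxE -surjective_pairing.
  have Kw' : K L w'.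
    split; first by rewrite Ew' /v' eq_sym (negPf k0).
    apply: le_trans wL; rewrite Ew' /closed_length /v' (sum_move edist)//.
    by rewrite e1 e2; lra.
  have : F w' <= F w by apply: wmax; rewrite inE.
  rewrite /F Ew' /v' (sum_move cross)// (sum_move sqdist)//.
  rewrite -!edist_sqr e1 e2 -/l1 -/l2.
  set A := \sum_(_ < _) _; set B := \sum_(_ < _) _ => H.
  (* The move keeps the length and only weakly increases the area; the strict gain is the drop
     [(l1 - l2) ^+ 2 / 2] of the energy, which is what [eps] is for. *)
  have H2 : eps * ((l1 - l2) ^+ 2 / 2) <= 0.
    have -> : (l1 - l2) ^+ 2 / 2 = l1 ^+ 2 + l2 ^+ 2 - (((l1 + l2) / 2) ^+ 2 + ((l1 + l2) / 2) ^+ 2) by field.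
    by move: H cr; set u := (_ / 2) ^+ 2; lra.
  apply/eqP; rewrite -subr_eq0 -sqrf_eq0; apply/eqP/le_anti; rewrite sqr_ge0 andbT.
  by move: H2; rewrite pmulr_rle0//; lra.
have allE k : edist (pt w k) (pt w (ordS k)) = edist (pt w ord0) (pt w (ordS ord0)).
  have H i : (i < n)%N -> edist (pt w (inord i)) (pt w (ordS (inord i))) = edist (pt w ord0) (pt w (ordS ord0)).
    elim: i => [_|i IH im]; first by rewrite (_ : inord 0 = ord0)//; apply/val_inj; rewrite /= inordK.
    have <- : ordS (inord i) = inord i.+1 :> 'I_n.
      by apply/val_inj; rewrite /= !inordK// ?modn_small// ltnW.
    rewrite -step ?IH// 1?ltnW//.
    by apply/eqP => /(congr1 (@nat_of_ord n)); rewrite /= inordK 1?ltnW// modn_small.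
  by rewrite -(H k)// inord_val.
set l := edist (pt w ord0) _ in allE.
have El : closed_length (pt w) = n%:R * l.
  rewrite /closed_length (eq_bigr (fun=> l)) => [|j _]; last exact: allE.
  by rewrite sumr_const card_ord mulr_natl.
have El2 : \sum_j sqdist (pt w j) (pt w (ordS j)) = n%:R * l ^+ 2.
  rewrite (eq_bigr (fun=> l ^+ 2)) => [|j _]; last by rewrite -edist_sqr allE.
  by rewrite sumr_const card_ord mulr_natl.
have := cross_sum_le (pt w) n2; rewrite El2 -/tau => Hc.
have n0 : 0 < n%:R :> R by rewrite ltr0n.
have l0 : 0 <= l by exact: edist_nneg.
have c0 : 0 <= n%:R * l ^+ 2 by rewrite mulr_ge0 ?sqr_ge0 ?ltW.
have t0 : 0 < 2 * n%:R * tau by apply: mulr_gt0; [exact: mulr_gt0|exact: tau_gt0].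
rewrite /F El2 ler_pdivlMr//.
have L2 : (n%:R * l) ^+ 2 <= L ^+ 2.
  by rewrite ler_pXn2r ?nnegrE -?El// ?(le_trans _ wL)// El mulr_ge0// ltW.
have D : \sum_j cross (pt w j) (pt w (ordS j)) - eps * (n%:R * l ^+ 2) <= \sum_j cross (pt w j) (pt w (ordS j)).
  by rewrite gerBl mulr_ge0// ltW.
apply: (@le_trans _ _ ((\sum_j cross (pt w j) (pt w (ordS j))) * (2 * n%:R * tau))).
  by rewrite (ler_pM2r t0).
apply: le_trans L2.
have -> : (n%:R * l) ^+ 2 = n%:R * (n%:R * l ^+ 2) by ring.
apply: le_trans (ler_wpM2l (ltW n0) Hc).
by rewrite le_eqVlt; apply/orP; left; apply/eqP; ring.
Qed.

(** The translate with first vertex 0 competes in the maximization, and the weight of the energy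
    tends to 0. *)
Lemma isoperimetric_succ (v : 'I_n -> plane) :
  2 * n%:R * tan (pi / n%:R) * (\sum_j cross (v j) (v (ordS j))) <= closed_length v ^+ 2.
Proof.
rewrite -/tau.
pose u j := v j - v ord0.
pose z : T := (\row_j (u j).1, \row_j (u j).2).
have Ez : pt z = u by apply/funext => j; rewrite /pt /z !mxE -surjective_pairing.
have Lz : closed_length (pt z) = closed_length v.
  by apply: eq_bigr => j _; rewrite Ez /u /edist/=; congr Num.sqrt; ring.
have Cz : \sum_j cross (pt z j) (pt z (ordS j)) = \sum_j cross (v j) (v (ordS j)).
  pose A j := cross (v ord0) (v j).
  rewrite Ez -[RHS](subrK (\sum_j A j)) -[X in _ - X + _](sum_ordS A).
  by rewrite -sumrB -big_split; apply: eq_bigr => j _; rewrite /= /u /A /cross/=; ring.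
have Kz : K (closed_length v) z by split; [rewrite Ez /u subrr|rewrite Lz].
have n0 : 0 < n%:R :> R by rewrite ltr0n.
have t0 : 0 < 2 * n%:R * tau by apply: mulr_gt0; [exact: mulr_gt0|exact: tau_gt0].
rewrite mulrC -ler_pdivlMr//; apply/ler_addgt0Pr => e e0.
pose Q := \sum_j sqdist (pt z j) (pt z (ordS j)).
have Q0 : 0 <= Q by apply: sumr_ge0 => j _; exact: sqdist_ge0.
have Q1 : 0 < 1 + Q by rewrite ltr_pwDl.
(* With this weight the penalty of the given polygon is at most [e]; the summand 1 guards against
   [Q = 0]. *)
have := @maximizer_bound (e / (1 + Q)) _ _ (divr_gt0 e0 Q1) Kz.
rewrite Cz -/Q lerBlDr => /le_trans; apply; rewrite lerD2l.
by rewrite mulrAC ler_pdivrMr// ler_pM2l// lerDr.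
Qed.
End maximizer.

End IsoperimetricCompactness.

(** * Numerical bounds on [pi] and on tangents *)

Section TanBounds.
Context {R : realType}.
Implicit Types x : R.

Lemma sqr_le_mono (a x : R) : 0 <= a -> a <= x -> a ^+ 2 <= x ^+ 2.
Proof. by move=> a0 ax; rewrite ler_pXn2r ?nnegrE// (le_trans a0). Qed.

Lemma sqr_le_inv (a x : R) : 0 <= x -> a ^+ 2 <= x ^+ 2 -> a <= x.
Proof.
move=> x0 ax; rewrite leNgt; apply/negP => xa.
by move: ax; rewrite leNgt ltr_pXn2r ?xa ?nnegrE// (le_trans x0)// ltW.
Qed.

Lemma cos_mulr3n x : cos (x *+ 3) = 4 * cos x ^+ 3 - 3 * cos x.
Proof.
rewrite mulrSr cosD cos_mulr2n sin_mulr2n.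
have -> : (cos x * sin x) *+ 2 * sin x = 2 * cos x * sin x ^+ 2 by ring.
by rewrite sin2cos2; ring.
Qed.

Lemma cos_pi_div_gt0 n : (2 < n)%N -> 0 < cos (pi / n%:R) :> R.
Proof.
move=> /(@pi_div_bounds R)/andP[h0 h1]; apply: cos_gt0_pihalf.
by rewrite h1 andbT (lt_trans _ h0)// oppr_lt0 divr_gt0 ?pi_gt0.
Qed.

Lemma tan_pi_div_gt0 n : (2 < n)%N -> 0 < tan (pi / n%:R) :> R.
Proof.
move=> n2; rewrite /tan divr_gt0 ?cos_pi_div_gt0// sin_gt0_pihalf//.
exact: pi_div_bounds.
Qed.

Lemma tan_sqr_cos n : (2 < n)%N ->
  (1 + tan (pi / n%:R) ^+ 2) * cos (pi / n%:R) ^+ 2 = 1 :> R.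
Proof.
by move=> n2; rewrite -cos2_tan2 ?mulVf ?expf_neq0// gt_eqF// cos_pi_div_gt0.
Qed.

Lemma cos_pi6_sqr : cos (pi / 6%:R) ^+ 2 = 3 / 4 :> R.
Proof.
have c0 := @cos_pi_div_gt0 6 isT.
have : cos ((pi / 6%:R) *+ 3) = 0 :> R.
  by rewrite (_ : _ *+ 3 = pi / 2) ?cos_pihalf//; field.
rewrite cos_mulr3n; move: c0; set c := cos _ => c0 E.
have cn0 : c != 0 by rewrite gt_eqF.
apply: (mulfI cn0); have -> : c * c ^+ 2 = c ^+ 3 by ring.
lra.
Qed.

(** At [x = pi / 5] one has [cos (3 x) = - cos (2 x)]; the resulting cubic in [cos x] is divided by
    its factor [cos x + 1]. *)
Lemma cos_pi5 : 4 * cos (pi / 5%:R) ^+ 2 - 2 * cos (pi / 5%:R) - 1 = 0 :> R.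
Proof.
have c0 := @cos_pi_div_gt0 5 isT.
have : cos ((pi / 5%:R) *+ 3) = - cos ((pi / 5%:R) *+ 2) :> R.
  rewrite (_ : _ *+ 3 = - ((pi / 5%:R) *+ 2) + pi); last by field.
  by rewrite cosDpi cosN.
rewrite cos_mulr3n cos_mulr2n; move: c0; set c := cos _ => c0 E.
have cn0 : c + 1 != 0 by rewrite gt_eqF// addr_gt0.
apply: (mulfI cn0); rewrite mulr0.
have -> : (c + 1) * (4 * c ^+ 2 - 2 * c - 1) = 4 * c ^+ 3 + 2 * c ^+ 2 - 3 * c - 1 by ring.
by move: E; rewrite mulr2n; lra.
Qed.

(** Convexity of the tangent: by the mean value theorem the slope is [1 + tan ^ 2] at some point to
    the right of [b]. *)
Lemma tan_tangent_le (a b : R) : 0 <= b -> b <= a -> a < pi / 2 ->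
  (a - b) * (1 + tan b ^+ 2) <= tan a - tan b.
Proof.
move=> b0 ba api.
have itv x : b <= x <= a -> - (pi / 2) < x < pi / 2.
  move=> /andP[bx xa]; rewrite (le_lt_trans xa api) andbT (lt_le_trans _ (le_trans b0 bx))//.
  by rewrite oppr_lt0 divr_gt0 ?pi_gt0.
have cn0 x : b <= x <= a -> cos x != 0.
  by move=> /itv xI; rewrite gt_eqF// cos_gt0_pihalf.
have [|x xI|c cI ->] := @MVT_segment _ tan (fun x => (cos x) ^-2) _ _ ba.
- move=> x; rewrite in_itv/= => /andP[bx xa]; apply: is_derive_tan.
  by apply: cn0; rewrite !ltW.
- apply/continuous_in_subspaceT => y; rewrite inE/= in_itv/= => yI.
  by apply: continuous_tan; exact: cn0.
move: cI; rewrite in_itv/= => cI; rewrite cos2_tan2 ?cn0// mulrC.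
rewrite ler_wpM2r ?subr_ge0// lerD2l.
have tb : 0 <= tan b.
  rewrite /tan; apply: divr_ge0; last by rewrite ltW// cos_gt0_pihalf// itv// lexx.
  apply: sin_ge0_pi; rewrite b0/= (le_trans ba)// (le_trans (ltW api))//.
  by rewrite ler_pdivrMr// ler_peMr ?pi_ge0// ler1n.
have /andP[bc ca] := cI.
have tbc : tan b <= tan c.
  move: bc; rewrite le_eqVlt => /predU1P[->//|bc].
  by rewrite ltW// ltr_tan// in_itv/= itv// ?lexx// ltW.
by rewrite ler_pXn2r ?nnegrE// (le_trans tb).
Qed.

Lemma tan_ge x : 0 <= x < pi / 2 -> x <= tan x.
Proof.
move=> /andP[x0 x1]; have := tan_tangent_le (lexx 0) x0 x1.
by rewrite tan0 expr0n/= addr0 !subr0 mulr1.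
Qed.

Lemma sin_le x : 0 <= x -> sin x <= x.
Proof.
move=> x0; have [|c _] := @MVT_segment _ (@sin R) (@cos R) _ _ x0.
  exact/continuous_subspaceT/continuous_sin.
by rewrite sin0 !subr0 => ->; rewrite ler_piMl// cos_le1.
Qed.

(** From [sin (pi / 12) <= pi / 12]: if this sine were below 31/120, then
    [cos (pi / 6) = 1 - 2 sin ^ 2] would be at least 97/112, whose square just exceeds 3/4. *)
Lemma pi_lower_bound : 31 / 10 <= pi :> R.
Proof.
have h0 : 0 <= (pi : R) / 12%:R by rewrite divr_ge0 ?pi_ge0.
have := sin_le h0; set s := sin _ => sle.
have s0 : 0 <= s.
  by rewrite sin_ge0_pi// h0/= ler_pdivrMr// ler_peMr ?pi_ge0// ler1n.
have c6 := @cos_pi_div_gt0 6 isT.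
have E : cos (pi / 6%:R) = 1 - 2 * s ^+ 2 :> R.
  rewrite (_ : pi / 6%:R = (pi / 12%:R) *+ 2); last by field.
  by rewrite cos_mulr2n cos2sin2 -/s; ring.
move: cos_pi6_sqr c6; rewrite E => E2 c6.
suff : 31 / 120 <= s by move: sle; set p : R := pi; lra.
rewrite leNgt; apply/negP => sl.
have := sqr_le_mono s0 (ltW sl); move: E2 c6; set y := s ^+ 2 => E2 c6 yl.
have : (97 / 112) ^+ 2 <= (1 - 2 * y) ^+ 2 by apply: sqr_le_mono; lra.
by rewrite E2; lra.
Qed.
End TanBounds.

Section Constants.
Context {R : realType}.
(* A rational number whose powers make [2 sqrt 3 corner_ratio ^ (6 - n)] a lower
   bound of [n tan (pi / n)] for every [n >= 3], tight at [n = 6]. *)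
Definition corner_ratio : R := 22 / 21.

Lemma corner_ratio_gt1 : 1 < corner_ratio. Proof. by rewrite /corner_ratio; lra. Qed.

(** A continued fraction convergent: [97 ^ 2 = 3 * 56 ^ 2 + 1]. *)
Lemma sqrt3_le : Num.sqrt 3 <= 97 / 56 :> R.
Proof. by apply: sqr_le_inv; [lra|rewrite sqr_sqrtr//; lra]. Qed.

(** By the double angle formula the tangent is the positive root of [t ^ 2 + 2 t = 1], namely
    [sqrt 2 - 1], and 12/29 is a convergent from below. *)
Lemma tan_pi8 : 12 / 29 <= tan (pi / 8%:R) :> R.
Proof.
have t0 := @tan_pi_div_gt0 R 8 isT.
have c0 : cos (pi / 8%:R) != 0 :> R by rewrite gt_eqF// cos_pi_div_gt0.
have := tan_mulr2n c0; rewrite (_ : pi / 8%:R *+ 2 = pi / 4); last by field.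
rewrite tan_piquarter; move: t0; set t := tan _ => t0 E.
have d0 : 1 - t ^+ 2 != 0.
  by apply/eqP => d0; move: E; rewrite d0 invr0 mulr0 => /eqP; rewrite oner_eq0.
have {}E : 1 - t ^+ 2 = 2 * t.
  by move: E => /(congr1 (fun x => x * (1 - t ^+ 2))); rewrite mul1r divfK// => ->; ring.
by rewrite leNgt; apply/negP => H; have := sqr_le_mono (ltW t0) (ltW H); lra.
Qed.

(** The powers of [corner_ratio] stand on both sides so that the exponent [6 - n] never becomes
    negative. *)
Lemma tan_lower_bound n : (2 < n)%N ->
  2 * Num.sqrt 3 * corner_ratio ^+ 6 <= n%:R * tan (pi / n%:R) * corner_ratio ^+ n :> R.
Proof.
move=> n2.
have q0 : 0 < corner_ratio := lt_trans ltr01 corner_ratio_gt1.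
have E : Num.sqrt 3 ^+ 2 = 3 :> R by rewrite sqr_sqrtr.
have r2 := sqrt3_le; have r0 : 0 <= (Num.sqrt 3 : R) by exact: sqrtr_ge0.
(* From 9 on, [n tan (pi / n) >= pi >= 31 / 10] is enough, with three spare factors
   [corner_ratio]. *)
have [n9|] := leqP 9 n.
  have H : 31 / 10 <= n%:R * tan (pi / n%:R) :> R.
    apply: le_trans pi_lower_bound _.
    have nR : 0 < n%:R :> R by rewrite ltr0n; lia.
    rewrite mulrC -ler_pdivrMr//; apply: tan_ge.
    by have /andP[h0 ->] := @pi_div_bounds R n n2; rewrite ltW.
  have q9 : corner_ratio ^+ 9 <= corner_ratio ^+ n by rewrite ler_weXn2l// ltW ?corner_ratio_gt1.
  apply: le_trans (_ : 31 / 10 * corner_ratio ^+ 9 <= _).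
    rewrite (_ : corner_ratio ^+ 9 = corner_ratio ^+ 3 * corner_ratio ^+ 6); last by ring.
    by rewrite [leRHS]mulrA ler_pM2r ?exprn_gt0// /corner_ratio; lra.
  by apply: ler_pM => //; rewrite ?exprn_ge0 ?(ltW q0)//; lra.
have t0 := @tan_pi_div_gt0 R n n2; have tc := @tan_sqr_cos R n n2.
case: n n2 t0 tc => [|[|[|[|[|[|[|[|[|n]]]]]]]]] // _ t0 tc _.
- have c3 : cos (pi / 3%:R) = 2^-1 :> R.
    rewrite (_ : pi / 3%:R = (pi / 6%:R) *+ 2); last by field.
    by rewrite cos_mulr2n cos_pi6_sqr; field.
  move: tc; rewrite c3 (_ : 2^-1 ^+ 2 = 4^-1 :> R) => [tc|]; last by field.
  rewrite (_ : tan _ = Num.sqrt 3); last first.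
    apply/eqP; rewrite -(@eqrXn2 _ 2)// ?ltW ?sqrtr_ge0// E; apply/eqP.
    by move: tc; set t2 := tan _ ^+ 2; lra.
  rewrite (_ : corner_ratio ^+ 6 = corner_ratio ^+ 3 * corner_ratio ^+ 3); last by ring.
  by rewrite [leLHS]mulrA ler_pM2r ?exprn_gt0// /corner_ratio; lra.
- rewrite (_ : corner_ratio ^+ 6 = corner_ratio ^+ 2 * corner_ratio ^+ 4); last by ring.
  by rewrite [leLHS]mulrA ler_pM2r ?exprn_gt0// tan_piquarter /corner_ratio; lra.
- rewrite (_ : corner_ratio ^+ 6 = corner_ratio * corner_ratio ^+ 5); last by ring.
  rewrite [leLHS]mulrA ler_pM2r ?exprn_gt0//; move: tc t0 (@cos_pi5 R) (@cos_pi_div_gt0 R 5 isT).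
  set t := tan _; set c := cos _ => tc t0 c5 c0.
  (* For the pentagon 17/21 approximates [cos (pi / 5) = (1 + sqrt 5) / 4] from above. The quadratic
     equation turns it into [c ^+ 2 <= 55 / 84], hence the bound 53/73 on the tangent; there is
     little slack here. *)
  have cl : c <= 17 / 21.
    rewrite leNgt; apply/negP => H; have := sqr_ge0 (c - 17 / 21); lra.
  have c2 : c ^+ 2 <= 55 / 84 by lra.
  have p : 0 < 1 + t ^+ 2 by rewrite addr_gt0// exprn_gt0.
  have t2 : 1 <= (1 + t ^+ 2) * (55 / 84) by rewrite -[leLHS]tc ler_pM2l.
  have tl : t >= 53 / 73 by apply: sqr_le_inv; [exact: ltW|lra].
  by rewrite /corner_ratio; lra.
- rewrite ler_pM2r ?exprn_gt0//; move: tc t0; rewrite cos_pi6_sqr.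
  set t := tan _ => tc t0; have t2 : 3 * t ^+ 2 = 1 by lra.
  have : Num.sqrt 3 <= 3 * t by apply: sqr_le_inv; [rewrite mulr_ge0// ltW|rewrite E; lra].
  by lra.
- have : 2 * Num.sqrt 3 <= 7%:R * tan (pi / 7%:R) * corner_ratio :> R.
    (* The tangent at [pi / 7] is bounded by the tangent line at [pi / 8]; the step is
       [pi / 56 >= 31 / 560]. *)
    have h8 := @pi_div_bounds R 8 isT; have /andP[_ h7] := @pi_div_bounds R 7 isT.
    have p := @pi_lower_bound R.
    have h78 : pi / 8%:R <= pi / 7%:R :> R by move: p; set x : R := pi; lra.
    have := tan_tangent_le (ltW (proj1 (andP h8))) h78 h7.
    have := tan_pi8; set t := tan (pi / 8%:R); set u := tan _ => t8.
    have D : 31 / 560 <= pi / 7%:R - pi / 8%:R :> R by move: p; set x : R := pi; lra.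
    move: D; set d := _ - _ => D H.
    have H2 : (31 / 560) * (1 + t ^+ 2) <= d * (1 + t ^+ 2).
      by rewrite ler_pM2r// ltr_pwDl// sqr_ge0.
    have H3 : (2 / 5) ^+ 2 <= t ^+ 2 by apply: sqr_le_mono; lra.
    by rewrite /corner_ratio; lra.
  move=> H; rewrite (_ : corner_ratio ^+ 7 = corner_ratio * corner_ratio ^+ 6); last by ring.
  by rewrite [leRHS]mulrA ler_pM2r ?exprn_gt0.
- rewrite (_ : corner_ratio ^+ 8 = corner_ratio ^+ 2 * corner_ratio ^+ 6); last by ring.
  rewrite [leRHS]mulrA ler_pM2r ?exprn_gt0//; have := tan_pi8.
  by set t := tan _ => t8; rewrite /corner_ratio; lra.
Qed.
End Constants.

(** * Convex polygons and extreme points *)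

Section CcwPolygons.
Context {R : realType}.
Local Notation plane := (R * R)%type.
Implicit Types (p u : plane).

Lemma orient_rot p u s : orient p u s = orient u s p.
Proof. by rewrite /orient; ring. Qed.

Lemma orientC p u s : orient u p s = - orient p u s.
Proof. by rewrite /orient; ring. Qed.

Lemma orientxx p s : orient p p s = 0.
Proof. by rewrite /orient; ring. Qed.

Lemma strictly_ccw_ordS n (v : 'I_n -> plane) :
  strictly_ccw v -> strictly_ccw (v \o @ordS n).
Proof.
move=> ccw i j k /andP[ij jk] /=; have kn := ltn_ord k.
have [kn1|kn1] := eqVneq k.+1 n.
  by rewrite orient_rot orient_rot; apply: ccw; rewrite !val_ordS kn1 eqxx; do 2 case: ifP; lia.
by apply: ccw; rewrite !val_ordS; do 3 case: ifP; lia.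
Qed.

(** Lets any vertex be the first one; the compatibility with [ordS] allows sums along the sides to
    be reindexed. *)
Lemma rotate_to n (v : 'I_n.+1 -> plane) (i0 : 'I_n.+1) : strictly_ccw v ->
  exists s : 'I_n.+1 -> 'I_n.+1, [/\ bijective s, s ord0 = i0, strictly_ccw (v \o s) &
    forall i, s (ordS i) = ordS (s i)].
Proof.
move=> ccw; exists (iter i0 (@ordS n.+1)); split.
- by elim: (nat_of_ord i0) => [|k IH]; [exists id|apply: bij_comp (ordS_bij _) IH].
- have H k : (k < n.+1)%N -> nat_of_ord (iter k (@ordS n.+1) ord0) = k.
    elim: k => // k IH kn; rewrite /= -/(iter k _ _) IH ?modn_small// ltnW//.
  by apply/val_inj; rewrite /= H.
- elim: (nat_of_ord i0) => [|k /strictly_ccw_ordS] //.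
  suff -> : (v \o iter k.+1 (@ordS n.+1)) = (v \o iter k (@ordS n.+1)) \o @ordS n.+1 by [].
  by apply/funext => j /=; rewrite -iterS iterSr.
- by move=> i; rewrite -iterSr.
Qed.

Lemma no_valley (A B C D : plane) (a b : R) :
  0 < orient A B C -> 0 < orient A B D -> 0 < orient A C D -> 0 < orient B C D ->
  let F p := a * p.1 + b * p.2 in F A <= F C -> F C < F B -> F C < F D -> False.
Proof.
move=> o1 o2 o3 o4 F FA FB FD.
(* the diagonals [A C] and [B D] cross *)
have E : orient B C D * F A + orient A B D * F C = orient A C D * F B + orient A B C * F D.
  by rewrite /F /orient; ring.
have S : orient B C D + orient A B D = orient A C D + orient A B C by rewrite /orient; ring.
have H1 : orient B C D * F A <= orient B C D * F C by rewrite ler_pM2l.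
have H2 : orient A C D * F C < orient A C D * F B by rewrite ltr_pM2l.
have H3 : orient A B C * F C < orient A B C * F D by rewrite ltr_pM2l.
have H4 : orient B C D * F C + orient A B D * F C = orient A C D * F C + orient A B C * F C.
  by rewrite -!mulrDl S.
lra.
Qed.

(** The ascent to [g M], and the descent to [g m] completed by the closing step to [g 0], cover the
    same height. *)
Lemma unimodal_variation (g : nat -> R) (m M : nat) : (M <= m)%N ->
  (forall k, (k < M)%N -> g k <= g k.+1) ->
  (forall k, (M <= k < m)%N -> g k.+1 <= g k) ->
  g 0%N <= g m ->
  \sum_(0 <= k < m) `|g k.+1 - g k| + `|g 0%N - g m| = 2 * (g M - g 0%N).
Proof.
move=> Mm up down g0.
rewrite (big_cat_nat (n := M))//= (@telescope_sumr_eq _ _ _ g)//; last first.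
  by move=> k /andP[_ kM]; rewrite ger0_norm// subr_ge0 up.
rewrite (@telescope_sumr_eq _ _ _ (fun k => - g k))//; last first.
  by move=> k kM; rewrite ler0_norm ?subr_le0 ?down// opprB addrC opprK.
by rewrite ler0_norm ?subr_le0//; ring.
Qed.

(* Along the polygon the functional has one ascent and one descent, because a
   second valley is excluded by [no_valley]. *)
Lemma functional_variation n (v : 'I_n -> plane) (a b lo hi : R) :
  let F p := a * p.1 + b * p.2 in
  strictly_ccw v -> (forall i, lo <= F (v i) <= hi) -> lo <= hi ->
  \sum_i `|F (v (ordS i)) - F (v i)| <= 2 * (hi - lo).
Proof.
move=> F; case: n v => [|m] v ccw bnd lohi.
  by rewrite big_ord0 mulr_ge0// subr_ge0.
pose i0 := [arg min_(i < ord0) F (v i)]%O.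
have i0min i : F (v i0) <= F (v i).
  by rewrite /i0; case: arg_minP => //= j _; exact.
have [s [sb s0 sccw sS]] := rotate_to i0 ccw.
pose g k := F (v (s (inord k))).
have g0min k : g 0%N <= g k.
  by rewrite /g (_ : inord 0 = ord0) ?s0//; apply/val_inj; rewrite /= inordK.
pose M : 'I_m.+1 := [arg max_(k > ord0) g k]%O.
have gM k : (k < m.+1)%N -> g k <= g M.
  move=> km; rewrite /M; case: arg_maxP => //= j _ /(_ (Ordinal km)) /=; exact.
(* The numbering starts at a minimum of [F], so a later valley [j] between [i] and [k] provides the
   four vertices of [no_valley]. *)
have valley i j k : (0 < i)%N -> (i < j)%N -> (j < k)%N -> (k < m.+1)%N ->
    g j < g i -> g j < g k -> False.
  move=> i_gt0 ij jk km gji gjk.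
  have H x y z : (x < y)%N -> (y < z)%N -> (z < m.+1)%N ->
      0 < orient (v (s (inord x))) (v (s (inord y))) (v (s (inord z))).
    by move=> xy yz zm; apply: sccw; rewrite !inordK; lia.
  apply: (@no_valley _ _ _ _ a b (H 0 i j _ _ _) (H 0 i k _ _ _) (H 0 j k _ _ _) (H i j k _ _ _)%N) => //; try lia.
  exact: g0min.
have -> : \sum_i `|F (v (ordS i)) - F (v i)| =
    \sum_(0 <= k < m) `|g k.+1 - g k| + `|g 0%N - g m|.
  rewrite (reindex s)/=; last exact: onW_bij.
  have gE (k : 'I_m.+1) : F (v (s k)) = g k by rewrite /g inord_val.
  have gSE (k : 'I_m.+1) : F (v (ordS (s k))) = g (ordS k) by rewrite -sS gE.
  rewrite big_ord_recr/= big_mkord gSE gE; congr (_ + _); last by rewrite val_ordS/= eqxx.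
  apply: eq_bigr => k _; rewrite gSE gE val_ordS /=.
  by rewrite eqSS ltn_eqF.
rewrite (@unimodal_variation g m M)//.
- rewrite ler_pM2l// lerB//; first by have /andP[] := bnd (s (inord M)).
  by have /andP[] := bnd (s (inord 0)).
- by rewrite -ltnS.
- move=> k kM; rewrite leNgt; apply/negP => gk.
  have [k0|k0] := posnP k; first by move: gk; rewrite k0 ltNge g0min.
  have kM1 : (k.+1 < M)%N.
    rewrite ltn_neqAle kM andbT; apply/eqP => E; move: gk; rewrite E ltNge gM//.
    by rewrite ltnW// (leq_trans _ (ltn_ord M)).
  apply: (valley k k.+1 M) => //.
  by apply: lt_le_trans gk (gM _ _); rewrite ltnW// (leq_trans _ (ltn_ord M)).
- move=> k /andP[Mk km]; rewrite leNgt; apply/negP => gk.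
  have Mk1 : (M < k)%N.
    rewrite ltn_neqAle Mk andbT; apply/eqP => E; move: gk; rewrite -E ltNge gM//.
    by rewrite E ltnS.
  have [M0|M0] := posnP M.
    by move: gk; rewrite ltNge (le_trans _ (g0min k))// -M0 gM.
  apply: (valley M k k.+1) => //.
  by apply: lt_le_trans gk (gM _ _).
Qed.

Lemma edist_le_norm1 p u : edist p u <= `|u.1 - p.1| + `|u.2 - p.2|.
Proof.
rewrite -[leRHS]ger0_norm ?addr_ge0// -sqrtr_sqr /edist ler_sqrt ?sqr_ge0//.
rewrite -[(p.1 - _) ^+ 2]sqrrN -[(p.2 - _) ^+ 2]sqrrN !opprB [in leRHS]sqrrD.
rewrite !real_normK ?num_real//.
by rewrite addrAC lerDl mulrn_wge0// mulr_ge0.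
Qed.

(** Bounds the supremum that defines [perim]: the length is at most the sum of the variations of the
    two coordinates, each at most [4 * M]. *)
Lemma closed_length_box n (v : 'I_n -> plane) (M : R) : 0 <= M ->
  strictly_ccw v -> (forall i, `|(v i).1| <= M /\ `|(v i).2| <= M) ->
  closed_length v <= 8 * M.
Proof.
move=> M0 ccw bnd.
have MM : - M <= M by rewrite (le_trans _ M0)// oppr_le0.
have H1 : \sum_i `|(v (ordS i)).1 - (v i).1| <= 2 * (M - - M).
  have E p : 1 * p.1 + 0 * p.2 = p.1 by ring.
  have := @functional_variation n v 1 0 (- M) M ccw; under eq_bigr do rewrite /= !E.
  by apply => // i; rewrite E -ler_norml; have [] := bnd i.
have H2 : \sum_i `|(v (ordS i)).2 - (v i).2| <= 2 * (M - - M).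
  have E p : 0 * p.1 + 1 * p.2 = p.2 by ring.
  have := @functional_variation n v 0 1 (- M) M ccw; under eq_bigr do rewrite /= !E.
  by apply => // i; rewrite E -ler_norml; have [] := bnd i.
apply: (@le_trans _ _ (\sum_i (`|(v (ordS i)).1 - (v i).1| + `|(v (ordS i)).2 - (v i).2|))).
  by apply: ler_sum => i _; exact: edist_le_norm1.
rewrite big_split/=; lra.
Qed.
End CcwPolygons.

(** * Extreme points of convex cells *)

Section ExtremePoints.
Context {R : realType}.
Local Notation plane := (R * R)%type.
Implicit Types (p u v z : plane) (C : set plane).

Definition mix (t : R) p u : plane := ((1 - t) * p.1 + t * u.1, (1 - t) * p.2 + t * u.2).

Definition cvx C := forall t p u, 0 <= t <= 1 -> C p -> C u -> C (mix t p u).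

Lemma convex_setP C : convex_set (C : set (convex_lmodType plane)) -> cvx C.
Proof.
move=> cC t p u /andP[t0 t1] Cp Cu.
have h0 : 0 <= 1 - t by rewrite subr_ge0.
have h1 : 1 - t <= 1 by rewrite gerBl.
have := cC p u (Itv01 h0 h1); rewrite !inE => /(_ Cp Cu).
suff -> : mix t p u = conv (Itv01 h0 h1) (p : convex_lmodType plane) (u : convex_lmodType plane) by [].
transitivity ((1 - t) *: p + (1 - (1 - t)) *: u); last by [].
by rewrite opprB addrCA subrr addr0.
Qed.

(** Extreme points in midpoint form; they are the corners that will be counted. *)
Definition ext C v := C v /\ forall z, C (v + z) -> C (v - z) -> z = 0.

(** Passes from midpoints to any inner point of a segment: changing the parameter by [min t (1 - t)]
    both ways gives two points of [C] symmetric about [v]. *)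
Lemma ext_mix C v p u t : cvx C -> ext C v -> C p -> C u -> 0 < t < 1 ->
  v = mix t p u -> v = p /\ v = u.
Proof.
move=> cC [Cv ev] Cp Cu /andP[t0 t1] E.
suff pu : p = u.
  by split; rewrite E pu /mix -!mulrDl subrK !mul1r -surjective_pairing.
pose s := Num.min t (1 - t).
have s0 : 0 < s by rewrite lt_min t0 subr_gt0.
have st : s <= t by rewrite ge_min lexx.
have st1 : s <= 1 - t by rewrite ge_min lexx orbT.
pose z : plane := (s * (u.1 - p.1), s * (u.2 - p.2)).
have z0 : z = 0.
  apply: ev.
  - have -> : v + z = mix (t + s) p u.
      by rewrite E /mix /z; congr (_, _) => /=; ring.
    by apply: cC => //; apply/andP; split; lra.
  - have -> : v - z = mix (t - s) p u.
      by rewrite E /mix /z; congr (_, _) => /=; ring.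
    by apply: cC => //; apply/andP; split; lra.
move: z0 => /eqP; rewrite xpair_eqE !mulf_eq0 (gt_eqF s0) /= !subr_eq0.
by move=> /andP[/eqP e1 /eqP e2]; rewrite [p]surjective_pairing [u]surjective_pairing e1 e2.
Qed.

(** The three orientations are barycentric weights of [v] in the triangle [p u w]. Writing [v] as a
    mixture of [p] and a point of the side [u w] reduces the claim to [ext_mix], apart from the
    cases of vanishing weights. *)
Lemma ext_triangle C v p u w : cvx C -> ext C v -> C p -> C u -> C w ->
  0 <= orient v u w -> 0 <= orient v w p -> 0 <= orient v p u ->
  0 < orient v u w + orient v w p + orient v p u -> [\/ v = p, v = u | v = w].
Proof.
move=> cC ev Cp Cu Cw.
set a := orient v u w; set b := orient v w p; set c := orient v p u.
move=> a0 b0 c0 s0; have sn0 : a + b + c != 0 by rewrite gt_eqF.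
have Ev1 : (a + b + c) * v.1 = a * p.1 + b * u.1 + c * w.1 by rewrite /a /b /c /orient; ring.
have Ev2 : (a + b + c) * v.2 = a * p.2 + b * u.2 + c * w.2 by rewrite /a /b /c /orient; ring.
have [bc0|bc0] := eqVneq (b + c) 0.
  move: Ev1 Ev2 sn0; have [-> ->] : b = 0 /\ c = 0 by split; lra.
  rewrite !addr0 !mul0r !addr0 => /[swap] /mulfI E2 /mulfI E1 sn0.
  by constructor 1; rewrite [v]surjective_pairing [p]surjective_pairing E1// E2.
have bcp : 0 < b + c by rewrite lt_neqAle eq_sym bc0 addr_ge0.
pose m := mix (c / (b + c)) u w.
have m1 : (b + c) * m.1 = b * u.1 + c * w.1 by rewrite /m /mix/=; field.
have m2 : (b + c) * m.2 = b * u.2 + c * w.2 by rewrite /m /mix/=; field.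
have Cm : C m.
  apply: cC => //; rewrite divr_ge0 ?(ltW bcp)//= ler_pdivrMr//; lra.
have Em : v = mix ((b + c) / (a + b + c)) p m.
  rewrite [LHS]surjective_pairing /mix; congr (_, _); apply: (mulfI sn0).
    by rewrite Ev1 -addrA -m1; field.
  by rewrite Ev2 -addrA -m2; field.
have [a00|an0] := eqVneq a 0.
  have vm : v = m.
    rewrite Em a00 add0r divff// /mix subrr !mul0r !mul1r !add0r.
    by rewrite -surjective_pairing.
  have [c00|cn0] := eqVneq c 0.
    by constructor 2; rewrite vm /m c00 /mix mul0r subr0 !mul1r !mul0r !addr0 -surjective_pairing.
  have [b00|bn0] := eqVneq b 0.
    by constructor 3; rewrite vm /m b00 add0r divff// /mix subrr !mul1r !mul0r !add0r -surjective_pairing.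
  have [|-> _] := ext_mix cC ev Cu Cw _ vm; last by constructor 2.
  have b1 : 0 < b by rewrite lt_neqAle eq_sym bn0.
  have c1 : 0 < c by rewrite lt_neqAle eq_sym cn0.
  by rewrite divr_gt0//= ltr_pdivrMr//; lra.
have [|-> _] := ext_mix cC ev Cp Cm _ Em; last by constructor 1.
have a1 : 0 < a by rewrite lt_neqAle eq_sym an0.
by rewrite divr_gt0//= ?ltr_pdivrMr//; lra.
Qed.

(** On the face where the functional is maximal, the orthogonal functional is maximized in turn; its
    maximizer is an end of the face, hence extreme. *)
Lemma ext_max C (a b : R) : compact C -> C !=set0 -> (a != 0) || (b != 0) ->
  exists2 u, ext C u & forall p, C p -> a * p.1 + b * p.2 <= a * u.1 + b * u.2.
Proof.
move=> cC C0 ab.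
have cf (x y : R) : continuous (fun p : plane => x * p.1 + y * p.2).
  move=> p; apply: cvgD; apply: cvgMr; by [exact: cvg_fst|exact: cvg_snd].
have [c Cc cmax] := compact_EVT_max C0 cC (continuous_subspaceT (cf a b)).
pose D := C `&` [set p | a * p.1 + b * p.2 = a * c.1 + b * c.2].
have cD : compact D.
  apply: compact_closedI => //.
  by apply: (@preimage_closed _ _ (fun p => _) [set x | x = _]) => [p _|]; [exact: cf|exact: closed_eq].
have D0 : D !=set0 by exists c; split => //; rewrite inE in Cc.
have [u Du umax] := compact_EVT_max D0 cD (continuous_subspaceT (cf (- b) a)).
move: Du; rewrite inE => -[Cu Eu].
exists u; last by move=> p Cp; rewrite Eu; apply: cmax; rewrite inE.
split=> // z C1 C2.
have C1' : u + z \in C by rewrite inE. have C2' : u - z \in C by rewrite inE.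
have z1 : a * z.1 + b * z.2 = 0.
  have := cmax _ C1'; have := cmax _ C2'; rewrite -Eu /=; lra.
have D1 : u + z \in D by rewrite inE; split => //=; rewrite -Eu; lra.
have D2 : u - z \in D by rewrite inE; split => //=; rewrite -Eu; lra.
have z2 : - b * z.1 + a * z.2 = 0.
  have := umax _ D1; have := umax _ D2; rewrite /=; lra.
have ab0 : a ^+ 2 + b ^+ 2 != 0.
  by rewrite paddr_eq0 ?sqr_ge0// !sqrf_eq0 negb_and.
rewrite [z]surjective_pairing; congr (_, _); apply: (mulfI ab0); rewrite mulr0.
  have -> : (a ^+ 2 + b ^+ 2) * z.1 = a * (a * z.1 + b * z.2) - b * (- b * z.1 + a * z.2) by ring.
  by rewrite z1 z2; ring.
have -> : (a ^+ 2 + b ^+ 2) * z.2 = b * (a * z.1 + b * z.2) + a * (- b * z.1 + a * z.2) by ring.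
by rewrite z1 z2; ring.
Qed.

Definition ext_polygon C n (v : 'I_n -> plane) :=
  [/\ injective v, strictly_ccw v & forall i, ext C (v i)].

(** A point [u] strictly to the right of a side is inserted in that side. After rotation the side
    runs from [x m] to [x 0] and [u] comes last. If a triple ending with [u] did not turn left, then
    [x 0], [x m] or [x k] would be in a triangle of [u] and two other vertices, against
    extremality. *)
Lemma ext_polygon_insert C m (v : 'I_m.+1 -> plane) i u : (0 < m)%N -> cvx C ->
  ext_polygon C v -> ext C u -> orient (v i) (v (ordS i)) u < 0 ->
  exists w : 'I_m.+2 -> plane, ext_polygon C w.
Proof.
move=> m0 cC [vinj vccw vext] eu ou.
have [s [sb s0 sccw sS]] := rotate_to (ordS i) vccw.
have smax : s ord_max = i.
  by apply: (@ordS_inj m.+1); rewrite -sS -s0; congr s; apply/val_inj; rewrite /= modnn.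
pose x k := v (s (inord k)).
have xinj j k : (j < m.+1)%N -> (k < m.+1)%N -> x j = x k -> j = k.
  by move=> jm km /vinj /(bij_inj sb) /(congr1 val); rewrite /= !inordK.
have xccw j k l : (j < k)%N -> (k < l)%N -> (l < m.+1)%N -> 0 < orient (x j) (x k) (x l).
  by move=> jk kl lm; apply: sccw; rewrite !inordK; lia.
have xext j : ext C (x j) by exact: vext.
have xC j : C (x j) by case: (xext j).
have uC : C u by case: eu.
have {}ou : orient (x m) (x 0%N) u < 0.
  rewrite /x (_ : inord m = ord_max); last by apply/val_inj; rewrite /= inordK.
  by rewrite (_ : inord 0 = ord0) ?smax ?s0//; apply/val_inj; rewrite /= inordK.
have ux j : (j < m.+1)%N -> u <> x j.
  move=> jm E; move: ou; rewrite {}E; have [->|jm'] := eqVneq j m.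
    by rewrite orient_rot orient_rot orientxx ltxx.
  have [->|j0] := posnP j; first by rewrite orient_rot orientxx ltxx.
  by rewrite orient_rot ltNge ltW// xccw//; lia.
have H0 j : (0 < j)%N -> (j < m)%N -> 0 < orient (x 0%N) (x j) u.
  move=> j0 jm; rewrite ltNge; apply/negP => o.
  have o1 : 0 < orient (x 0%N) (x j) (x m) by exact: xccw.
  have o2 : 0 < orient (x 0%N) (x m) u by rewrite orientC; lra.
  have o3 : 0 <= orient (x 0%N) u (x j) by rewrite orient_rot orient_rot orientC; lra.
  have [||/xinj|/xinj] := ext_triangle cC (xext 0%N) uC (xC j) (xC m) (ltW o1) (ltW o2) o3.
  - by rewrite ltr_pwDl// addr_gt0.
  - by move=> /esym/ux; apply.
  - by move=> H; have := H isT; lia.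
  - by move=> H; have := H isT; lia.
have Hm j : (0 < j)%N -> (j < m)%N -> 0 < orient (x j) (x m) u.
  move=> j0 jm; rewrite ltNge; apply/negP => o.
  have o1 : 0 < orient (x m) (x 0%N) (x j) by rewrite orient_rot; exact: xccw.
  have o2 : 0 < orient (x m) u (x 0%N) by rewrite orient_rot orient_rot orientC; lra.
  have o3 : 0 <= orient (x m) (x j) u by rewrite orientC; lra.
  have [|/xinj||/xinj] := ext_triangle cC (xext m) (xC j) uC (xC 0%N) (ltW o2) (ltW o1) o3.
  - by rewrite ltr_pwDl// addr_gt0.
  - by move=> H; have := H (ltnSn m); lia.
  - by move=> /esym/ux; apply.
  - by move=> H; have := H (ltnSn m); lia.
have H j k : (j < k)%N -> (k < m.+1)%N -> 0 < orient (x j) (x k) u.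
  move=> jk; rewrite ltnS leq_eqVlt => /predU1P[km|km].
    have [j0|j0] := posnP j; last by rewrite km; apply: Hm => //; rewrite -km.
    by rewrite j0 km orientC; lra.
  have [j0|j0] := posnP j; first by rewrite j0; apply: H0 => //; rewrite -j0.
  rewrite ltNge; apply/negP => o.
  have o1 : 0 < orient (x k) (x 0%N) (x j) by rewrite orient_rot; apply: xccw => //; lia.
  have o2 : 0 < orient (x k) u (x 0%N).
    by rewrite -orient_rot; apply: H0; lia.
  have o3 : 0 <= orient (x k) (x j) u by rewrite orientC; lra.
  have [|/xinj||/xinj] := ext_triangle cC (xext k) (xC j) uC (xC 0%N) (ltW o2) (ltW o1) o3.
  - by rewrite ltr_pwDl// addr_gt0.
  - by move=> H; have := H _ _; lia.
  - by move=> /esym/ux; apply; lia.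
  - by move=> H; have := H _ _; lia.
pose w (k : 'I_m.+2) := if (k < m.+1)%N then x k else u.
have wx (k : 'I_m.+2) : (k < m.+1)%N -> w k = x k by rewrite /w => ->.
have wu (k : 'I_m.+2) : ~~ (k < m.+1)%N -> w k = u by rewrite /w => /negPf ->.
exists w; split.
- move=> j k; have [jm|jm] := boolP (j < m.+1)%N; have [km|km] := boolP (k < m.+1)%N.
  + by rewrite !wx// => /xinj E; apply/val_inj/E.
  + by rewrite wx// wu// => /esym/ux; case.
  + by rewrite [in w k]wx// wu// => /ux; case.
  + by move=> _; apply/val_inj => /=; have := ltn_ord j; have := ltn_ord k; lia.
- move=> j k l /andP[jk kl]; have lm := ltn_ord l.
  rewrite (wx j) ?(wx k); try lia.
  have [lm1|lm1] := boolP (l < m.+1)%N; first by rewrite wx//; exact: xccw.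
  by rewrite wu//; apply: H; lia.
- by move=> k; rewrite /w; case: ifP.
Qed.

Lemma ordS_neq n (i : 'I_n) : (1 < n)%N -> ordS i != i.
Proof. by move=> n1; apply/eqP => /(congr1 (@nat_of_ord n)); rewrite val_ordS; case: ifP; lia. Qed.

Lemma interior_box C c : C° c ->
  exists2 e : R, 0 < e & forall a b, `|a| < e -> `|b| < e -> C (c.1 + a, c.2 + b).
Proof.
move=> /nbhs_ballP[e /= e0 Be]; exists e => // a b ae be; apply: Be.
by split; rewrite /ball/= opprD addrA subrr sub0r normrN.
Qed.

Lemma ext_polygon_size C n (v : 'I_n -> plane) : finite_set [set v | ext C v] ->
  ext_polygon C v -> (n <= #|` fset_set [set v | ext C v]|)%N.
Proof.
move=> fE [vinj _ vext].
rewrite -[n in (n <= _)%N]card_ord cardE -(size_map v) uniq_leq_size//.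
  by rewrite map_inj_uniq// enum_uniq.
by move=> _ /mapP[i _ ->]; rewrite in_fset_set//; apply/mem_set; exact: vext.
Qed.

(* Take a counterclockwise polygon of extreme points with the most vertices. *)
Lemma polygonal_cell C : compact C -> cvx C -> C° !=set0 ->
  finite_set [set v | ext C v] ->
  exists m (v : 'I_m.+1 -> plane), [/\ (1 < m)%N, ext_polygon C v &
    forall p i, C p -> 0 <= orient (v i) (v (ordS i)) p].
Proof.
move=> kC cC [c Cc] fE; have [e e0 Be] := interior_box Cc.
have C0 : C !=set0 by exists c; exact: interior_subset.
pose P n := `[< exists v : 'I_n -> plane, ext_polygon C v >].
have bound n : P n -> (n <= #|` fset_set [set v | ext C v]|)%N.
  by move=> /asboolP[v]; exact: ext_polygon_size.
(* A leftmost and a rightmost extreme point start the search; for two vertices [strictly_ccw] is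
   vacuous. *)
have P2 : P 2.
  have [|u1 eu1 max1] := @ext_max C 1 0 kC C0; first by rewrite oner_eq0.
  have [|u2 eu2 max2] := @ext_max C (-1) 0 kC C0; first by rewrite oppr_eq0 oner_eq0.
  have u12 : u1 <> u2.
    move=> E; have e2 : `|e / 2| < e by rewrite gtr0_norm ?divr_gt0//; lra.
    have e00 : `|0 : R| < e by rewrite normr0.
    have := max1 _ (Be _ _ e2 e00); have := max2 _ (interior_subset Cc).
    by rewrite E/=; lra.
  apply/asboolP; exists (fun i : 'I_2 => if i == ord0 then u1 else u2); split.
  - move=> [[|[|//]] ?] [[|[|//]] ?] //= E;
      by [apply/val_inj|case: u12|case: u12].
  - by move=> i j k; have := ltn_ord k; lia.
  - by move=> i; case: ifP.
have exP : exists n, P n by exists 2.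
case: (ex_maxnP exP bound) => n /asboolP[v vpol] nmax.
have n2 := nmax _ P2; case: n n2 v vpol nmax => // m m0 v vpol nmax.
have v_neq i : v i != v (ordS i).
  case: vpol => vinj _ _; apply/eqP => /vinj/eqP; rewrite eq_sym.
  by rewrite (negPf (ordS_neq _ _)).
(* If a point of [C] were to the right of a side, so would be an extreme point farthest on that
   side, and inserting it would contradict maximality. *)
have left p i : C p -> 0 <= orient (v i) (v (ordS i)) p.
  move=> Cp; rewrite leNgt; apply/negP => o.
  have [|u eu umax] := @ext_max C ((v (ordS i)).2 - (v i).2) (- ((v (ordS i)).1 - (v i).1)) kC C0.
    rewrite oppr_eq0 !subr_eq0 -negb_and andbC; apply: contra (v_neq i) => /andP[/eqP e1 /eqP e2].
    by rewrite [v i]surjective_pairing [v (ordS i)]surjective_pairing e1 e2.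
  have [|w wpol] := ext_polygon_insert m0 cC vpol eu (i := i).
    by apply: le_lt_trans o; have := umax _ Cp; rewrite /orient; lra.
  have : P m.+2 by apply/asboolP; exists w.
  by move=> /nmax; rewrite ltnn.
exists m, v; split=> //.
have {}m0 : (0 < m)%N by [].
rewrite ltn_neqAle m0 andbT; apply/eqP => m1; subst m.
have E0 : ordS ord0 = ord_max :> 'I_2 by apply/val_inj.
have E1 : ordS ord_max = ord0 :> 'I_2 by apply/val_inj.
have Z p : C p -> orient (v ord0) (v ord_max) p = 0.
  move=> Cp; have := left p ord0 Cp; have := left p ord_max Cp.
  by rewrite E0 E1 orientC; lra.
have e2 : `|e / 2| < e by rewrite gtr0_norm ?divr_gt0//; lra.
have e00 : `|0 : R| < e by rewrite normr0.
have := v_neq ord0; rewrite E0 => /eqP; apply.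
have := Z _ (Be _ _ e2 e00); have := Z _ (Be _ _ e00 e2); have := Z _ (interior_subset Cc).
rewrite /orient/= => z0 z1 z2.
have h0 : e / 2 != 0 by rewrite gt_eqF// divr_gt0.
rewrite [LHS]surjective_pairing [RHS]surjective_pairing; congr (_, _).
  by apply/eqP; rewrite -subr_eq0 -oppr_eq0 opprB; apply/eqP/(mulIf h0); lra.
by apply/eqP; rewrite -subr_eq0 -oppr_eq0 opprB; apply/eqP/(mulIf h0); lra.
Qed.
End ExtremePoints.

(** * Area *)

Section PlaneMeasure.
Context {R : realType}.
Local Notation mR := (measurableTypeR R).
Local Notation plane := (R * R)%type.
Local Notation leb := (@lebesgue_measure R).

Lemma affine_measurable (a k : R) : measurable_fun setT (fun x : mR => a + k * x : mR).
Proof. by apply: measurable_realfun.measurable_funD => //; apply: measurable_realfun.measurable_funM. Qed.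

Lemma lebesgue_measure_affine (a k : R) (A : set mR) : 0 < k -> measurable A ->
  (k%:E * leb [set x : mR | A (a + k * x)%R])%E = leb A.
Proof.
move=> k0 mA.
pose mu : {measure set mR -> \bar R} := mscale (NngNum (ltW k0))
  (measure_function_pushforward__canonical__measure_function_Measure leb (affine_measurable a k)).
apply/esym; apply: (@lebesgue_measure_unique R mu) => // X /ocitvP[->|[x x12 ->]].
  by rewrite !measure0.
rewrite /mu/= /mscale/= /pushforward.
have -> : (fun x0 : mR => a + k * x0) @^-1` `]x.1, x.2] = `](x.1 - a) / k, (x.2 - a) / k]%classic.
  apply/seteqP; split=> y /=; rewrite !in_itv/=.
    by rewrite ltr_pdivrMr// ler_pdivlMr// ltrBlDl lerBrDl ![y * k]mulrC.
  by rewrite ltr_pdivrMr// ler_pdivlMr// ltrBlDl lerBrDl ![y * k]mulrC.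
rewrite !lebesgue_measure_itv/= !lte_fin x12 ltr_pM2r ?invr_gt0// ltrD2r x12.
by rewrite -!EFinB -EFinM; congr EFin; field; rewrite gt_eqF.
Qed.

Definition rescale (a b k : R) (p : mR * mR) : mR * mR := (a + k * p.1, b + k * p.2).

Lemma rescale_measurable a b k : measurable_fun setT (rescale a b k).
Proof.
apply/measurable_fun_pairP; split.
  by apply: (measurableT_comp (affine_measurable a k)) => //; exact: measurable_fst.
by apply: (measurableT_comp (affine_measurable b k)) => //; exact: measurable_snd.
Qed.

(** The scaled pushforward agrees with the product measure on rectangles, which determine it. The
    case [k = 1] is translation invariance. *)
Lemma area_rescale (a b k : R) (A : set (mR * mR)) : 0 < k -> measurable A ->
  ((k ^+ 2)%:E * area (rescale a b k @^-1` A))%E = area A.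
Proof.
move=> k0 mA.
have k2 : 0 < k ^+ 2 by rewrite exprn_gt0.
pose mu : {measure set (mR * mR) -> \bar R} := mscale (NngNum (ltW k2))
  (measure_function_pushforward__canonical__measure_function_Measure
     (leb \x leb)%E (rescale_measurable a b k)).
apply/esym; apply: (@product_measure_unique _ _ mR mR R leb leb mu) => // X Y mX mY.
rewrite /mu/= /mscale/= /pushforward.
have -> : rescale a b k @^-1` (X `*` Y) =
    [set x : mR | X (a + k * x)] `*` [set x : mR | Y (b + k * x)] by [].
have mX' : measurable [set x : mR | X (a + k * x)].
  by rewrite -[X in measurable X]setTI; exact: affine_measurable.
have mY' : measurable [set x : mR | Y (b + k * x)].
  by rewrite -[X in measurable X]setTI; exact: affine_measurable.
rewrite product_measure1E// -(lebesgue_measure_affine a k0 mX) -(lebesgue_measure_affine b k0 mY).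
by rewrite expr2 EFinM muleACA.
Qed.

(** Measurable sets are those of the product structure, so an open set is exhibited as a countable
    union of rational boxes. *)
Lemma open_measurable2 (U : set plane) : open U -> measurable (U : set (mR * mR)).
Proof.
move=> oU.
pose box (t : rat * rat * rat) : set plane :=
  [set` `]ratr t.1.1 - ratr t.2, ratr t.1.1 + ratr t.2[%R] `*`
  [set` `]ratr t.1.2 - ratr t.2, ratr t.1.2 + ratr t.2[%R].
have -> : U = \bigcup_(t in [set t | box t `<=` U]) box t.
  apply/seteqP; split=> p; last by move=> [t tU]; exact: tU.
  move=> Up; have /nbhs_ballP[e /= e0 Be] := open_nbhs_nbhs (conj oU Up).
  (* A box of half-width [r] whose centre is within [r] of [p] stays within [2 r < e] of [p]. *)
  have [r] : exists r : rat, e / 4 < ratr r < e / 2.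
    have [|r] := @rat_in_itvoo R (e / 4) (e / 2); first by lra.
    by rewrite in_itv/= => ?; exists r.
  move=> /andP[r1 r2]; have r0 : 0 < ratr r :> R by lra.
  have [x] : exists x : rat, p.1 - ratr r < ratr x < p.1 + ratr r.
    have [|x] := @rat_in_itvoo R (p.1 - ratr r) (p.1 + ratr r); first by lra.
    by rewrite in_itv/= => ?; exists x.
  move=> /andP[x1 x2].
  have [y] : exists y : rat, p.2 - ratr r < ratr y < p.2 + ratr r.
    have [|y] := @rat_in_itvoo R (p.2 - ratr r) (p.2 + ratr r); first by lra.
    by rewrite in_itv/= => ?; exists y.
  move=> /andP[y1 y2].
  exists (x, y, r) => /=; last by split; rewrite /= in_itv/=; apply/andP; split; lra.
  move=> u [/=]; rewrite !in_itv/= => /andP[u1 u2] /andP[u3 u4]; apply: Be.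
  by split; rewrite /ball/= ltr_norml; apply/andP; split; lra.
rewrite bigcup_mkcond; apply: countable_bigcupT_measurable => // t.
case: ifP => // _; apply: measurableX; exact: measurable_itv.
Qed.

Lemma closed_measurable2 (A : set plane) : closed A -> measurable (A : set (mR * mR)).
Proof.
move=> cA; rewrite -[A]setCK; apply: measurableC.
by apply: open_measurable2; exact: closed_openC.
Qed.

Lemma integral_affine (a b c d : R) : a <= b ->
  (\int[leb]_(x in `[a, b]) (c + d * (x - a))%:E = ((b - a) * (c + d * (b - a) / 2))%:E)%E.
Proof.
rewrite le_eqVlt => /predU1P[<-|ab].
  by rewrite subrr mul0r set_itv1 integral_set1.
pose F x := c * (x - a) + d / 2 * (x - a) ^+ 2.
have dF (x : R) : is_derive x 1 F (c + d * (x - a)).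
  rewrite /F; apply: is_derive_eq; rewrite /GRing.scale/=; by field.
have cont : continuous (fun x => c + d * (x - a)).
  by move=> x; apply: cvgD; [exact: cvg_cst|apply: cvgMr; apply: cvgB; [exact: cvg_id|exact: cvg_cst]].
have cF : continuous F.
  by move=> x; apply/differentiable_continuous/derivable1_diffP; case: (dF x).
rewrite (@continuous_FTC2 _ _ F)//.
- by rewrite -EFinB; congr EFin; rewrite /F; field.
- exact: continuous_subspaceT.
- split; first by move=> x _; case: (dF x).
    exact/cvg_at_right_filter/cF.
  exact/cvg_at_left_filter/cF.
- by move=> x _; rewrite derive1E derive_val.
Qed.

Definition trapezoid (a b l0 l1 u0 u1 : R) : set plane :=
  [set p | a <= p.1 <= b /\ l0 + l1 * (p.1 - a) <= p.2 <= u0 + u1 * (p.1 - a)].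

Lemma trapezoid_measurable a b l0 l1 u0 u1 :
  measurable (trapezoid a b l0 l1 u0 u1 : set (mR * mR)).
Proof.
apply: closed_measurable2.
have cf (x y : R) : continuous (fun p : plane => x * p.1 + y * p.2).
  move=> p; apply: cvgD; apply: cvgMr; by [exact: cvg_fst|exact: cvg_snd].
have H x y z : closed [set p : plane | z <= x * p.1 + y * p.2].
  by apply: (@preimage_closed _ _ (fun p => _) [set t | z <= t]) => [p _|]; [exact: cf|exact: closed_ge].
have -> : trapezoid a b l0 l1 u0 u1 =
    ([set p : plane | a <= 1 * p.1 + 0 * p.2] `&` [set p : plane | - b <= - 1 * p.1 + 0 * p.2]) `&`
    ([set p : plane | l0 - l1 * a <= - l1 * p.1 + 1 * p.2] `&`
     [set p : plane | - u0 + u1 * a <= u1 * p.1 + - 1 * p.2]).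
  apply/seteqP; split=> p /=.
    by move=> [/andP[? ?] /andP[? ?]]; split; split; lra.
  by move=> [[? ?] [? ?]]; split; apply/andP; split; lra.
by apply: closedI; apply: closedI; exact: H.
Qed.

(** The product measure is the integral of the lengths of the vertical sections, which are affine in
    the abscissa. *)
Lemma area_trapezoid a b l0 l1 u0 u1 : a <= b -> l0 <= u0 ->
  l0 + l1 * (b - a) <= u0 + u1 * (b - a) ->
  area (trapezoid a b l0 l1 u0 u1) = ((b - a) * ((u0 - l0) + (u1 - l1) * (b - a) / 2))%:E.
Proof.
move=> ab lu lub; rewrite -integral_affine// /area /product_measure1.
rewrite [RHS]integral_mkcond; apply: eq_integral => x _ /=.
rewrite patchE; case: ifPn => [|/negP]; rewrite inE/= in_itv/= => xab.
  have -> : xsection (trapezoid a b l0 l1 u0 u1) x =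
      `[l0 + l1 * (x - a), u0 + u1 * (x - a)]%classic.
    apply/seteqP; split=> y; rewrite /xsection/= inE /trapezoid/= in_itv/=; first by case.
    by move=> H; split.
  rewrite lebesgue_measure_itv/= lte_fin.
  have H : l0 + l1 * (x - a) <= u0 + u1 * (x - a).
    move: ab; rewrite le_eqVlt => /predU1P[E|ab'].
      have -> : x = a by move: xab; rewrite -E => /andP[? ?]; lra.
      by rewrite subrr !mulr0 !addr0.
    have := xab => /andP[ax xb].
    rewrite -subr_ge0 -(@pmulr_rge0 _ (b - a)) ?subr_gt0//.
    have -> : (b - a) * (u0 + u1 * (x - a) - (l0 + l1 * (x - a))) =
      (b - x) * (u0 - l0) + (x - a) * (u0 + u1 * (b - a) - (l0 + l1 * (b - a))) by ring.
    by rewrite addr_ge0// mulr_ge0// subr_ge0.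
  move: H; rewrite le_eqVlt => /predU1P[H|H].
    rewrite H ltxx; congr EFin.
    by apply/esym; move: H; lra.
  by rewrite H -EFinB; congr EFin; ring.
rewrite (_ : xsection _ _ = set0) ?measure0//; apply/seteqP; split => // y.
by rewrite /xsection/= inE => -[].
Qed.

End PlaneMeasure.

(** * Upper bound for the area of a triangle *)

Section TriangleArea.
Context {R : realType}.
Local Notation mR := (measurableTypeR R).
Local Notation plane := (R * R)%type.
Local Notation leb := (@lebesgue_measure R).

Lemma area_le (A B : set plane) : measurable (A : set (mR * mR)) ->
  measurable (B : set (mR * mR)) -> A `<=` B -> (area A <= area B)%E.
Proof. by move=> mA mB AB; apply: (le_measure (leb \x leb)%E); rewrite ?inE. Qed.

Lemma area_setU_le (A B : set plane) : measurable (A : set (mR * mR)) ->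
  measurable (B : set (mR * mR)) -> (area (A `|` B) <= area A + area B)%E.
Proof. by move=> mA mB; exact: (measureU2 (leb \x leb)%E). Qed.

Definition triangle (a b c : plane) : set plane :=
  [set p | [/\ 0 <= orient a b p, 0 <= orient b c p & 0 <= orient c a p]].

Lemma triangle_rot a b c : triangle a b c = triangle b c a.
Proof. by apply/seteqP; split=> p [? ? ?]; split. Qed.

Lemma halfplane_closed (a b : plane) : closed [set p | 0 <= orient a b p].
Proof.
apply: (@preimage_closed _ _ (fun p => orient a b p) [set t | 0 <= t]) => [p _|]; last exact: closed_ge.
by rewrite /orient; apply: cvgB; apply: cvgMr; apply: cvgB; by [exact: cvg_fst|exact: cvg_snd|exact: cvg_cst].
Qed.

Lemma triangle_closed a b c : closed (triangle a b c).
Proof.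
have -> : triangle a b c = [set p | 0 <= orient a b p] `&`
   ([set p | 0 <= orient b c p] `&` [set p | 0 <= orient c a p]).
  by apply/seteqP; split=> p; [case|move=> [? [? ?]]].
by apply: closedI; [|apply: closedI]; exact: halfplane_closed.
Qed.

Lemma triangle_fst_range (a b c p : plane) (lo hi : R) : 0 < orient a b c -> triangle a b c p ->
  (forall q, q = a \/ q = b \/ q = c -> lo <= q.1 <= hi) -> lo <= p.1 <= hi.
Proof.
move=> o [t1 t2 t3] H.
have /andP[a1 a2] := H a (or_introl erefl).
have /andP[b1 b2] := H b (or_intror (or_introl erefl)).
have /andP[c1 c2] := H c (or_intror (or_intror erefl)).
have S : orient a b p + orient b c p + orient c a p = orient a b c by rewrite /orient; ring.
have E : orient a b c * p.1 = orient b c p * a.1 + orient c a p * b.1 + orient a b p * c.1.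
  by rewrite /orient; ring.
rewrite -(ler_pM2l o) -[X in _ && X](ler_pM2l o) E -S.
have := ler_wpM2l t1 c1; have := ler_wpM2l t2 a1; have := ler_wpM2l t3 b1.
have := ler_wpM2l t1 c2; have := ler_wpM2l t2 a2; have := ler_wpM2l t3 b2.
by move=> *; apply/andP; split; lra.
Qed.

Let two_trapezoids (T : set plane) a b l0 l1 u0 u1 a' b' l0' l1' u0' u1' (s : R) :
  measurable (T : set (mR * mR)) ->
  a <= b -> l0 <= u0 -> l0 + l1 * (b - a) <= u0 + u1 * (b - a) ->
  a' <= b' -> l0' <= u0' -> l0' + l1' * (b' - a') <= u0' + u1' * (b' - a') ->
  T `<=` trapezoid a b l0 l1 u0 u1 `|` trapezoid a' b' l0' l1' u0' u1' ->
  (b - a) * ((u0 - l0) + (u1 - l1) * (b - a) / 2) +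
  (b' - a') * ((u0' - l0') + (u1' - l1') * (b' - a') / 2) = s ->
  (area T <= s%:E)%E.
Proof.
move=> mT ab lu1 lu2 ab' lu1' lu2' sub <-.
apply: (@le_trans _ _ (area (trapezoid a b l0 l1 u0 u1 `|` trapezoid a' b' l0' l1' u0' u1'))).
  by apply: area_le => //; apply: measurableU; exact: trapezoid_measurable.
apply: le_trans (area_setU_le _ _) _; try exact: trapezoid_measurable.
by rewrite !area_trapezoid// -EFinD.
Qed.

(** The vertical line through [b] cuts the triangle into two trapezoids with one degenerate side;
    here [b] lies below the side [c a]. *)
Let area_triangle_up a b c : a.1 <= b.1 -> b.1 <= c.1 -> 0 < orient a b c ->
  (area (triangle a b c) <= (orient a b c / 2)%:E)%E.
Proof.
move=> ab bc o.
have ac : 0 < c.1 - a.1.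
  rewrite subr_gt0 lt_neqAle (le_trans ab bc) andbT; apply/eqP => E; move: o.
  have E2 : b.1 = a.1 by lra.
  by rewrite /orient E2 E subrr mul0r mulr0 subrr ltxx.
pose m := (c.2 - a.2) / (c.1 - a.1).
have Em : m * (c.1 - a.1) = c.2 - a.2 by rewrite divfK// gt_eqF.
(* A vertical side gets slope 0, by division by 0, but its trapezoid then has width 0; the equations
   for the slopes are used in the strict case only. *)
pose s1 := (b.2 - a.2) / (b.1 - a.1); pose s2 := (c.2 - b.2) / (c.1 - b.1).
have E1 : a.1 < b.1 -> s1 * (b.1 - a.1) = b.2 - a.2.
  by move=> h; rewrite divfK// subr_eq0 gt_eqF.
have E2 : b.1 < c.1 -> s2 * (c.1 - b.1) = c.2 - b.2.
  by move=> h; rewrite divfK// subr_eq0 gt_eqF.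
(* The height of the side [c a] above [b]; twice the area is this height times the width. *)
pose g := a.2 + m * (b.1 - a.1) - b.2.
have Eo : orient a b c = (c.1 - a.1) * g.
  by rewrite /orient -Em /g; ring.
have g0 : 0 < g by rewrite -(pmulr_rgt0 _ ac) -Eo.
apply: (two_trapezoids (a := a.1) (b := b.1) (l0 := a.2) (l1 := s1) (u0 := a.2) (u1 := m)
  (a' := b.1) (b' := c.1) (l0' := b.2) (l1' := s2) (u0' := g + b.2) (u1' := m)) => //.
- by apply: closed_measurable2; exact: triangle_closed.
- move: ab; rewrite le_eqVlt => /predU1P[->|h]; first by rewrite subrr !mulr0.
  by rewrite E1//; move: g0; rewrite /g; lra.
- by lra.
- move: bc; rewrite le_eqVlt => /predU1P[->|h]; first by rewrite subrr !mulr0; lra.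
  by rewrite E2// /g; move: Em; lra.
- move=> p Tp.
  have /andP[pa pc] : a.1 <= p.1 <= c.1.
    by apply: triangle_fst_range o Tp _ => x [->|[->|->]]; apply/andP; split; lra.
  have [t1 t2 t3] := Tp.
  have up : p.2 <= a.2 + m * (p.1 - a.1).
    rewrite -subr_ge0 -(pmulr_rge0 _ ac).
    rewrite [leRHS](_ : _ = orient c a p)//.
    have -> : (c.1 - a.1) * (a.2 + m * (p.1 - a.1) - p.2) =
      (c.1 - a.1) * (a.2 - p.2) + (m * (c.1 - a.1)) * (p.1 - a.1) by ring.
    by rewrite Em /orient; ring.
  have [/andP[abx pb]|H] := boolP ((a.1 < b.1) && (p.1 <= b.1)).
    left; split; first by rewrite pa.
    rewrite up andbT; have ba : 0 < b.1 - a.1 by rewrite subr_gt0.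
    rewrite -subr_ge0 -(pmulr_rge0 _ ba) [leRHS](_ : _ = orient a b p)//.
    have -> : (b.1 - a.1) * (p.2 - (a.2 + s1 * (p.1 - a.1))) =
      (b.1 - a.1) * (p.2 - a.2) - (s1 * (b.1 - a.1)) * (p.1 - a.1) by ring.
    by rewrite E1//.
  have bp : b.1 <= p.1.
    by move: H; rewrite negb_and -leNgt -ltNge => /orP[H|/ltW//]; exact: le_trans H pa.
  have bc' : b.1 < c.1.
    rewrite lt_neqAle bc andbT; apply/eqP => E; move: H; rewrite negb_and -leNgt -ltNge.
    by move=> /orP[H|H]; lra.
  have cb : 0 < c.1 - b.1 by rewrite subr_gt0.
  right; split; first by rewrite bp.
  apply/andP; split; last by rewrite /g; move: up; lra.
  rewrite -subr_ge0 -(pmulr_rge0 _ cb) [leRHS](_ : _ = orient b c p)//.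
  have -> : (c.1 - b.1) * (p.2 - (b.2 + s2 * (p.1 - b.1))) =
    (c.1 - b.1) * (p.2 - b.2) - (s2 * (c.1 - b.1)) * (p.1 - b.1) by ring.
  by rewrite E2.
- have -> : (b.1 - a.1) * (a.2 - a.2 + (m - s1) * (b.1 - a.1) / 2) = (b.1 - a.1) * g / 2.
    move: ab; rewrite le_eqVlt => /predU1P[->|h]; first by rewrite subrr !mul0r.
    have -> : (m - s1) * (b.1 - a.1) = m * (b.1 - a.1) - s1 * (b.1 - a.1) by ring.
    by rewrite E1// /g; field.
  have -> : (c.1 - b.1) * (g + b.2 - b.2 + (m - s2) * (c.1 - b.1) / 2) = (c.1 - b.1) * g / 2.
    move: bc; rewrite le_eqVlt => /predU1P[->|h]; first by rewrite subrr !mul0r.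
    have -> : (m - s2) * (c.1 - b.1) = m * (c.1 - b.1) - s2 * (c.1 - b.1) by ring.
    rewrite E2//.
    have -> : m * (c.1 - b.1) - (c.2 - b.2) = - g.
      by rewrite /g; move: Em; lra.
    by field.
  by rewrite Eo; field.
Qed.

(** The other position: [b] lies above the side [c a]. *)
Let area_triangle_down a b c : b.1 <= a.1 -> c.1 <= b.1 -> 0 < orient a b c ->
  (area (triangle a b c) <= (orient a b c / 2)%:E)%E.
Proof.
move=> ab bc o.
have ac : 0 < a.1 - c.1.
  rewrite subr_gt0 lt_neqAle (le_trans bc ab) andbT; apply/eqP => E; move: o.
  have E2 : b.1 = a.1 by lra.
  by rewrite /orient E2 E subrr mul0r mulr0 subrr ltxx.
pose m := (a.2 - c.2) / (a.1 - c.1).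
have Em : m * (a.1 - c.1) = a.2 - c.2 by rewrite divfK// gt_eqF.
pose s1 := (b.2 - c.2) / (b.1 - c.1); pose s2 := (a.2 - b.2) / (a.1 - b.1).
have E1 : c.1 < b.1 -> s1 * (b.1 - c.1) = b.2 - c.2.
  by move=> h; rewrite divfK// subr_eq0 gt_eqF.
have E2 : b.1 < a.1 -> s2 * (a.1 - b.1) = a.2 - b.2.
  by move=> h; rewrite divfK// subr_eq0 gt_eqF.
pose g := b.2 - (c.2 + m * (b.1 - c.1)).
have Eo : orient a b c = (a.1 - c.1) * g.
  have -> : orient a b c = (a.1 - c.1) * (b.2 - c.2) - (a.2 - c.2) * (b.1 - c.1).
    by rewrite /orient; ring.
  by rewrite -Em /g; ring.
have g0 : 0 < g by rewrite -(pmulr_rgt0 _ ac) -Eo.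
apply: (two_trapezoids (a := c.1) (b := b.1) (l0 := c.2) (l1 := m) (u0 := c.2) (u1 := s1)
  (a' := b.1) (b' := a.1) (l0' := b.2 - g) (l1' := m) (u0' := b.2) (u1' := s2)) => //.
- by apply: closed_measurable2; exact: triangle_closed.
- move: bc; rewrite le_eqVlt => /predU1P[->|h]; first by rewrite subrr !mulr0.
  by rewrite E1//; move: g0; rewrite /g; lra.
- by lra.
- move: ab; rewrite le_eqVlt => /predU1P[->|h]; first by rewrite subrr !mulr0; lra.
  by rewrite E2// /g; move: Em; lra.
- move=> p Tp.
  have /andP[pc pa] : c.1 <= p.1 <= a.1.
    by apply: triangle_fst_range o Tp _ => x [->|[->|->]]; apply/andP; split; lra.
  have [t1 t2 t3] := Tp.
  have up : c.2 + m * (p.1 - c.1) <= p.2.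
    rewrite -subr_ge0 -(pmulr_rge0 _ ac).
    rewrite [leRHS](_ : _ = orient c a p)//.
    have -> : (a.1 - c.1) * (p.2 - (c.2 + m * (p.1 - c.1))) =
      (a.1 - c.1) * (p.2 - c.2) - (m * (a.1 - c.1)) * (p.1 - c.1) by ring.
    by rewrite Em /orient; ring.
  have [/andP[abx pb]|H] := boolP ((c.1 < b.1) && (p.1 <= b.1)).
    left; split; first by rewrite pc.
    rewrite up /=; have ba : 0 < b.1 - c.1 by rewrite subr_gt0.
    rewrite -subr_ge0 -(pmulr_rge0 _ ba) [leRHS](_ : _ = orient b c p)//.
    have -> : (b.1 - c.1) * (c.2 + s1 * (p.1 - c.1) - p.2) =
      (b.1 - c.1) * (c.2 - p.2) + (s1 * (b.1 - c.1)) * (p.1 - c.1) by ring.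
    by rewrite E1// /orient; ring.
  have bp : b.1 <= p.1.
    by move: H; rewrite negb_and -leNgt -ltNge => /orP[H|/ltW//]; exact: le_trans H pc.
  have bc' : b.1 < a.1.
    rewrite lt_neqAle ab andbT; apply/eqP => E; move: H; rewrite negb_and -leNgt -ltNge.
    by move=> /orP[H|H]; lra.
  have cb : 0 < a.1 - b.1 by rewrite subr_gt0.
  right; split; first by rewrite bp.
  apply/andP; split; first by rewrite /g; move: up; lra.
  rewrite -subr_ge0 -(pmulr_rge0 _ cb) [leRHS](_ : _ = orient a b p)//.
  have -> : (a.1 - b.1) * (b.2 + s2 * (p.1 - b.1) - p.2) =
    (a.1 - b.1) * (b.2 - p.2) + (s2 * (a.1 - b.1)) * (p.1 - b.1) by ring.
  by rewrite E2// /orient; ring.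
- have -> : (b.1 - c.1) * (c.2 - c.2 + (s1 - m) * (b.1 - c.1) / 2) = (b.1 - c.1) * g / 2.
    move: bc; rewrite le_eqVlt => /predU1P[->|h]; first by rewrite subrr !mul0r.
    have -> : (s1 - m) * (b.1 - c.1) = s1 * (b.1 - c.1) - m * (b.1 - c.1) by ring.
    by rewrite E1// /g; field.
  have -> : (a.1 - b.1) * (b.2 - (b.2 - g) + (s2 - m) * (a.1 - b.1) / 2) = (a.1 - b.1) * g / 2.
    move: ab; rewrite le_eqVlt => /predU1P[->|h]; first by rewrite subrr !mul0r.
    have -> : (s2 - m) * (a.1 - b.1) = s2 * (a.1 - b.1) - m * (a.1 - b.1) by ring.
    rewrite E2//.
    have -> : a.2 - b.2 - m * (a.1 - b.1) = - g.
      by rewrite /g; move: Em; lra.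
    by field.
  by rewrite Eo; field.
Qed.

Lemma area_triangle a b c : 0 < orient a b c ->
  (area (triangle a b c) <= (orient a b c / 2)%:E)%E.
Proof.
(* A rotation of the names gives [b] the middle abscissa. *)
wlog H : a b c / (a.1 <= b.1 <= c.1) || (c.1 <= b.1 <= a.1).
  move=> H; have [|h1] := boolP ((a.1 <= b.1 <= c.1) || (c.1 <= b.1 <= a.1)); first exact: H.
  have [h2|h2] := boolP ((b.1 <= c.1 <= a.1) || (a.1 <= c.1 <= b.1)).
    by rewrite triangle_rot orient_rot; exact: H.
  rewrite -triangle_rot -orient_rot; apply: H.
  by move: h1 h2; case: (leP a.1 b.1); case: (leP b.1 c.1); case: (leP c.1 a.1) => //= *; lra.
by case/orP: H => /andP[? ?]; [exact: area_triangle_up|exact: area_triangle_down].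
Qed.
End TriangleArea.

(** * Perimeter of a cell *)

Section CellPerimeter.
Context {R : realType}.
Local Notation mR := (measurableTypeR R).
Local Notation plane := (R * R)%type.
Implicit Types (p u v z : plane) (C : set plane).

Lemma compact_closed2 C : compact C -> closed C.
Proof. by apply: compact_closed; exact: norm_hausdorff. Qed.

Lemma area_sum_le (F : nat -> set plane) (s : nat -> R) n :
  (forall k, (k < n)%N -> measurable (F k : set (mR * mR)) /\ (area (F k) <= (s k)%:E)%E) ->
  forall A : set plane, measurable (A : set (mR * mR)) ->
  (forall p, A p -> exists2 k, (k < n)%N & F k p) ->
  (area A <= (\sum_(k < n) s k)%:E)%E.
Proof.
elim: n => [_|n IH H] A mA sub.
  have -> : A = set0 by apply/seteqP; split => // p /sub[].
  by rewrite big_ord0 /area measure0.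
have [mF aF] := H n (ltnSn n).
rewrite big_ord_recr/= EFinD; apply: (@le_trans _ _ (area (A `\` F n) + area (F n))%E).
  apply: le_trans (area_setU_le _ _) => //; last exact: measurableD.
  apply: area_le => //; first by apply: measurableU => //; exact: measurableD.
  by move=> p Ap; have [Fp|nFp] := pselect (F n p); [right|left].
apply: leeD => //; apply: IH; first by move=> k kn; apply: H; rewrite ltnW.
  exact: measurableD.
move=> p [/sub[k kn Fkp] nFnp]; exists k => //.
by move: kn; rewrite ltnS leq_eqVlt => /predU1P[E|//]; move: nFnp; rewrite -E.
Qed.

Lemma ext_boundary C v : closed C -> ext C v -> boundary C v.
Proof.
move=> cC [Cv ev]; split; first exact: subset_closure.
move=> /interior_box[e e0 Be].
have e2 : `|e / 2| < e by rewrite gtr0_norm ?divr_gt0//; lra.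
have e2' : `|- (e / 2)| < e by rewrite normrN.
have e00 : `|0 : R| < e by rewrite normr0.
have : (e / 2, 0) = 0 :> plane.
  apply: ev; first exact: Be _ _ e2 e00.
  by have := Be _ _ e2' e00; rewrite addr0; congr C; rewrite -[v - _]/(_, _)/= subr0.
by move=> [/eqP]; rewrite gt_eqF// divr_gt0.
Qed.

Lemma compact_box C : compact C -> exists2 M : R, 0 <= M &
  forall p, C p -> `|p.1| <= M /\ `|p.2| <= M.
Proof.
move=> /compact_bounded[M0 [M0r HM]].
exists (`|M0| + 1); first by rewrite addr_ge0.
have M01 : M0 < `|M0| + 1 by rewrite (le_lt_trans (ler_norm _))// ltrDl.
move=> p Cp; have /= := HM _ M01 p Cp.
by rewrite prod_normE ge_max => /andP[].
Qed.

Lemma perim_has_sup C : compact C ->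
  has_sup [set l | exists n (v : 'I_n -> plane),
    [/\ forall i, boundary C (v i), strictly_ccw v & l = closed_length v]].
Proof.
move=> kC; have [M M0 HM] := compact_box kC.
split; first by exists (closed_length (fun _ : 'I_0 => 0)), 0%N, (fun=> 0); split => // -[].
exists (8 * M) => _ [n [v [bv ccw ->]]]; apply: closed_length_box => // i.
apply: HM; have [+ _] := bv i.
by rewrite -(proj1 (closure_id C) (compact_closed2 kC)).
Qed.

Lemma closed_length_le_perim C n (v : 'I_n -> plane) : compact C ->
  (forall i, boundary C (v i)) -> strictly_ccw v -> closed_length v <= perim C.
Proof.
move=> kC bv ccw; apply: sup_upper_bound; first exact: perim_has_sup.
by exists n, v; split.
Qed.

Lemma sign_change (f : nat -> R) m : (0 < m)%N -> 0 <= f 0%N -> f m <= 0 ->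
  exists2 k, (k < m)%N & 0 <= f k /\ f k.+1 <= 0.
Proof.
move=> + f0; elim: m => // m IH _ fm.
have [fm0|/ltW fm0] := leP 0 (f m); first by exists m.
have [m0|m0] := posnP m; first by exists 0%N => //; split=> //; rewrite -m0.
by have [k km] := IH m0 fm0; exists k => //; rewrite ltnW.
Qed.

(** Fan triangulation from [x 0]: the sum of cross products telescopes into the orientations of the
    triangles of the fan. A point of [C] lies in the triangle where its orientation with respect to
    the rays from [x 0] changes sign. *)
Lemma area_le_cross C m (v : 'I_m.+1 -> plane) : (1 < m)%N -> closed C ->
  strictly_ccw v -> (forall p i, C p -> 0 <= orient (v i) (v (ordS i)) p) ->
  (area C <= ((\sum_j cross (v j) (v (ordS j))) / 2)%:E)%E.
Proof.
move=> m1 cC ccw left.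
pose x k := v (inord k).
have xS k : (k < m)%N -> ordS (inord k) = inord k.+1 :> 'I_m.+1.
  by move=> km; apply/val_inj; rewrite /= !inordK// ?modn_small// ltnW.
have xm : ordS (inord m) = inord 0 :> 'I_m.+1.
  by apply/val_inj; rewrite /= !inordK// modnn.
have E : \sum_j cross (v j) (v (ordS j)) = \sum_(k < m.-1) orient (x 0%N) (x k.+1) (x k.+2).
  have -> : \sum_j cross (v j) (v (ordS j)) =
      \sum_(0 <= k < m) cross (x k) (x k.+1) + cross (x m) (x 0%N).
    rewrite big_ord_recr/= big_mkord; congr (_ + cross _ _).
    - apply: eq_bigr => k _; rewrite /x -xS//.
      by congr (cross (v _) (v (ordS _))); apply/val_inj; rewrite /= inordK// ltnS ltnW.
    - by rewrite /x; congr v; apply/val_inj; rewrite /= inordK.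
    - by rewrite /x -xm; congr (v (ordS _)); apply/val_inj; rewrite /= inordK.
  case: m m1 v x {ccw left xS xm} => // m m1 v x.
  rewrite big_mkord big_ord_recl/=.
  have -> : \sum_(k < m) orient (x 0%N) (x k.+1) (x k.+2) =
    \sum_(k < m) cross (x k.+1) (x k.+2) - \sum_(0 <= k < m) (cross (x 0%N) (x k.+2) - cross (x 0%N) (x k.+1)).
    by rewrite big_mkord -sumrB; apply: eq_bigr => k _; rewrite /orient /cross; ring.
  rewrite (telescope_sumr (fun k => cross (x 0%N) (x k.+1)))//.
  by rewrite /cross/bump/=; under eq_bigr do rewrite add1n; ring.
rewrite E mulr_suml.
apply: (@area_sum_le (fun k => triangle (x 0%N) (x k.+1) (x k.+2))
  (fun k => orient (x 0%N) (x k.+1) (x k.+2) / 2)).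
- move=> k km; split; first by apply: closed_measurable2; exact: triangle_closed.
  by apply: area_triangle; apply: ccw; rewrite !inordK//; lia.
- exact: closed_measurable2.
- move=> p Cp.
  have [||| k km [f1 f2]] := @sign_change (fun k => orient (x 0%N) (x k.+1) p) m.-1.
  + by rewrite -subn1 subn_gt0.
  + by rewrite /x -(xS 0%N (ltnW m1)); apply: left.
  + by rewrite (prednK (ltnW m1)) orientC oppr_le0 /x -xm; apply: left.
  exists k => //; split => //.
    by rewrite /x -(xS k.+1); [apply: left|lia].
  by rewrite orientC oppr_ge0.
Qed.

(** The polygon of extreme points is inscribed, so it bounds [perim C] from below, and it contains
    [C], so its area is at least 1. It has at most as many vertices as there are extreme points; as
    [corner_ratio > 1], having fewer only helps. *)
Lemma cell_perim_ge C : compact C -> cvx C -> C° !=set0 ->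
  finite_set [set v | ext C v] -> area C = 1%E ->
  8 * Num.sqrt 3 * corner_ratio ^+ 6 <= perim C ^+ 2 * corner_ratio ^+ #|` fset_set [set v | ext C v]| :> R.
Proof.
move=> kC cC iC fE aC.
have [m [v [m1 vpol left]]] := polygonal_cell kC cC iC fE.
have sz := ext_polygon_size fE vpol.
have [vinj ccw vext] := vpol.
have lP : closed_length v <= perim C.
  apply: closed_length_le_perim => // i; apply: ext_boundary => //.
  exact: compact_closed2.
have := area_le_cross m1 (compact_closed2 kC) ccw left.
rewrite aC lee_fin; set X := \sum_(_ < _) _ => X2.
have l0 : 0 <= closed_length v by apply: sumr_ge0 => i _; exact: edist_nneg.
have q0 : 0 < corner_ratio :> R := lt_trans ltr01 corner_ratio_gt1.
have iso : 2 * m.+1%:R * tan (pi / m.+1%:R) * X <= closed_length v ^+ 2.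
  by apply: isoperimetric_succ; rewrite ltnS.
have tn := @tan_lower_bound R m.+1 m1.
apply: (@le_trans _ _ (closed_length v ^+ 2 * corner_ratio ^+ m.+1)); last first.
  apply: ler_pM; rewrite ?exprn_ge0// ?(ltW q0)//.
    by rewrite ler_pXn2r ?nnegrE// (le_trans l0).
  by rewrite ler_weXn2l// ltW ?corner_ratio_gt1.
apply: (@le_trans _ _ (2 * m.+1%:R * tan (pi / m.+1%:R) * X * corner_ratio ^+ m.+1)); last first.
  by rewrite ler_pM2r ?exprn_gt0.
have -> : 2 * m.+1%:R * tan (pi / m.+1%:R) * X * corner_ratio ^+ m.+1 =
  2 * X * (m.+1%:R * tan (pi / m.+1%:R) * corner_ratio ^+ m.+1) by ring.
apply: (@le_trans _ _ (4 * (m.+1%:R * tan (pi / m.+1%:R) * corner_ratio ^+ m.+1))).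
  by move: tn; lra.
have t0 := @tan_pi_div_gt0 R m.+1 m1.
rewrite ler_wpM2r//; last by lra.
by apply: mulr_ge0; [apply: mulr_ge0 => //; exact: ltW|rewrite exprn_ge0// ltW].
Qed.
End CellPerimeter.

(** * Counting the corners of a tiling *)

Section VertexLemmas.
Context {R : realType}.
Local Notation plane := (R * R)%type.
Implicit Types (p u v y : plane) (A B C D : set plane).

(** Ties are broken by the second coordinate, so that a cell with a vertical side still has a single
    first and a single last point. *)
Definition lexlt p u := p.1 < u.1 \/ (p.1 = u.1 /\ p.2 < u.2).
Definition lexmin C v := C v /\ forall p, C p -> p <> v -> lexlt v p.
Definition lexmax C v := C v /\ forall p, C p -> p <> v -> lexlt p v.

Lemma lexlt_total p u : p <> u -> lexlt p u \/ lexlt u p.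
Proof.
move=> pu; case: (ltgtP p.1 u.1) => [h|h|e1]; [by left; left|by right; left|].
case: (ltgtP p.2 u.2) => [h|h|e2]; [by left; right|by right; right|].
by case: pu; rewrite [p]surjective_pairing [u]surjective_pairing e1 e2.
Qed.

Lemma lexlt_asym p u : lexlt p u -> lexlt u p -> False.
Proof. by move=> [h|[e h]] [h'|[e' h']]; lra. Qed.

Lemma lexmin_uniq C u v : lexmin C u -> lexmin C v -> u = v.
Proof.
move=> [Cu mu] [Cv mv]; apply: contrapT => uv.
by apply: (@lexlt_asym u v); [apply: mu => // /esym|exact: mv].
Qed.

Lemma lexmax_uniq C u v : lexmax C u -> lexmax C v -> u = v.
Proof.
move=> [Cu mu] [Cv mv]; apply: contrapT => uv.
by apply: (@lexlt_asym u v); [exact: mv|apply: mu => // /esym].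
Qed.

Lemma box_interior C c (e : R) : 0 < e ->
  (forall a b, `|a| < e -> `|b| < e -> C (c.1 + a, c.2 + b)) -> C° c.
Proof.
move=> e0 Be; apply/nbhs_ballP; exists e => //= p [p1 p2].
have := Be (p.1 - c.1) (p.2 - c.2); rewrite ![_ + (_ - _)]addrC !subrK -surjective_pairing; apply.
  by rewrite distrC.
by rewrite distrC.
Qed.

(** The homothety of centre [p] and ratio [t] sends a box around [y] to a box inside [C]. *)
Lemma cvx_interior C p y t : cvx C -> C p -> C° y -> 0 < t <= 1 -> C° (mix t p y).
Proof.
move=> cC Cp /interior_box[e e0 Be] /andP[t0 t1].
apply: (@box_interior _ _ (t * e)); first exact: mulr_gt0.
move=> a b ae be.
have -> : ((mix t p y).1 + a, (mix t p y).2 + b) = mix t p (y.1 + a / t, y.2 + b / t).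
  by rewrite /mix/=; congr (_, _); field; rewrite gt_eqF.
apply: cC => //; first by rewrite ltW.
by apply: Be; rewrite normrM normfV (gtr0_norm t0) ltr_pdivrMr// mulrC.
Qed.

Lemma mix_along v (w : plane) (s t : R) :
  mix s v (v.1 + t * w.1, v.2 + t * w.2) = (v.1 + s * t * w.1, v.2 + s * t * w.2).
Proof. by rewrite /mix/=; congr (_, _); ring. Qed.

(** On two given points the lexicographic order is the order of [x + e y] for all small positive
    [e]. *)
Lemma lexlt_tilt p u : lexlt p u -> exists2 e0 : R, 0 < e0 &
  forall e, 0 < e < e0 -> p.1 + e * p.2 < u.1 + e * u.2.
Proof.
case=> [h|[E h]]; last first.
  by exists 1 => // e /andP[e0 _]; rewrite E ltrD2l ltr_pM2l.
have d0 : 0 < 1 + `|u.2 - p.2| by rewrite ltr_pwDl.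
exists ((u.1 - p.1) / (1 + `|u.2 - p.2|)); first by rewrite divr_gt0// subr_gt0.
move=> e /andP[e0]; rewrite ltr_pdivlMr// => H.
have : - (e * (u.2 - p.2)) <= e * `|u.2 - p.2|.
  by rewrite -mulrN ler_pM2l// -normrN ler_norm.
by move: H; rewrite mulrDr mulr1; lra.
Qed.

(** Some point of [C] precedes [v] and some point follows it. For small [e] the functional [x + e y]
    separates both strictly from [v], so its level line through [v], of direction [(- e, 1)], meets
    the interior of [C], and not at [v]. *)
Lemma transversal C v : cvx C -> C° !=set0 -> C v -> ~ C° v ->
  ~ lexmin C v -> ~ lexmax C v -> exists2 e0 : R, 0 < e0 &
  forall e, 0 < e < e0 -> exists2 t : R, t != 0 & C° (v.1 + t * - e, v.2 + t * 1).
Proof.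
move=> cC [y Cy] Cv nCv nmin nmax.
have [p Cp pv] : exists2 p, C p & lexlt p v.
  apply: contrapT => H; apply: nmin; split=> // p Cp pv.
  by have [lpv|//] := lexlt_total pv; case: H; exists p.
have [u Cu vu] : exists2 u, C u & lexlt v u.
  apply: contrapT => H; apply: nmax; split=> // u Cu uv.
  by have [//|lvu] := lexlt_total uv; case: H; exists u.
have [e1 e10 E1] := lexlt_tilt pv; have [e2 e20 E2] := lexlt_tilt vu.
exists (Num.min e1 e2); first by rewrite lt_min e10.
move=> e /andP[e0]; rewrite lt_min => /andP[ee1 ee2].
pose l p := p.1 + e * p.2.
have l1 : l p < l v by apply: E1; rewrite e0.
have l2 : l v < l u by apply: E2; rewrite e0.
have lmix t a b : l (mix t a b) = (1 - t) * l a + t * l b by rewrite /l /mix/=; ring.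
(* The two separating points are replaced by interior points with nearly the same value of [l]. *)
have push a (s : R) : C a -> 0 < s -> exists2 a', C° a' & `|l a' - l a| < s.
  move=> Ca s0; pose k := `|l y - l a| + 1 + s.
  have k0 : 0 < k by rewrite addr_gt0// ltr_wpDl.
  exists (mix (s / k) a y).
    apply: cvx_interior => //; rewrite divr_gt0//= ler_pdivrMr// mul1r /k.
    by rewrite lerDr addr_ge0.
  rewrite lmix (_ : _ - _ = (s / k) * (l y - l a)); last by ring.
  rewrite normrM gtr0_norm ?divr_gt0// mulrAC ltr_pdivrMr// ltr_pM2l// /k.
  by lra.
have [p' Cp' lp'] := push p (l v - l p) Cp ltac:(by rewrite subr_gt0).
have [u' Cu' lu'] := push u (l u - l v) Cu ltac:(by rewrite subr_gt0).
have {lp'}lp' : l p' < l v by move: lp'; rewrite ltr_norml => /andP[_]; lra.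
have {lu'}lu' : l v < l u' by move: lu'; rewrite ltr_norml => /andP[+ _]; lra.
have d0 : 0 < l u' - l p' by rewrite subr_gt0 (lt_trans lp').
pose s := (l v - l p') / (l u' - l p').
have s0 : 0 < s by rewrite divr_gt0// subr_gt0.
have s1 : s <= 1 by rewrite ler_pdivrMr// mul1r lerD2r ltW.
pose r := mix s p' u'.
have Cr : C° r by apply: cvx_interior => //; [exact: interior_subset|rewrite s0].
have lr : l r = l v.
  by rewrite lmix /s; field; rewrite gt_eqF.
have rE : r = (v.1 + (r.2 - v.2) * - e, v.2 + (r.2 - v.2) * 1).
  rewrite [LHS]surjective_pairing; congr (_, _); last by ring.
  by move: lr; rewrite /l => lr; lra.
exists (r.2 - v.2); last by rewrite -rE.
apply/eqP => r0; apply: nCv; move: Cr; rewrite rE r0 !mul0r !addr0.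
by rewrite -surjective_pairing.
Qed.

(** Of two interior points on the same ray from [v], the nearer one is interior to both cells by
    [cvx_interior]. *)
Lemma same_side A B v (w : plane) t t' : cvx A -> cvx B -> A v -> B v ->
  A° `&` B° = set0 -> 0 < t * t' ->
  A° (v.1 + t * w.1, v.2 + t * w.2) -> B° (v.1 + t' * w.1, v.2 + t' * w.2) -> False.
Proof.
move=> cA cB Av Bv AB tt.
wlog H : A B t t' cA cB Av Bv AB tt / t / t' <= 1.
  move=> H At Bt; have [h|/ltW h] := leP (t / t') 1; first exact: (H A B t t').
  apply: (H B A t' t) => //; [by rewrite setIC|by rewrite mulrC|].
  have q0 : 0 < t / t' := lt_le_trans ltr01 h.
  by rewrite -(invf_div t t') invf_le1.
move=> At Bt.
have t'0 : t' != 0 by apply/eqP => E; move: tt; rewrite E mulr0 ltxx.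
have q0 : 0 < t / t'.
  have -> : t / t' = (t * t') / t' ^+ 2 by field.
  by rewrite divr_gt0// exprn_even_gt0.
have := cvx_interior cB Bv Bt (t := t / t'); rewrite q0 H mix_along divfK// => /(_ isT) Bt2.
have : (A° `&` B°) (v.1 + t * w.1, v.2 + t * w.2) by split.
by rewrite AB.
Qed.

(* A nearly vertical line through [v] enters the interior of each of the three
   cells, on one of its two sides. *)
Lemma three_cells A B C v :
  let good D := [/\ cvx D, D° !=set0, D v, ~ D° v & ~ lexmin D v /\ ~ lexmax D v] in
  good A -> good B -> good C ->
  A° `&` B° = set0 -> A° `&` C° = set0 -> B° `&` C° = set0 -> False.
Proof.
move=> good [cA iA Av nA [mA MA]] [cB iB Bv nB [mB MB]] [cC iC Cv nC [mC MC]] AB AC BC.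
have [ea ea0 Ha] := transversal cA iA Av nA mA MA.
have [eb eb0 Hb] := transversal cB iB Bv nB mB MB.
have [ec ec0 Hc] := transversal cC iC Cv nC mC MC.
pose m := Num.min ea (Num.min eb ec).
have m0 : 0 < m by rewrite !lt_min ea0 eb0.
have m2 : m / 2 < m by rewrite ltr_pdivrMr// ltr_pMr// ltr1n.
have ma : m <= ea by rewrite ge_min lexx.
have mb : m <= eb by rewrite !ge_min lexx orbT.
have mc : m <= ec by rewrite !ge_min lexx !orbT.
have e0 : 0 < m / 2 by rewrite divr_gt0.
have [|a an0 Aa] := Ha (m / 2); first by rewrite e0 (lt_le_trans m2).
have [|b bn0 Bb] := Hb (m / 2); first by rewrite e0 (lt_le_trans m2).
have [|c cn0 Cc] := Hc (m / 2); first by rewrite e0 (lt_le_trans m2).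
pose w : plane := (- (m / 2), 1).
have HAB : ~ 0 < a * b by move=> h; exact: (@same_side A B v w a b).
have HAC : ~ 0 < a * c by move=> h; exact: (@same_side A C v w a c).
have HBC : ~ 0 < b * c by move=> h; exact: (@same_side B C v w b c).
have [a0|a0|a0] := ltgtP a 0; last by move: an0; rewrite a0 eqxx.
- have [b0|b0|b0] := ltgtP b 0; last by move: bn0; rewrite b0 eqxx.
    by apply: HAB; rewrite nmulr_rgt0.
  have [c0|c0|c0] := ltgtP c 0; last by move: cn0; rewrite c0 eqxx.
    by apply: HAC; rewrite nmulr_rgt0.
  by apply: HBC; rewrite mulr_gt0.
- have [b0|b0|b0] := ltgtP b 0; last by move: bn0; rewrite b0 eqxx.
    have [c0|c0|c0] := ltgtP c 0; last by move: cn0; rewrite c0 eqxx.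
      by apply: HBC; rewrite nmulr_rgt0.
    by apply: HAC; rewrite mulr_gt0.
  by apply: HAB; rewrite mulr_gt0.
Qed.

(** A point of [A] interior to [B], moved slightly towards an interior point of [A], would be
    interior to both. *)
Lemma interior_disjoint A B : cvx A -> A° !=set0 -> A° `&` B° = set0 ->
  forall p, A p -> B° p -> False.
Proof.
move=> cA [y Ay] AB p Ap Bp; have [e e0 Be] := interior_box Bp.
have : (B°)° p by rewrite (proj1 (interior_id _) (@open_interior _ _)).
move=> /interior_box[d d0 Bd].
pose k := `|y.1 - p.1| + `|y.2 - p.2| + 1 + d.
have n1 := normr_ge0 (y.1 - p.1); have n2 := normr_ge0 (y.2 - p.2).
have k0 : 0 < k by rewrite /k; lra.
have t0 : 0 < d / k by rewrite divr_gt0.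
have t1 : d / k <= 1 by rewrite ler_pdivrMr// mul1r /k; lra.
suff : (A° `&` B°) (mix (d / k) p y) by rewrite AB.
split; first by apply: cvx_interior => //; rewrite t0.
have -> : mix (d / k) p y = (p.1 + (d / k) * (y.1 - p.1), p.2 + (d / k) * (y.2 - p.2)).
  by rewrite /mix; congr (_, _); ring.
by apply: Bd; rewrite normrM (gtr0_norm t0) mulrAC ltr_pdivrMr// ltr_pM2l// /k; lra.
Qed.

(** Connectedness of the segment: at the last parameter whose point is in [A], the points just after
    it are in [B], which is closed. *)
Lemma segment_meet A B a b : closed A -> closed B -> A a -> ~ A b ->
  (forall t, 0 <= t <= 1 -> A (mix t a b) \/ B (mix t a b)) ->
  exists2 t, 0 <= t <= 1 & A (mix t a b) /\ B (mix t a b).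
Proof.
move=> cA cB Aa nAb AB.
have cmix : continuous (fun t : R => mix t a b).
  have -> : (fun t : R => mix t a b) = (fun t => a + t *: (b - a)).
    by apply/funext => t; rewrite /mix -[RHS]/(_, _)/= /GRing.scale/=; congr (_, _); ring.
  move=> t; apply: cvgD; first exact: cvg_cst.
  by apply: cvgZ; [exact: cvg_id|exact: cvg_cst].
pose E := `[0, 1]%classic `&` (fun t : R => mix t a b) @^-1` A.
have kE : compact E.
  apply: compact_closedI; first exact: segment_compact.
  by apply: preimage_closed => // t _; exact: cmix.
have m0 : mix 0 a b = a by rewrite /mix subr0 !mul1r !mul0r !addr0 -surjective_pairing.
have m1 : mix 1 a b = b by rewrite /mix subrr !mul1r !mul0r !add0r -surjective_pairing.
have E0 : E !=set0 by exists 0; split; rewrite /= ?in_itv/= ?lexx ?ler01// m0.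
have cid : {within E, continuous (fun t : R => t)}.
  by apply: continuous_subspaceT => t; exact: cvg_id.
have [t tE tmax] := compact_EVT_max E0 kE cid.
move: tE; rewrite inE => -[/=]; rewrite in_itv/= => t01 At.
exists t => //; split=> //; apply: contrapT => nBt.
have t1 : t < 1.
  rewrite lt_neqAle; have /andP[_ ->] := t01; rewrite andbT; apply/eqP => t1.
  by apply: nAb; rewrite -m1 -t1.
have : nbhs t ((fun t : R => mix t a b) @^-1` (~` B)).
  by apply: cmix; apply: open_nbhs_nbhs; split => //; exact: closed_openC.
move=> /nbhs_ballP[d /= d0 Bd].
pose s := Num.min (t + d / 2) 1.
have ts : t < s by rewrite lt_min t1 ltrDl divr_gt0.
have s01 : 0 <= s <= 1.
  by rewrite ge_min lexx orbT andbT; have /andP[t0 _] := t01; rewrite (le_trans t0)// ltW.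
have [As|Bs] := AB s s01.
  have : s <= t by apply: tmax; rewrite inE; split => //=; rewrite in_itv.
  by rewrite leNgt ts.
apply: (Bd s) => //; rewrite /ball/= ltr0_norm ?subr_lt0// opprB.
have : s <= t + d / 2 by rewrite ge_min lexx.
by move: d0; lra.
Qed.

(* A segment from [A] to [B] meets both at some [c <> v]; as [v] is extreme in [A],
   the points opposite to [c] are in the interior of [B], hence so is [v]. *)
Lemma two_cells A B v (r : R) : closed A -> closed B -> cvx A -> cvx B ->
  A° !=set0 -> B° !=set0 -> A v -> B v -> ~ B° v -> A° `&` B° = set0 -> 0 < r ->
  (forall a b, `|a| < r -> `|b| < r ->
     A (v.1 + a, v.2 + b) \/ B (v.1 + a, v.2 + b)) -> ~ ext A v.
Proof.
move=> clA clB cA cB iA iB Av Bv nBv AB r0 cover [_ ev].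
have BA : B° `&` A° = set0 by rewrite setIC.
have shrink C y : cvx C -> C v -> C° y -> exists2 y', C° y' & `|y'.1 - v.1| < r /\ `|y'.2 - v.2| < r.
  move=> cC Cv Cy; pose k := `|y.1 - v.1| + `|y.2 - v.2| + 1 + r.
  have n1 := normr_ge0 (y.1 - v.1); have n2 := normr_ge0 (y.2 - v.2).
  have k0 : 0 < k by rewrite /k; lra.
  have t0 : 0 < r / k by rewrite divr_gt0.
  have t1 : r / k <= 1 by rewrite ler_pdivrMr// mul1r /k; lra.
  exists (mix (r / k) v y); first by apply: cvx_interior => //; rewrite t0.
  have E (x z : R) : (1 - r / k) * x + r / k * z - x = r / k * (z - x) by ring.
  have N (x : R) : `|x| < k -> `|r / k * x| < r.
    by move=> xk; rewrite normrM (gtr0_norm t0) mulrAC ltr_pdivrMr// ltr_pM2l.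
  by rewrite /mix/= !E; split; apply: N; rewrite /k; lra.
case: iA iB => [a0 Aa0] [b0 Bb0].
have [b Bb [b1 b2]] := shrink B b0 cB Bv Bb0.
have [a1 Aa1 [a11 a12]] := shrink A a0 cA Av Aa0.
have bv : b <> v by move=> E; apply: nBv; rewrite -E.
(* [a] is chosen so that the segment [a b] misses [v] *)
have [a Aa [av1 av2 ov]] : exists2 a, A° a & [/\ `|a.1 - v.1| < r, `|a.2 - v.2| < r & orient v b a != 0].
  have : (A°)° a1 by rewrite (proj1 (interior_id _) (@open_interior _ _)).
  move=> /interior_box[d d0 Ad].
  pose m := Num.min d (Num.min (r - `|a1.1 - v.1|) (r - `|a1.2 - v.2|)) / 2.
  have m0 : 0 < m by rewrite divr_gt0// !lt_min d0 !subr_gt0 a11.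
  have md : m < d.
    have : m * 2 <= d by rewrite /m divfK// ge_min lexx.
    by lra.
  have mr1 : m < r - `|a1.1 - v.1|.
    have : m * 2 <= r - `|a1.1 - v.1| by rewrite /m divfK// !ge_min lexx orbT.
    by lra.
  have mr2 : m < r - `|a1.2 - v.2|.
    have : m * 2 <= r - `|a1.2 - v.2| by rewrite /m divfK// !ge_min lexx !orbT.
    by lra.
  have nm : `|m| = m by rewrite gtr0_norm.
  have Q (x y : R) : (x == 0) || (x == m) -> (y == 0) || (y == m) ->
    orient v b (a1.1 + x, a1.2 + y) != 0 ->
    exists2 a, A° a & [/\ `|a.1 - v.1| < r, `|a.2 - v.2| < r & orient v b a != 0].
    move=> xm ym ob; exists (a1.1 + x, a1.2 + y).
      by apply: Ad; [case/orP: xm => /eqP ->|case/orP: ym => /eqP ->]; rewrite ?normr0 ?nm.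
    have nx : `|x| <= m by case/orP: xm => /eqP ->; rewrite ?normr0 ?nm// ltW.
    have ny : `|y| <= m by case/orP: ym => /eqP ->; rewrite ?normr0 ?nm// ltW.
    split=> //=.
      rewrite addrAC; apply: le_lt_trans (ler_normD _ _) _; lra.
    rewrite addrAC; apply: le_lt_trans (ler_normD _ _) _; lra.
  (* If [a1] and its two shifts by [m] along the axes were all on the line [v b], both coordinates
     of [b - v] would vanish. *)
  have [w0|] := eqVneq (orient v b (a1.1 + 0, a1.2 + 0)) 0; last by apply: Q; rewrite eqxx.
  have [w1|] := eqVneq (orient v b (a1.1 + m, a1.2 + 0)) 0; last by apply: Q; rewrite eqxx ?orbT.
  have [w2|] := eqVneq (orient v b (a1.1 + 0, a1.2 + m)) 0; last by apply: Q; rewrite eqxx ?orbT.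
  case: bv; rewrite [b]surjective_pairing [v]surjective_pairing.
  have mn0 : m != 0 by rewrite gt_eqF.
  move: w0 w1 w2; rewrite /orient/= => w0 w1 w2.
  congr (_, _); apply/eqP; rewrite -subr_eq0; apply/eqP/(mulIf mn0); lra.
have nAb : ~ A b by move=> Ab; exact: (interior_disjoint cA (ex_intro _ a0 Aa0) AB Ab Bb).
have [t t01 [Ac Bc]] : exists2 t, 0 <= t <= 1 & A (mix t a b) /\ B (mix t a b).
  apply: segment_meet => //; first exact: interior_subset.
  move=> t /andP[t0 t1].
  have -> : mix t a b = (v.1 + ((1 - t) * (a.1 - v.1) + t * (b.1 - v.1)),
                         v.2 + ((1 - t) * (a.2 - v.2) + t * (b.2 - v.2))).
    by rewrite /mix; congr (_, _); ring.
  have bnd (x z : R) : `|x| < r -> `|z| < r -> `|(1 - t) * x + t * z| < r.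
    move=> xr zr; apply: le_lt_trans (ler_normD _ _) _.
    have t1' : 0 <= 1 - t by rewrite subr_ge0.
    rewrite !normrM (ger0_norm t0) (ger0_norm t1').
    move: t0; rewrite le_eqVlt => /predU1P[<-|t0]; first by rewrite subr0 mul1r mul0r addr0.
    have : t * `|z| < t * r by rewrite ltr_pM2l.
    have : (1 - t) * `|x| <= (1 - t) * r by rewrite ler_wpM2l// ltW.
    by lra.
  by apply: cover; exact: bnd.
set c := mix t a b in Ac Bc.
pose z : plane := (c.1 - v.1, c.2 - v.2).
have z0 : z <> 0.
  move=> [z1 z2].
  have : (1 - t) * orient v b a = 0.
    have -> : (1 - t) * orient v b a = (b.1 - v.1) * (c.2 - v.2) - (b.2 - v.2) * (c.1 - v.1).
      by rewrite /orient /c /mix/=; ring.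
    by rewrite z1 z2 !mulr0 subrr.
  move/eqP; rewrite mulf_eq0 (negPf ov) orbF subr_eq0 => /eqP t1.
  by apply: nAb; move: Ac; rewrite /c -t1 /mix subrr !mul0r !mul1r !add0r -surjective_pairing.
pose k := `|z.1| + `|z.2| + 1 + r.
have n1 := normr_ge0 z.1; have n2 := normr_ge0 z.2.
have k0 : 0 < k by rewrite /k; lra.
pose s := r / k.
have s0 : 0 < s by rewrite divr_gt0.
have s1 : s < 1 by rewrite ltr_pdivrMr// mul1r /k; lra.
have sz1 : `|s * z.1| < r by rewrite normrM (gtr0_norm s0) /s mulrAC ltr_pdivrMr// ltr_pM2l// /k; lra.
have sz2 : `|s * z.2| < r by rewrite normrM (gtr0_norm s0) /s mulrAC ltr_pdivrMr// ltr_pM2l// /k; lra.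
pose d : plane := (v.1 - s * z.1, v.2 - s * z.2).
have nAd : ~ A d.
  move=> Ad; apply: z0.
  have sz : s *: z = 0.
    apply: ev; last by have -> : v - s *: z = d by [].
    have -> : v + s *: z = mix s v c.
      by rewrite /mix -[LHS]/(_, _) /= /GRing.scale/=; congr (_, _); ring.
    by apply: cA => //; rewrite !ltW.
  move/eqP: sz; rewrite scaler_eq0 gt_eqF//= => /eqP ->//.
have Bd : B° d.
  have : nbhs d (~` A) by apply: open_nbhs_nbhs; split => //; exact: closed_openC.
  move=> /interior_box[e e0 De].
  pose m := Num.min e (Num.min (r - `|s * z.1|) (r - `|s * z.2|)).
  apply: (@box_interior _ _ m); first by rewrite !lt_min e0 !subr_gt0 sz1.
  move=> x y; rewrite !lt_min => /and3P[xe x1 _] /and3P[ye _ y2].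
  have [||//|//] := cover (- (s * z.1) + x) (- (s * z.2) + y).
  - by apply: le_lt_trans (ler_normD _ _) _; rewrite normrN; lra.
  - by apply: le_lt_trans (ler_normD _ _) _; rewrite normrN; lra.
  - by rewrite !addrA => /De; case.
  - by rewrite !addrA.
apply: nBv.
have -> : v = mix (1 / (1 + s)) c d.
  rewrite [LHS]surjective_pairing /mix /d /z/=; congr (_, _); field; rewrite gt_eqF// addr_gt0//.
apply: cvx_interior => //; rewrite divr_gt0 ?addr_gt0//= ler_pdivrMr ?addr_gt0//.
by rewrite mul1r lerDl ltW.
Qed.
End VertexLemmas.

(** * Areas and packing *)

Section Packing.
Context {R : realType}.
Local Notation mR := (measurableTypeR R).
Local Notation plane := (R * R)%type.
Implicit Types (p u v y : plane) (A B C D : set plane).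

Lemma area_ge0 A : (0 <= area A)%E.
Proof. by rewrite /area; exact: (measure_ge0 (lebesgue_measure \x lebesgue_measure)%E). Qed.

Lemma interior_measurable A : measurable (A° : set (mR * mR)).
Proof. by apply: open_measurable2; exact: open_interior. Qed.

(** Shrinking [C] by a ratio [k < 1] towards an interior point puts it inside its interior, whose
    area is therefore at least [k ^ 2]. *)
Lemma area_interior C : compact C -> cvx C -> C° !=set0 -> area C = 1%E -> area C° = 1%E.
Proof.
move=> kC cC [y Cy] aC; apply/eqP; rewrite eq_le; apply/andP; split.
  rewrite -aC; apply: area_le; [exact: interior_measurable| |exact: interior_subset].
  by apply: closed_measurable2; exact: compact_closed2.
have H (k : R) : 0 < k < 1 -> ((k ^+ 2)%:E <= area C°)%E.
  move=> /andP[k0 k1].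
  rewrite -(@area_rescale R ((1 - k) * y.1) ((1 - k) * y.2) k)//; last exact: interior_measurable.
  rewrite -[leLHS]mule1 -aC lee_pmul2l// ?lte_fin ?exprn_gt0//.
  apply: area_le.
  - by apply: closed_measurable2; exact: compact_closed2.
  - have := @rescale_measurable R ((1 - k) * y.1) ((1 - k) * y.2) k measurableT _ (interior_measurable C).
    by rewrite setTI.
  - move=> p Cp /=.
    have -> : rescale ((1 - k) * y.1) ((1 - k) * y.2) k p = mix (1 - k) p y.
      by rewrite /rescale /mix; congr (_, _); ring.
    by apply: cvx_interior => //; rewrite subr_gt0 k1/= gerBl ltW.
have fC : area C° \is a fin_num.
  rewrite ge0_fin_numE ?area_ge0//; apply: le_lt_trans (_ : 1 < +oo)%E; last exact: ltry.
  rewrite -aC; apply: area_le; [exact: interior_measurable| |exact: interior_subset].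
  by apply: closed_measurable2; exact: compact_closed2.
rewrite -(fineK fC) lee_fin; set s := fine _.
have {}H k : 0 < k < 1 -> k ^+ 2 <= s by move=> /H; rewrite -(fineK fC) lee_fin.
rewrite leNgt; apply/negP => s1.
have s0 : 0 <= s by rewrite fine_ge0// area_ge0.
(* Chosen so that [k ^+ 2 - s = (1 - s) ^+ 2 / 4 > 0]. *)
pose k := (1 + s) / 2.
have k01 : 0 < k < 1 by apply/andP; split; rewrite /k; lra.
have := H k k01.
have : (1 - s) ^+ 2 > 0 by rewrite exprn_gt0// subr_gt0.
have -> : k ^+ 2 = s + (1 - s) ^+ 2 / 4 by rewrite /k; field.
lra.
Qed.

Definition cell C := [/\ compact C, cvx C, C° !=set0 & area C = 1%E].

(** The interiors are pairwise disjoint and still have area 1, so their areas add up inside [S]. *)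
Lemma packing (s : seq (set plane)) (S : set plane) :
  uniq s -> (forall C, C \in s -> cell C /\ C `<=` S) ->
  (forall C D, C \in s -> D \in s -> C <> D -> C° `&` D° = set0) ->
  measurable (S : set (mR * mR)) -> ((size s)%:R%:E <= area S)%E.
Proof.
move=> us cs disj mS.
pose U := \big[setU/set0]_(C <- s) C°.
have UP p : U p -> exists2 C, C \in s & C° p.
  rewrite /U; elim: (s) => [|C t IH]; first by rewrite big_nil.
  rewrite big_cons => -[Cp|/IH[D Dt Dp]]; first by exists C => //; rewrite mem_head.
  by exists D => //; rewrite inE Dt orbT.
have mU : measurable (U : set (mR * mR)).
  by rewrite /U; elim/big_ind: _ => // [*|C _]; [exact: measurableU|exact: interior_measurable].
apply: (@le_trans _ _ (area U)); last first.
  apply: area_le => // p /UP[C Cs Cp]; have [_ CS] := cs C Cs.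
  by apply: CS; exact: interior_subset.
suff -> : area U = (size s)%:R%:E by [].
rewrite /U {mU UP U}; elim: s us cs disj => [|C s IH]/= us cs disj.
  by rewrite big_nil /area measure0.
rewrite big_cons; have /andP[Cs us'] := us.
set V := \big[setU/set0]_(_ <- _) _ in IH *.
have mV : measurable (V : set (mR * mR)).
  by rewrite /V; elim/big_ind: _ => // [*|D _]; [exact: measurableU|exact: interior_measurable].
rewrite /area (@measureU _ _ _ (lebesgue_measure \x lebesgue_measure)%E)//; last 2 first.
- exact: interior_measurable.
- apply/seteqP; split=> // p [Cp].
  have : forall t, {subset t <= s} -> (\big[setU/set0]_(D <- t) D°) p -> False.
    elim=> [|D t IHt] ts; first by rewrite big_nil.
    rewrite big_cons => -[Dp|]; last by apply: IHt => E Et; apply: ts; rewrite inE Et orbT.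
    have Ds : D \in s by apply: ts; rewrite mem_head.
    have CD : C <> D by move=> E; move: Cs; rewrite E Ds.
    have := disj C D; rewrite mem_head inE Ds orbT => /(_ isT isT CD) E.
    by have : (C° `&` D°) p by []; rewrite E.
  by move=> H /H; apply.
have [[kC cC iC aC] _] := cs C (mem_head _ _).
have -> : (size s).+1%:R%:E = (area C° + area V)%E; last by [].
rewrite area_interior// IH//; first by rewrite -EFinD -natr1 addrC.
- by move=> D Ds; apply: cs; rewrite inE Ds orbT.
- by move=> D E Ds Es; apply: disj; rewrite inE ?Ds ?Es orbT.
Qed.

Lemma edist_triangle p u v : edist p v <= edist p u + edist u v.
Proof.
have n1 := edist_nneg p u; have n2 := edist_nneg u v.
rewrite -(@ler_pXn2r _ 2) ?nnegrE ?edist_nneg ?addr_ge0// sqrrD !edist_sqr.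
have CS : (p.1 - u.1) * (u.1 - v.1) + (p.2 - u.2) * (u.2 - v.2) <= edist p u * edist u v.
  apply: le_trans (ler_norm _) _.
  rewrite -(@ler_pXn2r _ 2) ?nnegrE ?mulr_ge0// real_normK ?num_real// exprMn !edist_sqr /sqdist -subr_ge0.
  have -> : ((p.1 - u.1) ^+ 2 + (p.2 - u.2) ^+ 2) * ((u.1 - v.1) ^+ 2 + (u.2 - v.2) ^+ 2) -
    ((p.1 - u.1) * (u.1 - v.1) + (p.2 - u.2) * (u.2 - v.2)) ^+ 2 =
    ((p.1 - u.1) * (u.2 - v.2) - (p.2 - u.2) * (u.1 - v.1)) ^+ 2 by ring.
  exact: sqr_ge0.
have -> : sqdist p v = sqdist p u + sqdist u v +
  2 * ((p.1 - u.1) * (u.1 - v.1) + (p.2 - u.2) * (u.2 - v.2)) by rewrite /sqdist; ring.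
by move: CS; rewrite -mulr_natl; lra.
Qed.

Lemma disk_closed c r : closed (@disk R c r).
Proof.
have cf : continuous (fun q : plane => edist c q).
  move=> z; apply: (@cvg_comp _ _ _ (fun z : plane => sqdist c z) (@Num.sqrt R)); last exact: sqrt_continuous.
  rewrite /sqdist; apply: cvgD.
    by apply: (@cvg_comp _ _ _ (fun z : plane => c.1 - z.1) (fun x => x ^+ 2));
      [apply: cvgB; [exact: cvg_cst|exact: cvg_fst]|exact: exprn_continuous].
  by apply: (@cvg_comp _ _ _ (fun z : plane => c.2 - z.2) (fun x => x ^+ 2));
      [apply: cvgB; [exact: cvg_cst|exact: cvg_snd]|exact: exprn_continuous].
by apply: (@preimage_closed _ _ (fun q => edist c q) [set t | t <= r]) => [z _|]; [exact: cf|exact: closed_le].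
Qed.

Lemma disk_measurable c r : measurable (disk c r : set (mR * mR)).
Proof. by apply: closed_measurable2; exact: disk_closed. Qed.

Definition unit_disk : set plane := disk 0 1.

Lemma area_disk_scale (r : R) : 0 < r -> area (disk 0 r) = ((r ^+ 2)%:E * area unit_disk)%E.
Proof.
move=> r0.
have := @area_rescale R 0 0 r^-1 unit_disk; rewrite invr_gt0 => /(_ r0 (disk_measurable _ _)) <-.
have -> : rescale 0 0 r^-1 @^-1` unit_disk = disk 0 r.
  have E p : edist 0 (rescale 0 0 r^-1 p) = r^-1 * edist 0 p.
    apply: edist_eq; first by rewrite mulr_ge0 ?edist_nneg// invr_ge0 ltW.
    by rewrite exprMn edist_sqr /sqdist /rescale/=; ring.
  by apply/seteqP; split=> p; rewrite /unit_disk /disk /= E mulrC ler_pdivrMr// mul1r.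
rewrite muleA -EFinM -exprMn mulfV ?expr1n ?mul1e// gt_eqF//.
Qed.

(** The disk is sandwiched between squares of areas 1 and 4; its exact area cancels from the
    quotients of cell counts. *)
Lemma area_disk1 : exists2 a : R, 0 < a & area unit_disk = a%:E.
Proof.
have sub : unit_disk `<=` @trapezoid R (-1) 1 (-1) 0 1 0.
  move=> p; rewrite /unit_disk /disk/= => pd; have [h1 h2] := edist_coord_le 0 p.
  move: h1 h2; rewrite /= !subr0 => h1 h2.
  have := le_trans h1 pd; have := le_trans h2 pd; rewrite !ler_norml.
  by move=> /andP[? ?] /andP[? ?]; split; apply/andP; split; lra.
have sup : @trapezoid R (- 2^-1) 2^-1 (- 2^-1) 0 2^-1 0 `<=` unit_disk.
  move=> p [/andP[p1 p2] /andP[p3 p4]]; rewrite /unit_disk /disk/=.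
  apply: le_trans (edist_le_norm1 _ _) _; rewrite /= !subr0.
  have : `|p.1| <= 2^-1 by rewrite ler_norml; apply/andP; split; lra.
  have : `|p.2| <= 2^-1 by rewrite ler_norml; apply/andP; split; lra.
  by lra.
have U : (area unit_disk <= 4%:E)%E.
  apply: le_trans (area_le (disk_measurable _ _) (trapezoid_measurable _ _ _ _ _ _) sub) _.
  by rewrite area_trapezoid ?lee_fin; lra.
have L : (1%:E <= area unit_disk)%E.
  apply: le_trans (area_le (trapezoid_measurable _ _ _ _ _ _) (disk_measurable _ _) sup).
  by rewrite area_trapezoid ?lee_fin; lra.
have fA : area unit_disk \is a fin_num.
  by rewrite ge0_fin_numE ?area_ge0//; apply: le_lt_trans U _; exact: ltry.
exists (fine (area unit_disk)); last by rewrite fineK.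
by rewrite (lt_le_trans ltr01)// -lee_fin fineK.
Qed.
End Packing.

(** * Finiteness and double counting in a tiling *)

Section Tilings.
Context {R : realType}.
Local Notation plane := (R * R)%type.
Implicit Types (p u v y : plane) (A B C D : set plane).

Variables (T : set (set plane)) (R0 : R).
Hypothesis T_cell : forall C, T C -> cell C.
Hypothesis T_disj : forall C D, T C -> T D -> C <> D -> C° `&` D° = set0.
Hypothesis T_cover : forall p, exists2 C, T C & C p.
Hypothesis R00 : 0 < R0.
Hypothesis T_small : forall C p u, T C -> C p -> C u -> edist p u <= R0.

Lemma cell_in_disk C p r : T C -> C p -> edist 0 p <= r -> C `<=` disk 0 (r + R0).
Proof.
move=> TC Cp pr u Cu; rewrite /disk/=.
by apply: le_trans (edist_triangle 0 p u) _; rewrite lerD//; exact: T_small TC Cp Cu.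
Qed.

Lemma packing_disk (s : seq (set plane)) r a : 0 < r -> area unit_disk = a%:E -> uniq s ->
  (forall C, C \in s -> cells_in T r C) -> (size s)%:R <= r ^+ 2 * a.
Proof.
move=> r0 ad us cs; rewrite -lee_fin EFinM -ad -area_disk_scale//.
apply: packing => //.
- by move=> C /cs[TC Cr]; split => //; exact: T_cell.
- by move=> C D /cs[TC _] /cs[TD _]; exact: T_disj.
- exact: disk_measurable.
Qed.

Lemma finite_cells_in r : finite_set (cells_in T r).
Proof.
apply: contrapT => iF.
have [a a0 ad] := @area_disk1 R.
pose r' := `|r| + 1; have r'0 : 0 < r' by rewrite ltr_wpDl.
have [n nb] : exists n : nat, r' ^+ 2 * a < n%:R.
  exists (Num.truncn (r' ^+ 2 * a)).+1; exact: truncnS_gt.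
have [B sub nB] := infinite_set_fset n iF.
have : (size B)%:R <= r' ^+ 2 * a.
  apply: packing_disk => //; first exact: fset_uniq.
  move=> C /sub [TC Cr]; split=> // p /Cr; rewrite /disk/= => /le_trans; apply.
  by rewrite (le_trans (ler_norm r))// lerDl.
by rewrite leNgt (lt_le_trans nb)// ler_nat.
Qed.

Definition count_cells r := #|` fset_set (cells_in T r)|.

Lemma mem_cells_in r C : (C \in fset_set (cells_in T r)) = `[< cells_in T r C >].
Proof.
rewrite in_fset_set; last exact: finite_cells_in.
by apply/idP/asboolP => [/set_mem|/mem_set].
Qed.

Lemma count_cells_le r a : 0 < r -> area unit_disk = a%:E -> (count_cells r)%:R <= r ^+ 2 * a.
Proof.
move=> r0 ad; apply: packing_disk => //; first exact: fset_uniq.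
move=> C.
by rewrite mem_cells_in => /asboolP.
Qed.

(** Every point of the disk of radius [r - R0] is in some cell, and that cell does not leave the
    disk of radius [r]. *)
Lemma count_cells_ge r a : R0 < r -> area unit_disk = a%:E -> (r - R0) ^+ 2 * a <= (count_cells r)%:R.
Proof.
move=> r0 ad; rewrite -lee_fin EFinM -ad -area_disk_scale ?subr_gt0//.
pose s : seq (set plane) := fset_set (cells_in T r).
have -> : (count_cells r)%:R = \sum_(k < size s) 1 :> R by rewrite sumr_const card_ord.
apply: (@area_sum_le R (fun k => nth set0 s k) (fun=> 1)).
- move=> k ks; have : nth set0 s k \in fset_set (cells_in T r) by exact: mem_nth.
  rewrite mem_cells_in => /asboolP[/T_cell[kC cC iC aC] _]; split; last by rewrite aC.
  by apply: closed_measurable2; exact: compact_closed2.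
- exact: disk_measurable.
- move=> p pd; have [C TC Cp] := T_cover p.
  have Cs : C \in s.
    rewrite mem_cells_in; apply/asboolP; split=> //.
    by have := cell_in_disk TC Cp pd; rewrite subrK.
  by exists (index C s); [rewrite index_mem|rewrite nth_index].
Qed.

(** Only finitely many cells come near [v], so the union of those that avoid [v] is closed and keeps
    a distance from it. *)
Lemma local_cover v : exists2 r : R, 0 < r & forall a b, `|a| < r -> `|b| < r ->
  exists C, [/\ T C, C v & C (v.1 + a, v.2 + b)].
Proof.
(* Points whose coordinates differ by less than 1 from those of [v] are within 2 of it, and a cell
   through such a point stays within [R0] of that point. *)
pose F := cells_in T (edist 0 v + 2 + R0).
have FF : finite_set F by exact: finite_cells_in.
pose Z := \bigcup_(C in F `&` [set C | ~ C v]) C.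
have cZ : closed Z.
  apply: closed_bigcup; first exact: finite_setIl.
  by move=> C [[/T_cell[kC _ _ _] _] _]; exact: compact_closed2.
have : nbhs v (~` Z).
  apply: open_nbhs_nbhs; split; first exact: closed_openC.
  by move=> [C [_ /= nCv] Cv].
move=> /interior_box[e e0 Be].
exists (Num.min e 1); first by rewrite lt_min e0/=.
move=> a b; rewrite !lt_min => /andP[ae a1] /andP[be b1].
pose p : plane := (v.1 + a, v.2 + b).
have [C TC Cp] := T_cover p.
exists C; split=> //; apply: contrapT => nCv.
apply: (Be a b ae be); exists C => //; split=> //; split=> //.
apply: cell_in_disk Cp _ => //.
apply: le_trans (edist_triangle 0 v p) _; rewrite lerD2l.
apply: le_trans (edist_le_norm1 _ _) _; rewrite /p/=.
have -> : v.1 + a - v.1 = a by ring.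
have -> : v.2 + b - v.2 = b by ring.
by lra.
Qed.

Lemma ext_not_interior C D v : T C -> T D -> ext C v -> D v -> ~ D° v.
Proof.
move=> TC TD ev Dv Div; have [kC cC iC _] := T_cell TC.
have [Cv _] := ev.
have [CD|CD] := pselect (C = D).
  have := ext_boundary (compact_closed2 kC) ev; rewrite CD => -[_]; exact.
exact: (interior_disjoint cC iC (T_disj TC TD CD) Cv Div).
Qed.

(** Otherwise [three_cells] leaves at most two cells containing [v], which cover a neighbourhood of
    it by [local_cover]: either [v] is interior to [A], or [two_cells] applies. *)
Lemma ext_lexext A v : T A -> ext A v -> exists2 D, T D & lexmin D v \/ lexmax D v.
Proof.
move=> TA ev; apply: contrapT => H.
have [Av _] := ev.
have good D : T D -> D v -> [/\ cvx D, D° !=set0, D v, ~ D° v & ~ lexmin D v /\ ~ lexmax D v].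
  move=> TD Dv; have [_ cD iD _] := T_cell TD; split=> //.
    exact: ext_not_interior TA TD ev Dv.
  by split=> h; apply: H; exists D => //; [left|right].
have [B [TB Bv HB]] : exists B, [/\ T B, B v & forall D, T D -> D v -> D = A \/ D = B].
  have [[B [TB Bv BA]]|nB] := pselect (exists B, [/\ T B, B v & B <> A]).
    exists B; split=> // D TD Dv; apply: contrapT => /not_orP[DA DB].
    apply: (three_cells (good _ TA Av) (good _ TB Bv) (good _ TD Dv)); apply: T_disj => //;
      by [apply: nesym|apply: nesym; apply: nesym].
  exists A; split=> // D TD Dv; left; apply: contrapT => DA; apply: nB; by exists D.
have [r r0 cov] := local_cover v.
have cov' a b : `|a| < r -> `|b| < r -> A (v.1 + a, v.2 + b) \/ B (v.1 + a, v.2 + b).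
  by move=> ar br; have [D [TD Dv Dp]] := cov a b ar br; have [<-|<-] := HB D TD Dv; [left|right].
have [kA cA iA _] := T_cell TA; have [kB cB iB _] := T_cell TB.
have [AB|AB] := pselect (A = B).
  have [_ _ _ nA _] := good A TA Av; apply: nA; apply: (box_interior r0) => a b ar br.
  by have := cov' a b ar br; rewrite -AB => -[].
have [_ _ _ nB _] := good B TB Bv.
exact: (two_cells (compact_closed2 kA) (compact_closed2 kB) cA cB iA iB Av Bv nB (T_disj TA TB AB) r0 cov' ev).
Qed.

(** This is why cells are polygons: each extreme point of [A] is a lexicographic extremity of one of
    the finitely many cells near [A], and a cell has at most two extremities. *)
Lemma finite_ext A : T A -> finite_set [set v | ext A v].
Proof.
move=> TA; have [kA cA [y /interior_subset Ay] _] := T_cell TA.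
pose F := cells_in T (edist 0 y + R0 + R0).
have FF : finite_set F by exact: finite_cells_in.
apply: (@sub_finite_set _ _ ((fun D => get (lexmin D)) @` F `|` (fun D => get (lexmax D)) @` F)).
  move=> v ev; have [D TD Dv] := ext_lexext TA ev.
  have FD : F D.
    have [Av _] := ev; have Dv' : D v by case: Dv => -[].
    split=> //; apply: (cell_in_disk TD Dv').
    exact: (cell_in_disk TA Ay (lexx _) Av).
  case: Dv => Dv; [left|right]; exists D => //.
    by apply: (lexmin_uniq (C := D)) => //; apply: getI Dv.
  by apply: (lexmax_uniq (C := D)) => //; apply: getI Dv.
by rewrite finite_setU; split; exact: finite_image.
Qed.

Definition nb_ext C := #|` fset_set [set v | ext C v]|.

(** A cell having a given corner as an extremity may leave the disk of radius [r], but by at most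
    [R0]; hence the larger radius on the right. The 6 is three cells per incidence times two
    extremities per cell. *)
Lemma sum_nb_ext r :
  (\sum_(C <- fset_set (cells_in T r)) nb_ext C <= 6 * count_cells (r + R0))%N.
Proof.
set s : seq (set plane) := fset_set (cells_in T r).
set s' : seq (set plane) := fset_set (cells_in T (r + R0)).
have us : uniq s by exact: fset_uniq.
have us' : uniq s' by exact: fset_uniq.
have sP C : C \in s -> T C /\ C `<=` disk 0 r by rewrite mem_cells_in => /asboolP.
have s'P C : T C -> C `<=` disk 0 (r + R0) -> C \in s'.
  by move=> TC Cr; rewrite mem_cells_in; apply/asboolP.
pose V := undup (flatten [seq enum_fset (fset_set [set v | ext C v]) | C <- s]).
pose ex C v := `[< ext C v >].
pose lmin D v := `[< lexmin D v >]; pose lmax D v := `[< lexmax D v >].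
have uV : uniq V by exact: undup_uniq.
have exE C v : C \in s -> (v \in fset_set [set v | ext C v]) = ex C v.
  move=> /sP[TC _]; rewrite in_fset_set; last exact: finite_ext.
  by apply/idP/asboolP => [/set_mem|/mem_set].
have VP C v : C \in s -> ex C v -> v \in V.
  move=> Cs ev; rewrite mem_undup; apply/flatten_mapP; exists C => //.
  by have := exE C v Cs; rewrite ev.
(* With [k >= 1] incidences at most [k + 2 <= 3 k] cells have the corner [v], and [k = 0] occurs
   only if no cell of [s] has it. *)
have vertex v : (\sum_(C <- s) ex C v <= 3 * \sum_(D <- s') (lmin D v + lmax D v))%N.
  have cE (P : pred (set plane)) t : (\sum_(C <- t) P C = count P t)%N.
    by rewrite -sum1_count [RHS]big_mkcond; apply: eq_bigr => C _; case: (P C).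
  rewrite cE.
  have -> : count (ex^~ v) s = (count (fun C => ex C v && (lmin C v || lmax C v)) s +
                   count (fun C => ex C v && ~~ (lmin C v || lmax C v)) s)%N.
    elim: (s) => //= C t ->; case: (ex C v) => /=; last by [].
    by case: (lmin C v || lmax C v) => /=; lia.
  have c1 : (count (fun C => ex C v && (lmin C v || lmax C v)) s <= \sum_(D <- s') (lmin D v + lmax D v))%N.
    apply: (@leq_trans (count (fun C => lmin C v || lmax C v) s')).
      rewrite -!size_filter; apply: uniq_leq_size; first exact: filter_uniq.
      move=> C; rewrite !mem_filter => /andP[/andP[_ ->] /sP[TC Cr]] /=.
      apply: s'P => // p /Cr; rewrite /disk/= => /le_trans; apply.
      by rewrite lerDl ltW.
    by rewrite -cE; apply: leq_sum => D _; case: (lmin D v); case: (lmax D v).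
  have c2 : (count (fun C => ex C v && ~~ (lmin C v || lmax C v)) s <= 2)%N.
    rewrite -size_filter leqNgt; apply/negP.
    set t := seq.filter _ s; have ut : uniq t by exact: filter_uniq.
    have tP C : C \in t -> T C /\ [/\ cvx C, C° !=set0, C v, ~ C° v & ~ lexmin C v /\ ~ lexmax C v].
      rewrite mem_filter => /andP[/andP[/asboolP ev]].
      rewrite negb_or => /andP[/asboolP n1 /asboolP n2] /sP[TC _]; split=> //.
      have [_ cC iC _] := T_cell TC; have [Cv _] := ev; split=> //.
      exact: (ext_not_interior TC TC ev Cv).
    case: t ut tP => [|A [|B [|C t]]] //.
    rewrite !cons_uniq => /and4P[nA nB _ _] tP _.
    have AB : A <> B by move=> E; move: nA; rewrite E mem_head.
    have AC : A <> C by move=> E; move: nA; rewrite E in_cons mem_head orbT.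
    have BC : B <> C by move=> E; move: nB; rewrite E mem_head.
    have [TA gA] := tP A (mem_head _ _).
    have Bt : B \in [:: A, B, C & t] by rewrite !in_cons eqxx orbT.
    have Ct : C \in [:: A, B, C & t] by rewrite !in_cons eqxx !orbT.
    have [TB gB] := tP B Bt; have [TC gC] := tP C Ct.
    exact: (three_cells gA gB gC (T_disj TA TB AB) (T_disj TA TC AC) (T_disj TB TC BC)).
  have [/hasP[C Cs Cv]|none] := boolP (has (ex^~ v) s).
    have [TC Cr] := sP C Cs.
    have [D TD Dv] := ext_lexext TC (asboolW Cv).
    have Ds : D \in s'.
      have Dv' : D v by case: Dv => -[].
      by apply: s'P => //; apply: (cell_in_disk TD Dv'); apply: Cr; case: (asboolW Cv).
    have : (1 <= \sum_(D <- s') (lmin D v + lmax D v))%N.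
      rewrite (big_rem D)//=; apply: (@leq_trans (lmin D v + lmax D v)); last exact: leq_addr.
      by case: Dv => /asboolP; rewrite /lmin /lmax => ->; rewrite ?addn1.
    lia.
  have z P : (count (fun C => ex C v && P C) s = 0)%N.
    apply/eqP; rewrite -leqn0 leqNgt -has_count; apply: contra none => /hasP[C Cs /andP[Cv _]].
    by apply/hasP; exists C.
  by rewrite !z.
have once (P : plane -> bool) : (forall u v, P u -> P v -> u = v) -> (\sum_(v <- V) P v <= 1)%N.
  move=> Pu; have -> : (\sum_(v <- V) P v = count P V)%N.
    by rewrite -sum1_count [RHS]big_mkcond; apply: eq_bigr => C _; case: (P C).
  rewrite -size_filter; case E : (seq.filter P V) => [|u [|w t]]//.
  have : uniq (seq.filter P V) by exact: filter_uniq.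
  have mem x : x \in seq.filter P V -> P x by rewrite mem_filter => /andP[].
  rewrite E cons_uniq => /andP[+ _].
  have <- : u = w; last by rewrite mem_head.
  by apply: Pu; apply: mem; rewrite E !in_cons eqxx ?orbT.
apply: (@leq_trans (\sum_(C <- s) \sum_(v <- V) ex C v)).
  rewrite big_seq [leqRHS]big_seq; apply: leq_sum => C Cs.
  have -> : (\sum_(v <- V) ex C v = count (ex C) V)%N.
    by rewrite -sum1_count [RHS]big_mkcond; apply: eq_bigr => v _; case: (ex C v).
  rewrite -size_filter; apply: uniq_leq_size; first exact: fset_uniq.
  by move=> v; rewrite mem_filter (exE C v Cs) => ev; rewrite ev (VP C v).
rewrite exchange_big/=.
apply: (@leq_trans (\sum_(v <- V) 3 * \sum_(D <- s') (lmin D v + lmax D v))).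
  by apply: leq_sum => v _; exact: vertex.
rewrite -big_distrr/= exchange_big/=.
apply: (@leq_trans (3 * \sum_(D <- s') 2)).
  rewrite leq_mul2l/=; apply: leq_sum => D _; rewrite big_split/=.
  rewrite -[2%N]/(1 + 1)%N leq_add//; apply: once => u w /asboolP h1 /asboolP h2.
    exact: lexmin_uniq h1 h2.
  exact: lexmax_uniq h1 h2.
by rewrite big_const_seq count_predT iter_addn_0 mulnCA mulnA mulnC /count_cells; lia.
Qed.
End Tilings.

(** * Passage to the limit *)

Section Limits.
Context {R : realType}.
Local Notation plane := (R * R)%type.
Implicit Types (p u v y : plane) (A B C D : set plane).

Lemma limf_einf_ge (f : R -> \bar R) (c : R) :
  (forall e, 0 < e -> exists M, forall r, M < r -> ((c - e)%:E <= f r)%E) ->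
  (c%:E <= limf_einf f (pinfty_nbhs R))%E.
Proof.
move=> H; rewrite limf_einfE; apply/lee_addgt0Pr => e e0.
have [M HM] := H e e0.
rewrite -leeBlDr// -EFinB.
apply: (@le_trans _ _ (ereal_inf (f @` [set r | M < r]))).
  by apply: le_ereal_inf_tmp => _ [r Mr <-]; exact: HM.
apply: ereal_sup_ubound; exists [set r | M < r] => //.
by exists M; split => //; exact: num_real.
Qed.

Lemma limf_einf_const (f : R -> \bar R) (c : R) M : (forall r, M < r -> f r = c%:E) ->
  limf_einf f (pinfty_nbhs R) = c%:E.
Proof.
move=> H; apply/eqP; rewrite eq_le; apply/andP; split; last first.
  by apply: limf_einf_ge => e e0; exists M => r Mr; rewrite H// lee_fin gerBl ltW.
rewrite limf_einfE; apply: ge_ereal_sup => _ [V [N [_ HN]] <-].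
pose r := Num.max M N + 1.
have rM : M < r by rewrite /r (le_lt_trans (_ : _ <= Num.max M N)) ?ltrDl// le_max lexx.
have rN : N < r by rewrite /r (le_lt_trans (_ : _ <= Num.max M N)) ?ltrDl// le_max lexx orbT.
by apply: ereal_inf_lbound; exists r; [exact: HN|exact: H].
Qed.

Lemma limf_esup_const (f : R -> \bar R) (c : R) M : (forall r, M < r -> f r = c%:E) ->
  limf_esup f (pinfty_nbhs R) = c%:E.
Proof.
move=> H; have := @limf_einf_const (\- f)%E (- c) M.
rewrite limf_einfN => E; rewrite -[LHS]oppeK E ?EFinN ?oppeK// => r Mr.
by rewrite H.
Qed.

Lemma perim_ge0 C : compact C -> 0 <= perim C.
Proof.
move=> kC; apply: sup_upper_bound; first exact: perim_has_sup.
exists 0%N, (fun=> 0); split; [by case|by move=> i; case: i|by rewrite /closed_length big_ord0].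
Qed.

Section Counting.
Variables (T : set (set plane)) (R0 : R).
Hypothesis T_cell : forall C, T C -> cell C.
Hypothesis T_disj : forall C D, T C -> T D -> C <> D -> C° `&` D° = set0.
Hypothesis T_cover : forall p, exists2 C, T C & C p.
Hypothesis R00 : 0 < R0.
Hypothesis T_small : forall C p u, T C -> C p -> C u -> edist p u <= R0.

Let N r := count_cells T r.

Lemma mean_log_perimE r : mean_log_perim T r =
  (\sum_(C <- fset_set (cells_in T r)) ln (perim C)) / (N r)%:R.
Proof. by rewrite /mean_log_perim fsbig_finite//; exact: finite_cells_in T_cell T_disj r. Qed.

Lemma count_cells_gt0 r : R0 < r -> (0 < N r)%N.
Proof.
move=> r0; have [a a0 ad] := @area_disk1 R.
rewrite -(@ltr_nat R); apply: lt_le_trans (count_cells_ge T_cell T_disj T_cover T_small r0 ad).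
by rewrite mulr_gt0// exprn_gt0// subr_gt0.
Qed.

Lemma has_Plog_const (l : R) : (forall C, T C -> perim C = l) -> has_Plog T (ln l).
Proof.
move=> Pl.
have H r : R0 < r -> (mean_log_perim T r)%:E = (ln l)%:E.
  move=> rR; rewrite mean_log_perimE; congr EFin.
  rewrite (eq_big_seq (fun=> ln l)); last first.
    move=> C; rewrite (mem_cells_in T_cell T_disj) => /asboolP[TC _].
    by rewrite Pl.
  rewrite big_const_seq count_predT iter_addr_0 -[_ *+ _]mulr_natr mulfK//.
  by rewrite pnatr_eq0 -lt0n; exact: count_cells_gt0.
by split; [exact: limf_einf_const H|exact: limf_esup_const H].
Qed.

(** The logarithm of the perimeter of the regular hexagon of unit area, whose square is
    [8 sqrt 3]. *)
Let c := ln (8 * Num.sqrt 3 : R) / 2.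

Lemma log_perim_cell C : T C ->
  c - ln (@corner_ratio R) / 2 * ((nb_ext C)%:R - 6) <= ln (perim C).
Proof.
move=> TC; have [kC cC iC aC] := T_cell TC.
have fE := finite_ext T_cell T_disj T_cover T_small TC.
have := cell_perim_ge kC cC iC fE aC; rewrite -/(nb_ext C).
have q0 : 0 < (corner_ratio : R) := lt_trans ltr01 corner_ratio_gt1.
have s0 : 0 < 8 * (Num.sqrt 3 : R) by rewrite mulr_gt0// sqrtr_gt0.
move=> H; have P0 : 0 < perim C.
  rewrite lt_neqAle perim_ge0// andbT; apply/eqP => E; move: H.
  by rewrite -E expr0n/= mul0r leNgt mulr_gt0// exprn_gt0.
have : ln (8 * Num.sqrt 3 * corner_ratio ^+ 6) <= ln (perim C ^+ 2 * corner_ratio ^+ nb_ext C).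
  by rewrite ler_ln ?posrE ?mulr_gt0 ?exprn_gt0.
have -> : ln (8 * Num.sqrt 3 * corner_ratio ^+ 6) = ln (8 * Num.sqrt 3) + ln corner_ratio *+ 6 :> R.
  by rewrite lnM ?posrE ?exprn_gt0// lnXn.
have -> : ln (perim C ^+ 2 * corner_ratio ^+ nb_ext C) = ln (perim C) *+ 2 + ln corner_ratio *+ nb_ext C.
  by rewrite lnM ?posrE ?exprn_gt0// !lnXn.
rewrite -[ln corner_ratio *+ nb_ext C]mulr_natl.
by rewrite /c; set x := ln (8 * _); set n : R := _%:R; lra.
Qed.

(** The corners exceed 6 per cell by at most [6 (n' - n)] in total. The area bounds give
    [n' - n <= 4 R0 r a] and, as [r > 2 R0], also [r ^ 2 a <= 4 n]; so the excess is at most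
    [6 * 16 R0 n / r], and half of 96 is the constant 48. *)
Lemma mean_log_perim_ge r : 2 * R0 < r ->
  c - 48 * R0 * ln (@corner_ratio R) / r <= mean_log_perim T r.
Proof.
move=> r2; have [a a0 ad] := @area_disk1 R.
have r0 : 0 < r by rewrite (lt_trans _ r2)// mulr_gt0.
have rR : R0 < r by lra.
have N0 : 0 < (N r)%:R :> R by rewrite ltr0n count_cells_gt0.
have lq : 0 < ln (@corner_ratio R) by rewrite ln_gt0// corner_ratio_gt1.
have lo := count_cells_ge T_cell T_disj T_cover T_small rR ad.
have hi : (N (r + R0))%:R <= (r + R0) ^+ 2 * a.
  by apply: count_cells_le => //; rewrite addr_gt0.
rewrite -/(N r) in lo.
have sum_n : \sum_(C <- fset_set (cells_in T r)) (nb_ext C)%:R <= 6 * (N (r + R0))%:R :> R.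
  rewrite -natr_sum -natrM ler_nat.
  exact: sum_nb_ext T_cell T_disj T_cover R00 T_small r.
rewrite mean_log_perimE ler_pdivlMr//.
apply: (@le_trans _ _ (\sum_(C <- fset_set (cells_in T r)) (c - ln corner_ratio / 2 * ((nb_ext C)%:R - 6)))); last first.
  rewrite big_seq [leRHS]big_seq; apply: ler_sum => C.
  by rewrite (mem_cells_in T_cell T_disj) => /asboolP[TC _]; exact: log_perim_cell.
have -> : \sum_(C <- fset_set (cells_in T r)) (c - ln corner_ratio / 2 * ((nb_ext C)%:R - 6)) =
    \sum_(C <- fset_set (cells_in T r)) c - ln corner_ratio / 2 *
      (\sum_(C <- fset_set (cells_in T r)) (nb_ext C)%:R -
       \sum_(C <- fset_set (cells_in T r)) 6).
  by rewrite -sumrB mulr_sumr -sumrB.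
rewrite !big_const_seq !count_predT !iter_addr_0 -/(N r).
rewrite -[c *+ _]mulr_natr -[6 *+ _]mulr_natr.
set S := \sum_(_ <- _) _ in sum_n *; set n : R := (N r)%:R in lo N0 *.
set n' : R := (N _)%:R in hi sum_n.
have K : r * (n' - n) <= 16 * R0 * n.
  have h1 : n' - n <= 4 * R0 * r * a.
    have : (r + R0) ^+ 2 * a - (r - R0) ^+ 2 * a = 4 * R0 * r * a by ring.
    by lra.
  have h2 : r ^+ 2 * a <= 4 * n.
    have : (r / 2) ^+ 2 * a <= (r - R0) ^+ 2 * a.
      rewrite ler_pM2r//; apply: sqr_le_mono; first by rewrite divr_ge0// ltW.
      by lra.
    have -> : (r / 2) ^+ 2 * a = r ^+ 2 * a / 4 by field.
    by lra.
  have : r * (n' - n) <= r * (4 * R0 * r * a) by rewrite ler_pM2l.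
  have : 4 * R0 * (r ^+ 2 * a) <= 4 * R0 * (4 * n) by rewrite ler_pM2l ?mulr_gt0.
  by lra.
have K2 : n' - n <= 16 * R0 * n / r by rewrite ler_pdivlMr// mulrC.
have K3 : ln corner_ratio / 2 * (S - 6 * n) <= ln corner_ratio / 2 * (6 * (16 * R0 * n / r)).
  by rewrite ler_pM2l ?divr_gt0//; lra.
have -> : (c - 48 * R0 * ln corner_ratio / r) * n = c * n - ln corner_ratio / 2 * (6 * (16 * R0 * n / r)).
  by field; rewrite gt_eqF.
by rewrite lerB.
Qed.

Lemma Plog_inf_ge : (c%:E <= Plog_inf T)%E.
Proof.
apply: limf_einf_ge => e e0.
have lq : 0 < ln (@corner_ratio R) by rewrite ln_gt0// corner_ratio_gt1.
exists (Num.max (2 * R0) (48 * R0 * ln (@corner_ratio R) / e)) => r.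
rewrite gt_max => /andP[r1 r2]; rewrite lee_fin.
have r0 : 0 < r by rewrite (lt_trans _ r1)// mulr_gt0.
apply: le_trans (mean_log_perim_ge r1); rewrite lerB// ler_pdivrMr// [leRHS]mulrC.
by rewrite -ler_pdivrMr// ltW.
Qed.
End Counting.

Section normal_tilings.
Variable T : set (set plane).
Hypotheses (cT : convex_tiling T) (nT : normal_tiling T) (uT : unit_area_cells T).

Lemma tiling_cell C : T C -> cell C.
Proof.
case: cT => -[_ kT _ _] vT TC; have [kC iC] := kT C TC.
by split; [exact: kC|exact: (convex_setP (vT C TC))|exact: iC|exact: uT].
Qed.

Lemma tiling_disj C D : T C -> T D -> C <> D -> C° `&` D° = set0.
Proof. by case: cT => -[_ _ _ dT] _; exact: dT. Qed.

Lemma tiling_cover p : exists2 C, T C & C p.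
Proof.
case: cT => -[_ _ UT _] _; have : (\bigcup_(C in T) C) p by rewrite UT.
by move=> [C TC Cp]; exists C.
Qed.

Lemma tiling_small : exists2 R0 : R, 0 < R0 & forall C p u, T C -> C p -> C u -> edist p u <= R0.
Proof.
case: nT => r0 [R0 [/andP[r00 rR] H]].
exists (R0 + R0); first by rewrite addr_gt0// (lt_trans r00).
move=> C p u /H[_ [z Cz]] /Cz zp /Cz zu.
apply: le_trans (edist_triangle p z u) _; rewrite lerD// edistC; exact: zp.
Qed.

Lemma Plog_inf_lower_bound : ((ln (8 * Num.sqrt 3) / 2)%:E <= Plog_inf T)%E.
Proof.
have [R0 R00 HR] := tiling_small.
exact: (Plog_inf_ge tiling_cell tiling_disj tiling_cover R00 HR).
Qed.

Lemma has_Plog_of_equal_perim (l : R) : (forall C, T C -> perim C = l) -> has_Plog T (ln l).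
Proof.
have [R0 R00 HR] := tiling_small.
exact: (has_Plog_const tiling_cell tiling_disj tiling_cover HR).
Qed.
End normal_tilings.
End Limits.

(** * The regular honeycomb *)

Section Hexagon.
Context {R : realType}.
Local Notation mR := (measurableTypeR R).
Local Notation plane := (R * R)%type.
Implicit Types (p u v y t : plane) (A B C D : set plane).

Let s : R := Num.sqrt 3.
Let s0 : 0 < s. Proof. by rewrite sqrtr_gt0. Qed.
Let ss : s * s = 3. Proof. by rewrite -expr2 sqr_sqrtr. Qed.
Let sn0 : s != 0. Proof. by rewrite gt_eqF. Qed.
Let s1 : 1 <= s. Proof. by apply: sqr_le_inv; rewrite ?ltW// expr1n expr2 ss; lra. Qed.
Let s2 : s <= 2. Proof. by apply: sqr_le_inv => //; rewrite !expr2 ss; lra. Qed.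

(* The apothem of the regular hexagon of unit area. *)
Definition apothem : R := Num.sqrt (2 * Num.sqrt 3)^-1.
Local Notation a := apothem.

Lemma apothem_gt0 : 0 < a.
Proof. by rewrite sqrtr_gt0 invr_gt0 mulr_gt0. Qed.

(** A regular hexagon of apothem [a] has area [2 sqrt 3 a ^ 2]. *)
Lemma apothem_sqr : 2 * s * a ^+ 2 = 1.
Proof. by rewrite sqr_sqrtr ?invr_ge0 ?mulr_ge0 ?sqrtr_ge0// -/s mulfV// mulf_neq0. Qed.

(* [p.1], [hexn2 p] and [hexn3 p] are the inner products of [p] with unit normals
   of the three pairs of sides. *)
Definition hexn2 p : R := p.1 / 2 + Num.sqrt 3 / 2 * p.2.
Definition hexn3 p : R := - p.1 / 2 + Num.sqrt 3 / 2 * p.2.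

Definition hex t : set plane :=
  [set p | [/\ `|(p - t).1| <= a, `|hexn2 (p - t)| <= a & `|hexn3 (p - t)| <= a]].

Lemma hex_cvx t : cvx (hex t).
Proof.
move=> k p u /andP[k0 k1] [p1 p2 p3] [u1 u2 u3].
have H x z w : w = (1 - k) * x + k * z -> `|x| <= a -> `|z| <= a -> `|w| <= a.
  move=> -> xa za; apply: le_trans (ler_normD _ _) _.
  have k1' : 0 <= 1 - k by rewrite subr_ge0.
  rewrite !normrM (ger0_norm k0) (ger0_norm k1').
  have := ler_wpM2l k0 za; have := ler_wpM2l k1' xa; lra.
split.
- by apply: H p1 u1; rewrite /mix/=; ring.
- by apply: H p2 u2; rewrite /mix/hexn2/=; field.
- by apply: H p3 u3; rewrite /mix/hexn3/=; field.
Qed.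

Lemma cvx_convex_set C : cvx C -> convex_set (C : set (convex_lmodType plane)).
Proof.
move=> cC; apply/convex_setW => x y; rewrite !inE => Cx Cy k k0 k1.
suff -> : conv k (x : convex_lmodType plane) (y : convex_lmodType plane) = mix (1 - k%:num) x y.
  by rewrite inE; apply: cC => //; rewrite subr_ge0 ltW//= gerBl ltW.
transitivity (k%:num *: (x : plane) + (1 - k%:num) *: (y : plane)); first by [].
by rewrite /mix -[LHS]/(_, _)/= /GRing.scale/=; congr (_, _); ring.
Qed.

Lemma hex_closed t : closed (hex t).
Proof.
have cf (x z w : R) : closed [set p : plane | `|x * p.1 + z * p.2 + w| <= a].
  apply: (@preimage_closed _ _ (fun p : plane => `|x * p.1 + z * p.2 + w|) [set r | r <= a]) => [p _|]; last exact: closed_le.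
  apply: (@continuous_comp _ _ _ (fun p : plane => x * p.1 + z * p.2 + w) (fun x => `|x|)); last exact: norm_continuous.
  apply: cvgD; last exact: cvg_cst.
  by apply: cvgD; apply: cvgMr; [exact: cvg_fst|exact: cvg_snd].
have -> : hex t = [set p : plane | `|1 * p.1 + 0 * p.2 + - t.1| <= a] `&`
  ([set p : plane | `|1 / 2 * p.1 + s / 2 * p.2 + - hexn2 t| <= a] `&`
   [set p : plane | `|- 1 / 2 * p.1 + s / 2 * p.2 + - hexn3 t| <= a]).
  have E1 p : (p - t).1 = 1 * p.1 + 0 * p.2 + - t.1 by rewrite /=; ring.
  have E2 p : hexn2 (p - t) = 1 / 2 * p.1 + s / 2 * p.2 + - hexn2 t by rewrite /hexn2/s/=; field.
  have E3 p : hexn3 (p - t) = - 1 / 2 * p.1 + s / 2 * p.2 + - hexn3 t by rewrite /hexn3/s/=; field.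
  apply/seteqP; split=> p; first by move=> [h1 h2 h3]; split; [|split]; rewrite /mkset -?E1 -?E2 -?E3.
  by move=> [h1 [h2 h3]]; split; rewrite ?E1 ?E2 ?E3.
by apply: closedI; [|apply: closedI]; exact: cf.
Qed.

Lemma hex_compact t : compact (hex t).
Proof.
have a0 := apothem_gt0.
pose B := `[t.1 - 4 * a, t.1 + 4 * a]%classic `*` `[t.2 - 4 * a, t.2 + 4 * a]%classic.
apply: (@subclosed_compact _ _ B); first exact: hex_closed.
  by apply: compact_setX; exact: segment_compact.
move=> p [h1 h2 h3].
have E : s * (p.2 - t.2) = hexn2 (p - t) + hexn3 (p - t) by rewrite /hexn2 /hexn3 /s/=; field.
have h : `|p.2 - t.2| <= 2 * a.
  apply: (@le_trans _ _ (s * `|p.2 - t.2|)); first by rewrite ler_peMl.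
  rewrite -[s in leLHS](gtr0_norm s0) -normrM E; apply: le_trans (ler_normD _ _) _; lra.
move: h1 h; rewrite !ler_norml /= => /andP[? ?] /andP[? ?].
by split; rewrite /= in_itv/=; apply/andP; split; lra.
Qed.

Lemma hex_box t p : `|p.1 - t.1| <= a / 2 -> `|p.2 - t.2| <= a / 2 -> hex t p.
Proof.
have a0 := apothem_gt0; move=> h1 h2.
have h3 : `|s * (p.2 - t.2)| <= a.
  rewrite normrM gtr0_norm//; apply: (@le_trans _ _ (2 * (a / 2))); last by lra.
  by apply: ler_pM; [exact: ltW|exact: normr_ge0|exact: s2|exact: h2].
have E2 : hexn2 (p - t) = (p.1 - t.1) / 2 + s * (p.2 - t.2) / 2 by rewrite /hexn2/s/=; field.
have E3 : hexn3 (p - t) = - (p.1 - t.1) / 2 + s * (p.2 - t.2) / 2 by rewrite /hexn3/s/=; field.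
move: h1 h2 h3; rewrite !ler_norml => /andP[? ?] _ /andP[? ?].
by split; rewrite ?E2 ?E3 ?ler_norml/=; apply/andP; split; lra.
Qed.

Lemma hex_interior t : (hex t)° t.
Proof.
have a0 := apothem_gt0.
apply: (@box_interior _ _ _ (a / 2)); first by rewrite divr_gt0.
move=> x z xa za; apply: hex_box => /=.
  by rewrite addrAC subrr add0r ltW.
by rewrite addrAC subrr add0r ltW.
Qed.

(** A horizontal displacement changes all three functionals, so none of them can reach its bound at
    an interior point. *)
Lemma hex_interior_strict t p : (hex t)° p ->
  [/\ `|(p - t).1| < a, `|hexn2 (p - t)| < a & `|hexn3 (p - t)| < a].
Proof.
move=> /interior_box[e e0 Be].
have e2 : `|e / 2| < e by rewrite gtr0_norm ?divr_gt0//; lra.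
have e2' : `|- (e / 2)| < e by rewrite normrN.
have e00 : `|0 : R| < e by rewrite normr0.
have [] := Be _ _ e2 e00; have [] := Be _ _ e2' e00.
rewrite /hexn2 /hexn3 /= !ler_norml !ltr_norml.
move=> /andP[? ?] /andP[? ?] /andP[? ?] /andP[? ?] /andP[? ?] /andP[? ?].
by split; apply/andP; split; lra.
Qed.

Lemma hex_translate t : hex t = rescale (- t.1) (- t.2) 1 @^-1` hex 0.
Proof.
apply/seteqP; split=> p; rewrite /hex /hexn2 /hexn3 /rescale/= !mul1r !subr0 ![- _ + _]addrC; by [].
Qed.

(** The hexagon has vertical sides on [x = a] and [x = - a]; the vertical diagonal of half-length
    [2 a / sqrt 3] cuts it into two trapezoids. *)
Lemma hexE : hex 0 = trapezoid (- a) 0 (- (a / s)) (- 1 * s^-1) (a / s) (1 * s^-1) `|`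
   trapezoid 0 a (- (2 * a / s)) (1 * s^-1) (2 * a / s) (- 1 * s^-1).
Proof.
have a0 := apothem_gt0.
have El (x z b : R) : s * (- (x / s) + z * s^-1 * b) = - x + z * b by field.
have Eu (x z b : R) : s * (x / s + z * s^-1 * b) = x + z * b by field.
have L (x z b w : R) : (- (x / s) + z * s^-1 * b <= w) = (- x + z * b <= s * w).
  by rewrite -(ler_pM2l s0) El.
have U (x z b w : R) : (w <= x / s + z * s^-1 * b) = (s * w <= x + z * b).
  by rewrite -(ler_pM2l s0) Eu.
have s2E w : s / 2 * w = s * w / 2 by field.
apply/seteqP; split=> p.
  rewrite /hex /hexn2 /hexn3 /= !subr0 -/s !s2E !ler_norml => -[/andP[h1 h2] /andP[h3 h4] /andP[h5 h6]].
  have [p0|p0] := leP p.1 0; [left|right]; split; rewrite ?L ?U; apply/andP; split; lra.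
rewrite /hex /hexn2 /hexn3 /= !subr0 -/s !s2E !ler_norml.
by case=> -[/andP[h1 h2]]; rewrite L U => /andP[h3 h4]; split; apply/andP; split; lra.
Qed.

Lemma area_hex t : area (hex t) = 1%E.
Proof.
have a0 := apothem_gt0.
have mH : measurable (hex 0 : set (mR * mR)).
  by apply: closed_measurable2; exact: hex_closed.
transitivity (area (hex 0)).
  have := @area_rescale R (- t.1) (- t.2) 1 (hex 0) ltr01 mH.
  by rewrite expr1n mul1e -hex_translate.
have sa : s * a ^+ 2 = 2^-1 by move: apothem_sqr; lra.
set T1 := trapezoid (- a) 0 (- (a / s)) (- 1 * s^-1) (a / s) (1 * s^-1).
set T2 := trapezoid 0 a (- (2 * a / s)) (1 * s^-1) (2 * a / s) (- 1 * s^-1).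
have as0 : 0 < a / s by rewrite divr_gt0.
have a1 : area T1 = (2^-1)%:E.
  rewrite area_trapezoid; [|lra|lra|]; last first.
    by rewrite sub0r opprK !mulNr !mul1r [s^-1 * a]mulrC; lra.
  congr EFin; rewrite -[RHS]sa; transitivity ((s * s) * a ^+ 2 / s); last by field.
  by rewrite ss; field.
have a2 : area T2 = (2^-1)%:E.
  rewrite area_trapezoid; [|lra|lra|]; last first.
    by rewrite subr0 !mulNr !mul1r [s^-1 * a]mulrC; lra.
  congr EFin; rewrite -[RHS]sa; transitivity ((s * s) * a ^+ 2 / s); last by field.
  by rewrite ss; field.
have a3 : area (T1 `&` T2) = 0%E.
  apply/eqP; rewrite eq_le area_ge0 andbT.
  (* The two halves meet in the vertical diagonal, a trapezoid of width 0. *)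
  pose T3 : set plane := trapezoid 0 0 (- (2 * a / s)) 0 (2 * a / s) 0.
  apply: (@le_trans _ _ (area T3)); last first.
    by rewrite area_trapezoid ?lee_fin; lra.
  apply: area_le; [apply: measurableI; exact: trapezoid_measurable|exact: trapezoid_measurable|].
  move=> p [[/andP[_ h1] _] [/andP[h2 _] /andP[h3 h4]]].
  have p0 : p.1 = 0 by lra.
  move: h3 h4; rewrite p0 subr0 !mulr0 !addr0 => h3 h4.
  by split; rewrite ?p0 ?lexx//= subr0 !mul0r !addr0 h3.
have m1 : measurable (T1 : set (mR * mR)) by exact: trapezoid_measurable.
have m2 : measurable (T2 : set (mR * mR)) by exact: trapezoid_measurable.
have -> : area (hex 0) = (area T1 + area T2 - area (T1 `&` T2))%E.
  rewrite hexE; apply: (@measureUfinr _ _ _ (lebesgue_measure \x lebesgue_measure)%E) => //.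
  have : (area T2 < +oo)%E by rewrite a2 ltry.
  exact.
by rewrite a1 a2 a3 sube0 -EFinD; congr EFin; lra.
Qed.
End Hexagon.

(** * Perimeter of the hexagon and the tiling by its translates *)

Section HexagonalTiling.
Context {R : realType}.
Local Notation plane := (R * R)%type.
Implicit Types (p u v y t : plane) (A B C D : set plane).

Let s : R := Num.sqrt 3.
Let s0 : 0 < s. Proof. by rewrite sqrtr_gt0. Qed.
Let ss : s * s = 3. Proof. by rewrite -expr2 sqr_sqrtr. Qed.
Let sn0 : s != 0. Proof. by rewrite gt_eqF. Qed.
Local Notation a := (@apothem R).
Let a0 : 0 < a. Proof. exact: apothem_gt0. Qed.

Lemma edist_le_hex_norm p u :
  edist p u <= (`|(u - p).1| + `|hexn2 (u - p)| + `|hexn3 (u - p)|) / s.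
Proof.
set d := u - p; set x := d.1; set y := hexn2 d; set z := hexn3 d.
have zE : z = y - x by rewrite /z /y /x /hexn2 /hexn3; field.
have n0 : 0 <= (`|x| + `|y| + `|z|) / s by rewrite divr_ge0 ?addr_ge0// ltW.
apply: sqr_le_inv => //; rewrite edist_sqr exprMn exprVn (expr2 s) ss ler_pdivlMr//.
have -> : sqdist p u * 3 = 4 * (x ^+ 2 - x * y + y ^+ 2).
  have E : sqdist p u = d.1 ^+ 2 + d.2 ^+ 2 by rewrite /sqdist /d /=; ring.
  rewrite E /y /x /hexn2 -/s.
  transitivity (3 * d.1 ^+ 2 + s * s * d.2 ^+ 2); first by rewrite ss; ring.
  have S : 3 * d.1 ^+ 2 = (s * s) * d.1 ^+ 2 by rewrite ss.
  by field.
rewrite zE.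
(* The largest of [|x|], [|y|], [|y - x|] is the sum of the other two, and the two sides of the
   inequality differ by four times the product of these two. *)
have [x0|x0] := leP 0 x; have [y0|y0] := leP 0 y; have [xy|xy] := leP 0 (y - x).
all: rewrite ?(ger0_norm x0) ?(ger0_norm y0) ?(ltr0_norm x0) ?(ltr0_norm y0) ?(ger0_norm xy) ?(ltr0_norm xy) -subr_ge0.
- have -> : (x + y + (y - x)) ^+ 2 - 4 * (x ^+ 2 - x * y + y ^+ 2) = 4 * (x * (y - x)) by ring.
  by rewrite !mulr_ge0.
- have -> : (x + y + - (y - x)) ^+ 2 - 4 * (x ^+ 2 - x * y + y ^+ 2) = 4 * (y * - (y - x)) by ring.
  by rewrite !mulr_ge0// oppr_ge0 ltW.
- by exfalso; lra.
- have -> : (x + - y + - (y - x)) ^+ 2 - 4 * (x ^+ 2 - x * y + y ^+ 2) = 4 * (x * - y) by ring.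
  by rewrite !mulr_ge0// oppr_ge0 ltW.
- have -> : (- x + y + (y - x)) ^+ 2 - 4 * (x ^+ 2 - x * y + y ^+ 2) = 4 * (- x * y) by ring.
  by rewrite !mulr_ge0// oppr_ge0 ltW.
- by exfalso; lra.
- have -> : (- x + - y + (y - x)) ^+ 2 - 4 * (x ^+ 2 - x * y + y ^+ 2) = 4 * (- y * (y - x)) by ring.
  by rewrite !mulr_ge0// oppr_ge0 ltW.
- have -> : (- x + - y + - (y - x)) ^+ 2 - 4 * (x ^+ 2 - x * y + y ^+ 2) = 4 * (- x * - (y - x)) by ring.
  by rewrite !mulr_ge0// oppr_ge0 ltW.
Qed.

(** Each of the three functionals varies by at most [4 a], and [12 a / sqrt 3 = 4 sqrt 3 a] is the
    true perimeter of the hexagon. *)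
Lemma hex_closed_length n (v : 'I_n -> plane) : strictly_ccw v ->
  (forall i, hex 0 (v i)) -> closed_length v <= 4 * s * a.
Proof.
move=> ccw vH.
have TV (b c : R) (f : plane -> R) : (forall p, f p = b * p.1 + c * p.2) ->
    (forall i, `|f (v i)| <= a) -> \sum_i `|f (v (ordS i) - v i)| <= 4 * a.
  move=> fE fa; have := @functional_variation R n v b c (- a) a ccw => /= H.
  have -> : 4 * a = 2 * (a - - a) by ring.
  have -> : \sum_i `|f (v (ordS i) - v i)| = \sum_i `|b * (v (ordS i)).1 + c * (v (ordS i)).2 - (b * (v i).1 + c * (v i).2)|.
    by apply: eq_bigr => i _; rewrite fE /=; congr `|_|; ring.
  apply: H; first by move=> i; rewrite -ler_norml -fE.
  by rewrite (le_trans _ (ltW a0))// oppr_le0 ltW.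
have H1 := TV 1 0 (fun p => p.1); have H2 := TV (1 / 2) (s / 2) hexn2; have H3 := TV (- 1 / 2) (s / 2) hexn3.
have {}H1 : \sum_i `|(v (ordS i) - v i).1| <= 4 * a.
  by apply: H1 => [p|i]; [ring|have [+ _ _] := vH i; rewrite /= subr0].
have {}H2 : \sum_i `|hexn2 (v (ordS i) - v i)| <= 4 * a.
  by apply: H2 => [p|i]; [rewrite /hexn2 -/s; field|have [_ + _] := vH i; rewrite subr0].
have {}H3 : \sum_i `|hexn3 (v (ordS i) - v i)| <= 4 * a.
  by apply: H3 => [p|i]; [rewrite /hexn3 -/s; field|have [_ _ +] := vH i; rewrite subr0].
apply: (@le_trans _ _ (\sum_i (`|(v (ordS i) - v i).1| + `|hexn2 (v (ordS i) - v i)| + `|hexn3 (v (ordS i) - v i)|) / s)).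
  by apply: ler_sum => i _; exact: edist_le_hex_norm.
rewrite -mulr_suml ler_pdivrMr// !big_split/=.
have -> : 4 * s * a * s = 4 * (s * s) * a by ring.
by rewrite ss; lra.
Qed.

Lemma interior_translate C t p : (C°) p -> ([set x | C (x - t)]°) (p + t).
Proof.
move=> /interior_box[e e0 Be]; apply: (@box_interior _ _ _ e) => // x z xe ze.
by have := Be x z xe ze; congr C; rewrite -[RHS]/(_, _)/=; congr (_, _); ring.
Qed.

Lemma perim_translate C t : closed C -> closed [set x | C (x - t)] ->
  perim [set x | C (x - t)] = perim C.
Proof.
move=> cC cD; set D := [set x | _] in cD *.
have CD : C = [set x | D (x - - t)].
  by apply/seteqP; split=> x; rewrite /D/= opprK addrK.
have bd (A B : set plane) w p : closed A -> closed B -> B = [set x | A (x - w)] ->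
    boundary B p -> boundary A (p - w).
  move=> cA cB E [+ nB]; rewrite -(proj1 (closure_id B) cB) => Bp; split.
    by apply: subset_closure; move: Bp; rewrite E.
  by move=> /(interior_translate w); rewrite subrK -E.
have sub (A B : set plane) w l : closed A -> closed B -> B = [set x | A (x - w)] ->
    (exists n (v : 'I_n -> plane), [/\ forall i, boundary B (v i), strictly_ccw v & l = closed_length v]) ->
    exists n (v : 'I_n -> plane), [/\ forall i, boundary A (v i), strictly_ccw v & l = closed_length v].
  move=> cA cB E [n [v [vb vccw ->]]]; exists n, (fun i => v i - w); split.
  - by move=> i; exact: bd cA cB E (vb i).
  - move=> i j k ijk; have := vccw i j k ijk; rewrite /orient/=.
    by congr (0 < _); ring.
  - by apply: eq_bigr => i _; rewrite /edist/=; congr Num.sqrt; ring.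
congr sup; apply/seteqP; split=> l /=; first exact: (sub C D t).
exact: (sub D C (- t)).
Qed.

Lemma perim_hex t : perim (hex t) = perim (hex 0).
Proof.
have E : hex t = [set x | hex 0 (x - t)].
  by apply/seteqP; split=> x; rewrite /hex/= !subr0.
by rewrite E perim_translate//; [exact: hex_closed|rewrite -E; exact: hex_closed].
Qed.

Lemma ln_perim_hex_le : ln (perim (hex 0)) <= ln (8 * s) / 2.
Proof.
have kH := @hex_compact R 0.
have P : perim (hex 0) <= 4 * s * a.
  apply: ge_sup; first by case: (perim_has_sup kH).
  move=> _ [n [v [vb vccw ->]]]; apply: hex_closed_length => // i.
  by have [+ _] := vb i; rewrite -(proj1 (closure_id (hex 0)) (@hex_closed R 0)).
have s8 : 0 < 8 * s by rewrite mulr_gt0.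
(* The case of a zero perimeter is settled by the convention [ln 0 = 0], the right-hand side being
   nonnegative. *)
have := perim_ge0 kH; rewrite le_eqVlt => /predU1P[<-|P0].
  rewrite ln0// divr_ge0// ln_ge0//.
  have : 1 <= s by apply: sqr_le_inv; rewrite ?ltW// expr1n expr2 ss; lra.
  by lra.
rewrite ler_pdivlMr// mulr_natr -lnXn// ler_ln ?posrE ?exprn_gt0//.
apply: (@le_trans _ _ ((4 * s * a) ^+ 2)); first by rewrite ler_pXn2r // nnegrE ltW // (lt_le_trans P0 P).
have -> : (4 * s * a) ^+ 2 = 8 * s * (2 * s * a ^+ 2) by ring.
by rewrite apothem_sqr mulr1.
Qed.

Let an0 : a != 0. Proof. by rewrite gt_eqF. Qed.

(* The point [p] with [p.1 = a U] and [hexn2 p = a V]. *)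
Definition hexpt (U V : R) : plane := (a * U, a * (2 * V - U) / Num.sqrt 3).

Lemma hexpt_surj p : exists U V, p = hexpt U V.
Proof.
case: p => x y; exists (x / a), (hexn2 (x, y) / a); rewrite /hexpt /hexn2 -/s /=.
have E1 : x = a * (x / a) by rewrite mulrC mulfVK.
have E2 : y = a * (2 * ((x / 2 + s / 2 * y) / a) - x / a) / s by field; rewrite ?an0 ?sn0.
congr pair; [exact: E1|exact: E2].
Qed.

Lemma orient_hexpt (U V U' V' X Y : R) :
  orient (hexpt U V) (hexpt U' V') (hexpt X Y) =
  2 * a ^+ 2 / s * ((U' - U) * (Y - V) - (V' - V) * (X - U)).
Proof. by rewrite /orient /hexpt /= -/s; field. Qed.

(** In these oblique coordinates the hexagon has integer data, which reduces what follows to linear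
    arithmetic. *)
Lemma hex_hexptP (I J U V : R) : hex (hexpt I J) (hexpt U V) <->
  [/\ `|U - I| <= 1, `|V - J| <= 1 & `|(V - J) - (U - I)| <= 1].
Proof.
have H (x y : R) : y = a * x -> (`|y| <= a) = (`|x| <= 1).
  by move=> ->; rewrite normrM gtr0_norm// ger_pMr.
rewrite /hex/=.
rewrite (H (U - I)); last by rewrite /=; ring.
rewrite (H (V - J)); last by rewrite /hexn2 /= -/s; field.
by rewrite (H ((V - J) - (U - I))); last by rewrite /hexn3 /= -/s; field.
Qed.

Lemma hexpt0 : hexpt 0 0 = 0.
Proof. by rewrite /hexpt subr0 !mulr0 mul0r. Qed.

(** Counterclockwise from the lower end of the right-hand vertical side. *)
Definition hexvertex (i : 'I_6) : plane :=
  hexpt (nth 0 [:: 1; 1; 0; -1; -1; 0] i) (nth 0 [:: 0; 1; 1; 0; -1; -1] i).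

Lemma hexvertex_ccw : weakly_ccw hexvertex.
Proof.
split.
  have E U V : hexn2 (hexpt U V) = a * V by rewrite /hexn2 /hexpt /= -/s; field.
  move=> i j ij; have := congr1 hexn2 ij; have := congr1 fst ij.
  rewrite !E => /(mulfI an0) EU /(mulfI an0) EV {ij}.
  apply: val_inj; move: i j EU EV.
  case=> [[|[|[|[|[|[|//]]]]]] ?] [[|[|[|[|[|[|//]]]]]] ?] //= ? ?; exfalso; lra.
have c0 : 0 < 2 * a ^+ 2 / s by rewrite divr_gt0// mulr_gt0// exprn_gt0.
move=> i j k ijk; rewrite orient_hexpt pmulr_rge0//; move: i j k ijk.
by case=> [[|[|[|[|[|[|//]]]]]] ?] [[|[|[|[|[|[|//]]]]]] ?] [[|[|[|[|[|[|//]]]]]] ?] //= _; lra.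
Qed.

Lemma hexvertex_hull (b c d e f g U V : R) :
  [/\ 0 <= b, 0 <= c & 0 <= d] -> [/\ 0 <= e, 0 <= f & 0 <= g] ->
  b + c + d + e + f + g = 1 -> U = b + c - e - f -> V = c + d - f - g ->
  convex_hull hexvertex (hexpt U V).
Proof.
move=> [h1 h2 h3] [h4 h5 h6] S EU EV; exists (fun i : 'I_6 => nth 0 [:: b; c; d; e; f; g] i); split.
- by case=> [[|[|[|[|[|[|//]]]]]] ?].
- by rewrite !big_ord_recl big_ord0/=; lra.
- rewrite !big_ord_recl big_ord0/= /hexvertex /hexpt /= -[RHS]/(_, _) /= /GRing.scale/=.
  by congr (_, _); rewrite ?EU ?EV -/s; field; rewrite ?an0 ?sn0.
Qed.

Lemma hex_hull : hex 0 = convex_hull hexvertex.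
Proof.
apply/seteqP; split=> p.
  have [U [V ->]] := hexpt_surj p.
  rewrite -{1}hexpt0 hex_hexptP !subr0 !ler_norml => -[/andP[? ?] /andP[? ?] /andP[? ?]].
  (* The signs of [U], [V] and [V - U] select the two adjacent vertices spanning, with the centre, a
     triangle that contains the point. The weight of the centre is shared equally by the opposite
     vertices number 0 and 3. *)
  have [U0|U0] := leP 0 U; have [V0|V0] := leP 0 V; have [UV|UV] := leP U V.
  - apply: (@hexvertex_hull ((1 - V) / 2) U (V - U) ((1 - V) / 2) 0 0); try (by split; lra); lra.
  - apply: (@hexvertex_hull (U - V + (1 - U) / 2) V 0 ((1 - U) / 2) 0 0); try (by split; lra); lra.
  - by exfalso; lra.
  - apply: (@hexvertex_hull (U + (1 - U + V) / 2) 0 0 ((1 - U + V) / 2) 0 (- V)); try (by split; lra); lra.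
  - apply: (@hexvertex_hull ((1 - V + U) / 2) 0 V (- U + (1 - V + U) / 2) 0 0); try (by split; lra); lra.
  - by exfalso; lra.
  - apply: (@hexvertex_hull ((1 + U) / 2) 0 0 (V - U + (1 + U) / 2) (- V) 0); try (by split; lra); lra.
  - apply: (@hexvertex_hull ((1 + V) / 2) 0 0 ((1 + V) / 2) (- U) (U - V)); try (by split; lra); lra.
move=> [w [w0 w1 ->]].
have -> : \sum_i w i *: hexvertex i = hexpt (\sum_i w i * nth 0 [:: 1; 1; 0; -1; -1; 0] i)
    (\sum_i w i * nth 0 [:: 0; 1; 1; 0; -1; -1] i).
  rewrite !big_ord_recl !big_ord0/= /hexvertex /hexpt /= -[LHS]/(_, _) /= /GRing.scale/=.
  by congr (_, _); rewrite -/s; field.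
rewrite -hexpt0 hex_hexptP; move: w1; rewrite !big_ord_recl !big_ord0/=.
set x1 := w _; set x2 := w _; set x3 := w _; set x4 := w _; set x5 := w _; set x6 := w _ => S.
have [? ? ?] : [/\ 0 <= x1, 0 <= x2 & 0 <= x3] by split; exact: w0.
have [? ? ?] : [/\ 0 <= x4, 0 <= x5 & 0 <= x6] by split; exact: w0.
by rewrite !ler_norml; split; apply/andP; split; lra.
Qed.

Lemma convex_hexagon_hex : convex_hexagon (hex (0 : plane)).
Proof.
split; first by exists 0; exact: hex_interior.
by exists hexvertex; split; [exact: hexvertex_ccw|exact: hex_hull].
Qed.

Lemma centrally_symmetric_hex : centrally_symmetric (hex (0 : plane)).
Proof.
exists 0 => p [h1 h2 h3]; rewrite mul0rn sub0r.
have N2 u : hexn2 (- u) = - hexn2 u by rewrite /hexn2/=; ring.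
have N3 u : hexn3 (- u) = - hexn3 u by rewrite /hexn3/=; field.
by move: h1 h2 h3; rewrite /hex/= !subr0 N2 N3 !normrN.
Qed.

(** In the oblique coordinates the centres are exactly the integer points whose coordinate sum is
    divisible by 3. *)
Definition hexcenter (m n : int) : plane := hexpt (2 * m + n)%:~R (m + 2 * n)%:~R.

Definition honeycomb : set (set plane) := [set C | exists m n : int, C = hex (hexcenter m n)].

(** The residue of [i + j] modulo 3 tells which corner of the unit square at [(i, j)] is a centre:
    [(i, j)] for 0, [(i + 1, j + 1)] for 1. For 2 both other corners are centres, and the diagonal
    decides between them. *)
Lemma honeycomb_cover p : exists2 C, honeycomb C & C p.
Proof.
have [U [V ->]] := hexpt_surj p.
have := Num.Theory.floor_itv U; have := Num.Theory.floor_itv V.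
set i := Num.floor U; set j := Num.floor V; rewrite !intrD => /andP[j1 j2] /andP[i1 i2].
have C (x y k : int) : x + y = 3 * k -> `|U - x%:~R| <= 1 -> `|V - y%:~R| <= 1 ->
    `|(V - y%:~R) - (U - x%:~R)| <= 1 -> exists2 C, honeycomb C & C (hexpt U V).
  move=> xyk h1 h2 h3; exists (hex (hexcenter (x - k) (y - k))); first by exists (x - k), (y - k).
  rewrite /hexcenter.
  have -> : 2 * (x - k) + (y - k) = x by lia.
  have -> : x - k + 2 * (y - k) = y by lia.
  by rewrite hex_hexptP.
have [k [E|[E|E]]] : exists k : int, i + j = 3 * k \/ i + j = 3 * k + 1 \/ i + j = 3 * k + 2.
- by exists ((i + j) %/ 3)%Z; lia.
- by apply: (C i j k) => //; rewrite ler_norml; apply/andP; split; lra.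
- by apply: (C (i + 1) (j + 1) (k + 1)); [lia|..]; rewrite !intrD ler_norml; apply/andP; split; lra.
have [UV|UV] := leP (V - j%:~R) (U - i%:~R).
- by apply: (C (i + 1) j (k + 1)); [lia|..]; rewrite ?intrD ler_norml; apply/andP; split; lra.
- by apply: (C i (j + 1) (k + 1)); [lia|..]; rewrite ?intrD ler_norml; apply/andP; split; lra.
Qed.

(** A common interior point forces the coordinates of the difference of the centres, and the
    difference of these coordinates, into -1, 0, 1; as their sum is divisible by 3, they vanish. *)
Lemma honeycomb_disj (m n m' n' : int) p :
  (hex (hexcenter m n))° p -> (hex (hexcenter m' n'))° p -> m = m' /\ n = n'.
Proof.
have [U [V ->]] := hexpt_surj p.
have H (I J : R) : (hex (hexpt I J))° (hexpt U V) -> [/\ `|U - I| < 1, `|V - J| < 1 & `|(V - J) - (U - I)| < 1].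
  have N (x y : R) : y = a * x -> (`|y| < a) = (`|x| < 1).
    by move=> ->; rewrite normrM gtr0_norm// gtr_pMr.
  move=> /hex_interior_strict.
  rewrite (N (U - I)); last by rewrite /=; ring.
  rewrite (N (V - J)); last by rewrite /hexn2 /= -/s; field.
  by rewrite (N ((V - J) - (U - I))); last by rewrite /hexn3 /= -/s; field.
have K (x y x' y' : int) : (hex (hexpt x%:~R y%:~R))° (hexpt U V) -> (hex (hexpt x'%:~R y'%:~R))° (hexpt U V) ->
    [/\ x < x' + 2, y < y' + 2 & y - x < y' - x' + 2].
  move=> /H[]; rewrite !ltr_norml => /andP[? ?] /andP[? ?] /andP[? ?].
  move=> /H[]; rewrite !ltr_norml => /andP[? ?] /andP[? ?] /andP[? ?].
  by split; rewrite -(ltr_int R) intrD ?intrB; lra.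
move=> h h'; have [h1 h2 h3] := K _ _ _ _ h h'; have [h4 h5 h6] := K _ _ _ _ h' h.
by split; clear -h1 h2 h3 h4 h5 h6; lia.
Qed.

Lemma honeycomb_tiling : tiling honeycomb.
Proof.
split.
- have -> : honeycomb = [set hex (hexcenter z.1 z.2) | z in [set: int * int]].
    apply/seteqP; split=> C; first by move=> [m [n ->]]; exists (m, n).
    by move=> [[m n] _ <-]; exists m, n.
  exact: sub_countable (card_image_le _ _) (countableP _).
- move=> _ [m [n ->]]; split; first exact: hex_compact.
  by exists (hexcenter m n); exact: hex_interior.
- apply/seteqP; split=> // p _; have [C TC Cp] := honeycomb_cover p.
  by exists C.
- move=> _ _ [m [n ->]] [m' [n' ->]] ne; apply/seteqP; split=> // p [h h'].
  by have [E E'] := honeycomb_disj h h'; case: ne; rewrite E E'.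
Qed.

Lemma honeycomb_hexagonal : hexagonal_tiling honeycomb.
Proof.
split; first exact: honeycomb_tiling.
exists (hex 0); split; [exact: convex_hexagon_hex|exact: centrally_symmetric_hex|].
move=> _ [m [n ->]]; exists (hexcenter m n); set t := hexcenter m n.
apply/seteqP; split=> p.
  by move=> tp; exists (p - t); [rewrite /hex/= !subr0|rewrite addrC subrK].
by move=> [u u0 <-]; move: u0; rewrite /hex /mkset subr0 [t + u]addrC addrK.
Qed.

Lemma honeycomb_convex : convex_tiling honeycomb.
Proof.
split; first exact: honeycomb_tiling.
by move=> _ [m [n ->]]; apply: cvx_convex_set; exact: hex_cvx.
Qed.

Lemma honeycomb_normal : normal_tiling honeycomb.
Proof.
have s1 : 1 <= s by apply: sqr_le_inv; rewrite ?ltW// expr1n expr2 ss; lra.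
(* The inner radius comes from [hex_box]; the outer one bounds the three terms of
   [edist_le_hex_norm] by [a] each and uses [sqrt 3 >= 1]. *)
exists (a / 2), (3 * a); split; first by apply/andP; split; have := a0; lra.
move=> _ [m [n ->]]; split; exists (hexcenter m n); set t := hexcenter m n => p.
  rewrite /disk/= => tp; have [h1 h2] := edist_coord_le t p.
  by apply: hex_box; [exact: le_trans h1 tp|exact: le_trans h2 tp].
move=> [h1 h2 h3]; rewrite /disk/=; apply: le_trans (edist_le_hex_norm _ _) _.
rewrite ler_pdivrMr//; apply: (@le_trans _ _ (3 * a * 1)); first by lra.
by rewrite ler_pM2l// mulr_gt0.
Qed.

Lemma honeycomb_area : unit_area_cells honeycomb.
Proof. by move=> _ [m [n ->]]; exact: area_hex. Qed.

Lemma honeycomb_perim C : honeycomb C -> perim C = perim (hex 0).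
Proof. by move=> [m [n ->]]; exact: perim_hex. Qed.
End HexagonalTiling.

Theorem corollary1p10 (R : realType) :
  exists (Thex : set (set (R * R))) (P : R),
    [/\ hexagonal_tiling Thex,
        unit_area_cells Thex,
        has_Plog Thex P &
        forall T : set (set (R * R)),
          convex_tiling T -> normal_tiling T -> unit_area_cells T ->
          (P%:E <= Plog_inf T)%E].
Proof.
(* The limit is the logarithm of the perimeter as it is defined, so comparing it with the lower
   bound takes only an upper estimate of this perimeter. *)
exists honeycomb, (ln (perim (hex 0))); split.
- exact: honeycomb_hexagonal.
- exact: honeycomb_area.
- apply: has_Plog_of_equal_perim; [exact: honeycomb_convex|exact: honeycomb_normal|exact: honeycomb_area|exact: honeycomb_perim].
- move=> T cT nT uT; apply: le_trans (Plog_inf_lower_bound cT nT uT).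
  by rewrite lee_fin; exact: ln_perim_hex_le.
Qed.
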